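(* Let $p>2$, let $\mathcal{G}\in\mathbf{G}$ be a noncompact graph, let $Z\subseteq \mathbb{V}\setminus\mathbb{V}_\infty$ be a set of vertices of degree $1$, and let $\lambda>-\omega_Z(\mathcal{G})$. (i) If $$\inf_{v\in\mathcal{N}_{\lambda,Z}(\mathcal{G})}J_\lambda(v)<J_\lambda^\infty(\mathcal{G};Z),$$ then there exists a ground state of $J_\lambda$ in $\mathcal{N}_{\lambda,Z}(\mathcal{G})$. Moreover, ground states have constant sign on $\mathcal{G}\setminus Z$ (i.e. each is either everywhere positive or everywhere negative there). (ii) If $$\inf_{v\in\mathcal{M}_{\lambda,Z}(\mathcal{G})}J_\lambda(v)<J_\lambda^\infty(\mathcal{G};Z)+\inf_{v\in\mathcal{N}_{\lambda,Z}(\mathcal{G})}J_\lambda(v),$$ then there exists a nodal ground state of $J_\lambda$ in $\mathcal{M}_{\lambda,Z}(\mathcal{G})$.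
   Context: $\mathbf{G}$ is the class of connected metric graphs $\mathcal{G}=(\mathbb{V},\mathbb{E})$ with at most countably many edges and vertices, every vertex of finite degree, and edge lengths bounded away from $0$: $\inf_{e\in\mathbb{E}}\ell_e>0$. Edges are bounded intervals or half-lines; each half-line is considered to end at a vertex at infinity of degree $1$, $\mathbb{V}_\infty$ is the set of these vertices, and they are not points of the metric space $\mathcal{G}$. $\mathcal{G}$ is noncompact if it has at least one half-line or infinitely many edges. $Z\subseteq\mathbb{V}\setminus\mathbb{V}_\infty$ is a (possibly empty or infinite) set of degree $1$ vertices. $H^1(\mathcal{G})$ is the space of continuous real functions on $\mathcal{G}$ that are $H^1$ on each edge with finite total $H^1$ norm, and $H^1_Z(\mathcal{G})=\{u\in H^1(\mathcal{G}): u(\mathrm{v})=0\ \forall\,\mathrm{v}\in Z\}$. Define $$\omega_Z(\mathcal{G})=\inf_{v\in H^1_Z(\mathcal{G})\setminus\{0\}}\frac{\|v'\|_{L^2(\mathcal{G})}^2}{\|v\|_{L^2(\mathcal{G})}^2},\qquad J_\lambda(u)=\tfrac12\|u'\|_{L^2(\mathcal{G})}^2+\tfrac{\lambda}{2}\|u\|_{L^2(\mathcal{G})}^2-\tfrac1p\|u\|_{L^p(\mathcal{G})}^p ,$$ $$\mathcal{N}_{\lambda,Z}(\mathcal{G})=\{u\in H^1_Z(\mathcal{G}): u\neq0,\ \|u'\|_{L^2}^2+\lambda\|u\|_{L^2}^2=\|u\|_{L^p}^p\},$$ $$\mathcal{M}_{\lambda,Z}(\mathcal{G})=\{u\in H^1_Z(\mathcal{G}):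 u^+,u^-\in\mathcal{N}_{\lambda,Z}(\mathcal{G})\},\quad u^+=\max(u,0),\ u^-=\min(u,0).$$ A ground state is $u\in\mathcal{N}_{\lambda,Z}(\mathcal{G})$ with $J_\lambda(u)=\inf_{\mathcal{N}_{\lambda,Z}(\mathcal{G})}J_\lambda$; a nodal ground state is $u\in\mathcal{M}_{\lambda,Z}(\mathcal{G})$ with $J_\lambda(u)=\inf_{\mathcal{M}_{\lambda,Z}(\mathcal{G})}J_\lambda$. The level at infinity is $$J_\lambda^\infty(\mathcal{G};Z)=\inf\Bigl\{\liminf_n J_\lambda(u_n): (u_n)_n\subseteq\mathcal{N}_{\lambda,Z}(\mathcal{G}),\ u_n\rightharpoonup0\text{ weakly in }H^1_Z(\mathcal{G})\Bigr\}.$$ *)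

(* Defs.v *)
From Stdlib Require Import Relation_Operators.
From HB Require Import structures.
From mathcomp Require Import all_boot all_order all_algebra.
From mathcomp Require Import finmap.
From mathcomp Require Import all_classical all_reals all_analysis.

Set Implicit Arguments.
Unset Strict Implicit.
Unset Printing Implicit Defensive.

Import Order.TTheory GRing.Theory Num.Theory.
Import numFieldNormedType.Exports.

Local Open Scope classical_set_scope.
Local Open Scope ring_scope.

(* An edge [e] is parametrized by arc length from [origin e] to [terminus e];
   half-lines are the edges with [edge_length e = +oo], and they end at their
   vertex at infinity.  Loops and multiple edges are allowed. *)
Record metric_graph (R : realType) := MetricGraph {
  vertex : countType;
  edge : countType;
  origin : edge -> vertex;
  terminus : edge -> vertex;
  edge_length : edge -> \bar R
}.

Section Graph.
Variables (R : realType) (G : metric_graph R).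

Definition infinity_vertices : set (vertex G) :=
  [set v | exists2 e : edge G, edge_length e = +oo%E & terminus e = v].

(* The ends of edges at [v]; a loop contributes two of them. *)
Definition incident_ends (v : vertex G) : set (edge G * bool) :=
  [set d | (if d.2 then terminus d.1 else origin d.1) = v].

(* Meaningful only when [incident_ends v] is finite ([fset_set] sends infinite
   sets to the empty one). *)
Definition vertex_degree (v : vertex G) : nat := #|` fset_set (incident_ends v)|.

Definition adjacent (v w : vertex G) : Prop :=
  exists e : edge G, origin e = v /\ terminus e = w.

Definition graph_connected : Prop :=
  forall v w : vertex G, clos_refl_sym_trans (vertex G) adjacent v w.

Definition class_G : Prop :=
  [/\ graph_connected,
      forall v : vertex G, finite_set (incident_ends v),
      (0 < ereal_inf (range (@edge_length R G)))%E
    & forall e : edge G,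
        edge_length e = +oo%E -> vertex_degree (terminus e) = 1%N].

Definition noncompact_graph : Prop :=
  (exists e : edge G, edge_length e = +oo%E) \/ infinite_set [set: edge G].

(* The points of the metric space: vertices not at infinity, and pairs of an edge
   and an interior coordinate on it. *)
Definition is_point (q : vertex G + edge G * R) : bool :=
  match q with
  | inl v => v \notin infinity_vertices
  | inr (e, x) => (0 < x) && (x%:E < edge_length e)%E
  end.

Definition graph_point : Type := {q : vertex G + edge G * R | is_point q}.

Definition vertex_points (Z : set (vertex G)) : set graph_point :=
  [set q | exists2 v, Z v & val q = inl v].

Definition edge_coord (e : edge G) (x : R) : vertex G + edge G * R :=
  if x <= 0 then inl (origin e)
  else if (edge_length e <= x%:E)%E then inl (terminus e)
  else inr (e, x).

(* The restriction of [u] to the edge [e], as a function of arc length.  When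
   [class_G] holds, [edge_coord e x] is always a point (see [edge_coordP]), so
   the default value [0] is never used. *)
Definition on_edge (u : graph_point -> R) (e : edge G) (x : R) : R :=
  if insub (edge_coord e x) is Some q then u q else 0.

Definition edge_interior (e : edge G) : set R :=
  [set x | (0 < x) && (x%:E < edge_length e)%E].

Definition edge_closure (e : edge G) : set R :=
  [set x | (0 <= x) && (x%:E <= edge_length e)%E].

(* As degrees are finite and lengths bounded away from 0, a function is
   continuous on the metric space iff it is continuous along every closed edge;
   agreement at a vertex is built in, [u] having a single value there. *)
Definition graph_continuous (u : graph_point -> R) : Prop :=
  forall e : edge G, {within edge_closure e, continuous (on_edge u e)}.

End Graph.

Section Sobolev_interval.
Variable R : realType.
Local Notation mu := (@lebesgue_measure R).

Definition C1c (D : set R) (phi : R -> R) : Prop :=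
  [/\ forall x, derivable phi x 1,
      continuous (derive1 phi)
    & exists K : set R,
        [/\ compact K, K `<=` D & forall x, ~ K x -> phi x = 0]].

Definition square_integrable (D : set R) (g : R -> R) : Prop :=
  measurable_fun D g /\
  (\int[mu]_(x in D) (`|g x| `^ 2)%:E < +oo)%E.

Definition is_weak_derivative (D : set R) (f g : R -> R) : Prop :=
  forall phi : R -> R, C1c D phi ->
    \int[mu]_(x in D) (f x * derive1 phi x) = - \int[mu]_(x in D) (g x * phi x).

Definition L2_weak_derivatives (D : set R) (f : R -> R) : set (R -> R) :=
  [set g | square_integrable D g /\ is_weak_derivative D f g].

Definition H1_interval (D : set R) (f : R -> R) : Prop :=
  square_integrable D f /\ L2_weak_derivatives D f !=set0.

(* A representative of the weak derivative, unique up to a null subset of [D]. *)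
Definition weak_derivative (D : set R) (f : R -> R) : R -> R :=
  xget (cst 0) (L2_weak_derivatives D f).

End Sobolev_interval.

Section Energy.
Variables (R : realType) (G : metric_graph R).
Local Notation mu := (@lebesgue_measure R).

(* $\|f\|_{L^q}^q$ (not its [q]-th root), for [f] given edgewise. *)
Definition Lpow (q : R) (f : edge G -> R -> R) : \bar R :=
  (\esum_(e in [set: edge G])
     \int[mu]_(x in edge_interior e) (`|f e x| `^ q)%:E)%E.

Definition graph_derivative (u : graph_point G -> R) (e : edge G) : R -> R :=
  weak_derivative (edge_interior e) (on_edge u e).

Definition H1 : set (graph_point G -> R) :=
  [set u | [/\ graph_continuous u,
               forall e : edge G, H1_interval (edge_interior e) (on_edge u e),
               (Lpow 2 (on_edge u) < +oo)%E
             & (Lpow 2 (graph_derivative u) < +oo)%E]].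

Definition H1Z (Z : set (vertex G)) : set (graph_point G -> R) :=
  [set u | H1 u /\ forall q : graph_point G, vertex_points Z q -> u q = 0].

Definition normL2sq (u : graph_point G -> R) : R := fine (Lpow 2 (on_edge u)).

Definition normL2sq_deriv (u : graph_point G -> R) : R :=
  fine (Lpow 2 (graph_derivative u)).

Definition normLp_pow (p : R) (u : graph_point G -> R) : R := fine (Lpow p (on_edge u)).

Definition H1_norm (u : graph_point G -> R) : R :=
  Num.sqrt (normL2sq_deriv u + normL2sq u).

Definition omega_Z (Z : set (vertex G)) : \bar R :=
  ereal_inf [set (normL2sq_deriv v / normL2sq v)%:E |
              v in [set v | H1Z Z v /\ v <> cst 0]].

Definition action_functional (p lambda : R) (u : graph_point G -> R) : R :=
  1 / 2 * normL2sq_deriv u + lambda / 2 * normL2sq u - 1 / p * normLp_pow p u.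

Definition Nehari (p lambda : R) (Z : set (vertex G)) : set (graph_point G -> R) :=
  [set u | [/\ H1Z Z u, u <> cst 0
             & normL2sq_deriv u + lambda * normL2sq u = normLp_pow p u]].

Definition nodal_Nehari (p lambda : R) (Z : set (vertex G)) :
    set (graph_point G -> R) :=
  [set u | [/\ H1Z Z u,
               Nehari p lambda Z (fun q => Num.max (u q) 0)
             & Nehari p lambda Z (fun q => Num.min (u q) 0)]].

Definition action_level (p lambda : R) (A : set (graph_point G -> R)) : \bar R :=
  ereal_inf [set (action_functional p lambda u)%:E | u in A].

Definition is_ground_state (p lambda : R) (Z : set (vertex G))
    (u : graph_point G -> R) : Prop :=
  Nehari p lambda Z u /\
  (action_functional p lambda u)%:E = action_level p lambda (Nehari p lambda Z).

Definition is_nodal_ground_state (p lambda : R) (Z : set (vertex G))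
    (u : graph_point G -> R) : Prop :=
  nodal_Nehari p lambda Z u /\
  (action_functional p lambda u)%:E = action_level p lambda (nodal_Nehari p lambda Z).

(* The topological dual of $H^1_Z$; values outside [H1Z Z] are irrelevant. *)
Definition H1Z_dual (Z : set (vertex G)) : set ((graph_point G -> R) -> R) :=
  [set F | (forall (a : R) (u v : graph_point G -> R), H1Z Z u -> H1Z Z v ->
              F (fun q => a * u q + v q) = a * F u + F v) /\
           exists C : R, forall u, H1Z Z u -> `|F u| <= C * H1_norm u].

Definition weakly_null (Z : set (vertex G)) (u : nat -> graph_point G -> R) : Prop :=
  (forall n, H1Z Z (u n)) /\
  forall F, H1Z_dual Z F -> (fun n => F (u n)) @ \oo --> (0 : R).

Definition level_at_infinity (p lambda : R) (Z : set (vertex G)) : \bar R :=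
  ereal_inf [set limn_einf (fun n => (action_functional p lambda (u n))%:E) |
              u in [set u : nat -> graph_point G -> R |
                     (forall n, Nehari p lambda Z (u n)) /\ weakly_null Z u]].

End Energy.

Lemma edge_coordP (R : realType) (G : metric_graph R) (e : edge G) (x : R) :
  class_G G -> is_point (edge_coord e x).
Proof.
case=> _ fin _ deg1.
have uniq_end v (d d' : edge G * bool) : vertex_degree v = 1%N ->
    incident_ends v d -> incident_ends v d' -> d = d'.
  rewrite /vertex_degree => /eqP /cardfs1P [d0 E] vd vd'.
  have mem d1 : incident_ends v d1 -> d1 = d0.
    move=> vd1; apply/eqP; rewrite -in_fset1 -E in_fset_set ?inE //.
  by rewrite (mem d vd) (mem d' vd').
rewrite /edge_coord; case: ifPn => [_|/=].
  rewrite /=; apply/negP; rewrite inE => -[e' e'oo te'].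
  have [//] : (e', true) = (e, false).
  exact: (uniq_end (terminus e') _ _ (deg1 _ e'oo)).
rewrite -ltNge => x0; case: ifPn => [lex|]; last first.
  by rewrite -ltNge /= x0.
rewrite /=; apply/negP; rewrite inE => -[e' e'oo te'].
have [E] : (e', true) = (e, true).
  exact: (uniq_end (terminus e') _ _ (deg1 _ e'oo)).
by move: lex; rewrite -E e'oo.
Qed.

(* Main.v *)
Require Import Defs.
From HB Require Import structures.
From mathcomp Require Import all_boot all_order all_algebra.
From mathcomp Require Import all_classical all_reals all_analysis.
From mathcomp Require Import measurable_realfun ring lra.

Set Implicit Arguments.
Unset Strict Implicit.
Unset Printing Implicit Defensive.

Import Order.TTheory GRing.Theory Num.Theory.
Import numFieldNormedType.Exports.

Local Open Scope classical_set_scope.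
Local Open Scope ring_scope.

(** The Nehari problem only uses the quadratic forms of ||u'||^2 and ||u||^2 and
    the p-th power of the L^p norm, so the existence part lives in an abstract
    Hilbert space of functions on a set.  A minimizing sequence u_n in the Nehari
    set is bounded, because lambda > - omega_Z makes Q(u) = ||u'||^2 + lambda ||u||^2
    coercive; along a subsequence it converges pointwise to some u in H^1_Z.  On
    bounded sequences pointwise convergence implies weak convergence (Mazur), so a
    vanishing limit would force the level to be at least the level at infinity.  If
    u <> 0 and Q(u) <= ||u||_p^p, rescaling u into the Nehari set gives a minimizer.
    Otherwise, by the Brezis-Lieb lemma, w_n = u_n - u eventually satisfies
    Q(w_n) < ||w_n||_p^p, and rescaling w_n, which is weakly null, again gives the
    level at infinity.  For nodal states the same alternative is applied to u_n^+
    and u_n^- separately.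

    A ground state that changed sign could be improved by rescaling u^+ or u^-.  A
    nonnegative ground state satisfies Q(u, v) >= 0 for all v >= 0; testing with
    tents centred at a zero of u bounds the sum of the values of u at distance h on
    the edges issuing from that zero by |lambda| h times the integral of u over the
    tent's support, hence u vanishes near that zero.  Connectedness then gives
    u = 0. *)

(** * Square-integrable functions and the Brezis-Lieb lemma *)

(** Two obstacles shape the development. [graph_derivative] picks an arbitrary weak derivative on
    each edge, so it is linear only up to null sets; functions of H^1 are therefore handled as
    primitives, in integral form, of a square-integrable gradient ([weak_grad]). And weak
    compactness is never invoked: pointwise limits come from a common Hoelder modulus and a diagonal
    extraction, and Mazur averages, strongly convergent by the parallelogram identity, recover what
    weak limits would give. The alternative rests on a count. If Q(u_n) -> alpha, then Q(w_n) ->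
    alpha - Q(u) because the cross term tends to 0, and ||w_n||_p^p -> alpha - ||u||_p^p because
    Q(u_n) = ||u_n||_p^p; so a sign of Q(u) - ||u||_p^p that is bad for u is good for w_n. On the
    Nehari set J = (1/2 - 1/p) Q, and a scaling factor at most 1 does not raise Q, so energies are
    compared through Q alone. Q(u, v) >= 0 comes from the one-sided variations u + t v, which do not
    lower the L^p norm; hence positivity is reached without the Euler-Lagrange equation or
    regularity of u. *)

Section SquareIntegrable.
Context d (T : measurableType d) (R : realType).
Variable mu : {measure set T -> \bar R}.
Implicit Types f g h : T -> R.

(** Genuine functions rather than classes modulo null sets, because pointwise limits matter later;
    equality almost everywhere enters explicitly through [sqi_ae]. *)
Definition sqi f : Prop :=
  measurable_fun setT f /\ mu.-integrable setT (fun x => (f x ^+ 2)%:E).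

Definition ip f g : R := \int[mu]_x (f x * g x).

Lemma integrable_lin (D : set T) (a : R) f g : measurable D ->
  mu.-integrable D (EFin \o f) -> mu.-integrable D (EFin \o g) ->
  mu.-integrable D (EFin \o (fun x => a * f x + g x)).
Proof.
move=> mD If Ig; rewrite (_ : EFin \o _ =
  (fun x => a%:E * (EFin \o f) x)%E \+ (EFin \o g))%E//.
by apply: integrableD => //; exact: integrableZl.
Qed.

Lemma integrableT_bounded f g : measurable_fun setT f ->
  mu.-integrable setT (EFin \o g) -> (forall x, `|f x| <= g x) ->
  mu.-integrable setT (EFin \o f).
Proof.
move=> mf ig fg; apply: le_integrable ig => //.
  exact/measurable_EFinP.
move=> x _ /=; rewrite lee_fin (le_trans (fg x))// ler_norm//.
Qed.

Lemma sqi_mul f g : sqi f -> sqi g ->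
  mu.-integrable setT (fun x => (f x * g x)%:E).
Proof.
move=> [mf if2] [mg ig2].
apply: (@integrableT_bounded _ (fun x => f x ^+ 2 + g x ^+ 2)).
- exact: measurable_funM.
- by rewrite (_ : (fun x => _) = (fun x => 1 * f x ^+ 2 + g x ^+ 2)) ?funeqE => [|x];
    [exact: integrable_lin | rewrite mul1r].
- move=> x; rewrite normrM -(real_normK (num_real (f x))) -(real_normK (num_real (g x))).
  have := normr_ge0 (f x); have := normr_ge0 (g x).
  move: `|f x| `|g x| => a b a0 b0; nra.
Qed.

Lemma sqi_lin (a : R) f g : sqi f -> sqi g -> sqi (fun x => a * f x + g x).
Proof.
move=> sf sg; have [mf if2] := sf; have [mg ig2] := sg.
have mfg : measurable_fun setT (fun x => a * f x + g x).
  by apply: measurable_funD => //; exact: measurable_funM.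
split => //.
apply: (@integrableT_bounded _ (fun x => 2 * a ^+ 2 * f x ^+ 2 + 2 * g x ^+ 2)).
- exact: measurable_funX.
- apply: integrable_lin => //.
  rewrite (_ : (fun x => _) = (fun x => 1 * g x ^+ 2 + g x ^+ 2)) ?funeqE => [|x].
    exact: integrable_lin.
  by rewrite mul1r mulr_natl mulr2n.
- move=> x; rewrite ger0_norm ?sqr_ge0//; have := sqr_ge0 (a * f x - g x); nra.
Qed.

Lemma sqiZ (a : R) f : sqi f -> sqi (fun x => a * f x).
Proof.
move=> sf; have := sqi_lin (a - 1) sf sf.
by under eq_fun do rewrite mulrBl mul1r subrK.
Qed.

Lemma sqiB f g : sqi f -> sqi g -> sqi (fun x => f x - g x).
Proof.
move=> sf sg; have := sqi_lin (-1) sg sf.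
by under eq_fun do rewrite mulN1r addrC.
Qed.

Lemma ipC f g : ip f g = ip g f.
Proof. by rewrite /ip; apply: eq_Rintegral => x _; rewrite mulrC. Qed.

Lemma ip_lin (a : R) f g h : sqi f -> sqi g -> sqi h ->
  ip (fun x => a * f x + g x) h = a * ip f h + ip g h.
Proof.
move=> sf sg sh; have ifh := sqi_mul sf sh; have igh := sqi_mul sg sh.
rewrite /ip -RintegralZl// -RintegralD//; last first.
  by rewrite /comp; under eq_fun do rewrite EFinM; exact: integrableZl.
by apply: eq_Rintegral => x _; rewrite mulrDl mulrA.
Qed.

Lemma ip_ge0 f : 0 <= ip f f.
Proof. by apply: Rintegral_ge0 => x _; rewrite -expr2 sqr_ge0. Qed.

Lemma ipE f : sqi f -> (\int[mu]_x (f x ^+ 2)%:E)%E = (ip f f)%:E.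
Proof.
move=> [_ sf]; rewrite (_ : ip f f = \int[mu]_x (f x ^+ 2)).
  by rewrite /Rintegral fineK//; exact: integrable_fin_num.
by apply: eq_Rintegral => x _; rewrite expr2.
Qed.

Lemma ip_sqr_le f g : sqi f -> sqi g -> ip f g ^+ 2 <= ip f f * ip g g.
Proof.
move=> sf sg.
have key a : 0 <= a ^+ 2 * ip f f + 2 * a * ip f g + ip g g.
  have := ip_ge0 (fun x => a * f x + g x).
  rewrite ip_lin//; last exact: sqi_lin.
  rewrite (ipC f) (ipC g) !ip_lin// (ipC g f) => h.
  by apply: (le_trans h); lra.
have f0 := ip_ge0 f.
have [f00|fn0] := eqVneq (ip f f) 0.
  rewrite f00 mul0r.
  have [->|fg0] := eqVneq (ip f g) 0; first by rewrite expr0n.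
  (* With [ip f f = 0] the quadratic is affine in [a], and this [a] is where it takes the value
     -1. *)
  have := key (- (ip g g + 1) / (2 * ip f g)).
  have -> : (- (ip g g + 1) / (2 * ip f g)) ^+ 2 * ip f f +
    2 * (- (ip g g + 1) / (2 * ip f g)) * ip f g + ip g g = -1.
    by rewrite f00; field.
  by rewrite ler0N1.
have fp : 0 < ip f f by rewrite lt_neqAle eq_sym fn0.
have := key (- ip f g / ip f f).
have -> : (- ip f g / ip f f) ^+ 2 * ip f f + 2 * (- ip f g / ip f f) * ip f g
   + ip g g = (ip f f * ip g g - ip f g ^+ 2) / ip f f by field.
by rewrite pmulr_lge0 ?invr_gt0// subr_ge0.
Qed.

Lemma ipD2 (t : R) f g : sqi f -> sqi g ->
  ip (fun x => t * f x + g x) (fun x => t * f x + g x) =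
  t ^+ 2 * ip f f + 2 * t * ip f g + ip g g.
Proof.
move=> sf sg; rewrite ip_lin//; last exact: sqi_lin.
by rewrite (ipC f) (ipC g) !ip_lin// (ipC g f); ring.
Qed.

Lemma sqi_ae f g : sqi f -> measurable_fun setT g -> {ae mu, forall x, f x = g x} ->
  sqi g /\ ip g g = ip f f.
Proof.
move=> sf mg fg; have [mf if2] := sf.
have mg2 : measurable_fun setT (fun x => (g x ^+ 2)%:E).
  by apply/measurable_EFinP; exact: measurable_funX.
have mf2 : measurable_fun setT (fun x => (f x ^+ 2)%:E).
  by apply/measurable_EFinP; exact: measurable_funX.
have E : (\int[mu]_x (g x ^+ 2)%:E = \int[mu]_x (f x ^+ 2)%:E)%E.
  apply: ge0_ae_eq_integral => //.
  - by move=> x _; rewrite lee_fin sqr_ge0.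
  - by move=> x _; rewrite lee_fin sqr_ge0.
  - by apply: filterS fg => x fx _; rewrite fx.
have sg : sqi g.
  split => //; apply/integrableP; split => //.
  under eq_integral do rewrite gee0_abs ?lee_fin ?sqr_ge0//.
  by rewrite E ipE// ltry.
by split => //; apply: EFin_inj; rewrite -!ipE.
Qed.

(** The bound is only asked for eventually, so that the lemma applies to the differences f n - f m
    of a Cauchy sequence, with n fixed. *)
Lemma fatou_ip (f : nat -> T -> R) g (M : R) : (forall n, sqi (f n)) ->
  (forall x, f ^~ x @ \oo --> g x) ->
  (\forall n \near \oo, ip (f n) (f n) <= M) -> sqi g /\ ip g g <= M.
Proof.
move=> sf fg [N _ hN].
have mg : measurable_fun setT g.
  by apply: (measurable_fun_cvg (h := f)) => [m|x _]; [case: (sf m)|exact: fg].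
have mf2 n : measurable_fun setT (fun x => (f n x ^+ 2)%:E).
  by have [_ /measurable_int] := sf n.
have mg2 : measurable_fun setT (fun x => (g x ^+ 2)%:E).
  by apply/measurable_EFinP; exact: measurable_funX.
have le : (\int[mu]_x (g x ^+ 2)%:E <= M%:E)%E.
  have -> : (\int[mu]_x (g x ^+ 2)%:E =
     \int[mu]_x limn_einf (fun n => (f n x ^+ 2)%:E))%E.
    apply: eq_integral => x _; apply/esym; apply: (cvg_limn_einf_sup _).1.
    by apply: cvg_EFin; [exact: nearW|exact: cvgM].
  apply: (le_trans (fatou mu _ _ _)) => //.
    by move=> n x _; rewrite lee_fin sqr_ge0.
  under eq_fun do rewrite ipE//.
  rewrite limn_einf_lim; apply: lime_le; first exact: is_cvg_einfs.
  exists N => // n Nn.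
  apply: (@le_trans _ _ (ip (f n) (f n))%:E).
    by apply: ereal_inf_lbound; exists n => /=.
  by rewrite lee_fin; exact: hN.
have sg : sqi g.
  split => //; apply/integrableP; split => //.
  under eq_integral do rewrite gee0_abs ?lee_fin ?sqr_ge0//.
  exact: le_lt_trans le (ltry _).
by split => //; rewrite -lee_fin -ipE.
Qed.

(** Riesz-Fischer: a subsequence with increments of squared norm at most 4^-k converges almost
    everywhere, and Fatou's lemma with one index fixed brings the whole sequence close to its
    limit. *)
Lemma sqi_complete (f : nat -> T -> R) : (forall n, sqi (f n)) ->
  (forall e : R, 0 < e -> exists N, forall m n, (N <= m)%N -> (N <= n)%N ->
     ip (fun x => f m x - f n x) (fun x => f m x - f n x) <= e) ->
  exists2 g, sqi g & forall e : R, 0 < e -> exists N, forall n, (N <= n)%N ->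
     ip (fun x => f n x - g x) (fun x => f n x - g x) <= e.
Proof.
move=> sf cf.
have half n : \sum_(0 <= k < n) (2^-1 : R) ^+ k <= 2.
  have := @geometric_le_lim R n 1 2^-1 ler01.
  rewrite (_ : 1 * (1 - 2^-1)^-1 = 2 :> R); last by field.
  rewrite /series /=; under eq_bigr do rewrite mul1r.
  by apply; rewrite ?ger0_norm ?invr_ge0// ?invr_gt0// invf_lt1// ltr1n.
have /choice[K hK] k : exists N, forall m n, (N <= m)%N -> (N <= n)%N ->
     ip (fun x => f m x - f n x) (fun x => f m x - f n x) <= (4^-1) ^+ k.
  by apply: cf; rewrite exprn_gt0.
pose s := fix s k := if k is k'.+1 then maxn (s k').+1 (K k) else K 0.
have sK k : (K k <= s k)%N by case: k => [|k] //=; rewrite leq_maxr.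
have sS k : (s k < s k.+1)%N by rewrite /= leq_maxl.
have sge k : (k <= s k)%N by elim: k => // k IH; apply: leq_ltn_trans IH (sS k).
pose a k x := f (s k.+1) x - f (s k) x.
have sa k : sqi (a k) by apply: sqiB.
have ipa k : ip (a k) (a k) <= (4^-1) ^+ k.
  by apply: hK => //; apply: leq_trans (sK k) _; exact: ltnW.
(* The weight 2^k keeps the sum integrable, since 2^k 4^-k = 2^-k, and it turns square summability
   into absolute summability: |a k x| <= w k x + 2^-k. *)
pose w k x := 2 ^+ k * a k x ^+ 2.
have w0 k x : 0 <= w k x by rewrite mulr_ge0 ?sqr_ge0// exprn_ge0.
have mw k : measurable_fun setT (fun x => (w k x)%:E).
  apply/measurable_EFinP; apply: measurable_funM => //.
  by apply: measurable_funX; case: (sa k).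
pose W x := (\sum_(0 <= k <oo) (w k x)%:E)%E.
have mW : measurable_fun setT W by apply: ge0_emeasurable_sum => // k x _ _; rewrite lee_fin.
have iW : (\int[mu]_x W x < +oo)%E.
  rewrite integral_nneseries//; last by move=> k x _; rewrite lee_fin.
  apply: (@le_lt_trans _ _ 2%:E); last exact: ltry.
  apply: lime_le.
    by apply: is_cvg_nneseries => k _ _; apply: integral_ge0 => x _; rewrite lee_fin.
  apply: nearW => n; apply: (@le_trans _ _ (\sum_(0 <= k < n) ((2^-1 : R) ^+ k)%:E)%E).
    apply: lee_sum => k _.
    rewrite /w; under eq_integral do rewrite EFinM.
    rewrite (_ : (\int[mu]_x _ = (2 ^+ k)%:E * \int[mu]_x (a k x ^+ 2)%:E)%E); last first.
      apply: ge0_integralZl => //.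
        by have [_ /measurable_int] := sa k.
      by move=> x _; rewrite lee_fin sqr_ge0.
    rewrite ipE// -EFinM lee_fin.
    apply: (@le_trans _ _ (2 ^+ k * (4^-1) ^+ k)).
      by rewrite ler_wpM2l// exprn_ge0.
    by rewrite -exprMn (_ : 2 * 4^-1 = 2^-1)//; field.
  by rewrite sumEFin lee_fin half.
have W0 x : (0 <= W x)%E by apply: nneseries_ge0 => k _ _; rewrite lee_fin.
pose A : set T := [set x | (W x < +oo)%E].
have mA : measurable A.
  by rewrite -[A]setTI; apply: emeasurable_fun_infty_o.
have aeA : {ae mu, forall x, A x}.
  have : mu.-integrable setT W.
    apply/integrableP; split => //.
    rewrite (eq_integral W); first exact: iW.
    by move=> x _; rewrite gee0_abs.
  move=> /(integrable_ae measurableT); apply: filterS => x /(_ I).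
  by rewrite ge0_fin_numE.
have cvA x : A x -> cvgn (fun k => f (s k) x).
  move=> Ax.
  have Wfin : W x \is a fin_num by rewrite ge0_fin_numE.
  have leW n : \sum_(0 <= k < n) w k x <= fine (W x).
    rewrite -lee_fin fineK// -sumEFin.
    by apply: nneseries_lim_ge => // k _ _; rewrite lee_fin w0.
  have cva : cvgn (series (a ^~ x)).
    apply: normed_cvg; apply: nondecreasing_is_cvgn.
      by apply: nondecreasing_series => *; exact: normr_ge0.
    exists (fine (W x) + 2) => _ [n _ <-].
    apply: le_trans (lerD (leW n) (half n)).
    rewrite /series /= -big_split/=; apply: ler_sum => k _.
    rewrite /w exprVn -(real_normK (num_real (a k x))).
    have : 0 < (2 : R) ^+ k by rewrite exprn_gt0.
    move: (2 ^+ k) `|a k x| => t b t0.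
    rewrite -(ler_pM2r t0) mulrDl mulVf ?gt_eqF//.
    by have := sqr_ge0 (t * b - 1); nra.
  have -> : (fun k => f (s k) x) = (fun k => f (s 0) x + series (a ^~ x) k).
    by apply/funext => k; rewrite /series /= telescope_sumr// addrC subrK.
  by apply: is_cvgD => //; exact: is_cvg_cst.
(* Cutting everything to the full-measure set [A] makes the subsequence converge at every point, as
   [fatou_ip] demands. *)
pose g x : R := if x \in A then limn (fun k => f (s k) x) else 0.
pose h k x := f k x * \1_A x.
have hg x : (fun k => h (s k) x) @ \oo --> g x.
  rewrite /h /g indicE; case: ifPn => [xA|_].
    under eq_fun do rewrite mulr1.
    by apply: cvA; rewrite inE in xA.
  under eq_fun do rewrite mulr0.
  exact: cvg_cst.
have mh k : measurable_fun setT (h k).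
  by apply: measurable_funM; [case: (sf k)|exact: measurable_indic].
have aeh k : {ae mu, forall x, f k x = h k x}.
  by apply: filterS aeA => x Ax; rewrite /h indicE mem_set// mulr1.
have sh k : sqi (h k) by have [] := sqi_ae (sf k) (mh k) (aeh k).
have mg : measurable_fun setT g.
  by apply: (measurable_fun_cvg (h := fun k => h (s k))) => [m|x _]; [case: (sh (s m))|exact: hg].
have main n e : (forall m, (n <= m)%N ->
     ip (fun x => f n x - f m x) (fun x => f n x - f m x) <= e) ->
     sqi (fun x => f n x - g x) /\ ip (fun x => f n x - g x) (fun x => f n x - g x) <= e.
  move=> hn.
  have [] := @fatou_ip (fun k x => h n x - h (s k) x) (fun x => h n x - g x) e.
  - by move=> k; apply: sqiB.
  - by move=> x; apply: cvgB; [exact: cvg_cst|exact: hg].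
  - exists n => // k nk.
    have ae_nk : {ae mu, forall x, f n x - f (s k) x = h n x - h (s k) x}.
      by apply: filterS2 (aeh n) (aeh (s k)) => x -> ->.
    have [_ ->] := sqi_ae (sqiB (sf n) (sf (s k))) (measurable_funB (mh n) (mh (s k))) ae_nk.
    by apply: hn; apply: leq_trans nk (sge k).
  move=> sng ipng.
  have ae_n : {ae mu, forall x, h n x - g x = f n x - g x}.
    by apply: filterS (aeh n) => x ->.
  have mng : measurable_fun setT (fun x => f n x - g x).
    by apply: measurable_funB => //; case: (sf n).
  by have [? ->] := sqi_ae sng mng ae_n.
have [N0 hN0] := cf 1 ltr01.
have [sNg _] := main N0 1 (fun m hm => hN0 _ _ (leqnn _) hm).
exists g.
  have := sqiB (sf N0) sNg.
  by under eq_fun do rewrite opprB addrC subrK.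
move=> e e0; have [N hN] := cf e e0; exists N => n Nn.
by have [] := main n e (fun m hm => hN _ _ Nn (leq_trans Nn hm)).
Qed.

(* Cutting at [|w n x| = r |v x|]: below the cut [r v^2] dominates, above it
   [|w n| |v| <= w n ^ 2 / r]. *)
Lemma ip_norm_cvg0 (w : nat -> T -> R) v (M : R) : (forall n, sqi (w n)) -> sqi v ->
  (forall n, ip (w n) (w n) <= M) -> (forall x, w ^~ x @ \oo --> (0 : R)) ->
  (fun n => ip (fun x => `|w n x|) (fun x => `|v x|)) @ \oo --> (0 : R).
Proof.
move=> sw sv wM w0.
have sabs f : sqi f -> sqi (fun x => `|f x|).
  move=> [mf if2]; split; first exact: measurableT_comp.
  by under eq_fun do rewrite real_normK ?num_real//.
have M0 : 0 <= M by apply: le_trans (ip_ge0 (w 0)) (wM 0).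
have [mv iv2] := sv.
apply/cvgrPdist_le => e e0.
have [r r0 rM] : exists2 r, 0 < r & r^-1 * M <= e / 2.
  exists ((M + 1) / (e / 2)); first by rewrite divr_gt0 ?divr_gt0// ltr_wpDl.
  have M1 : 0 < M + 1 by rewrite ltr_wpDl.
  rewrite invf_div mulrAC ler_pdivrMr// ler_wpM2l ?divr_ge0 ?ltW//.
  by rewrite ltrDl.
pose t n x := Num.min `|w n x| (r * `|v x|) * `|v x|.
have mt n : measurable_fun setT (t n).
  apply: measurable_funM; last exact: measurableT_comp.
  apply: measurable_minr; first by apply: measurableT_comp => //; case: (sw n).
  by apply: measurable_funM => //; exact: measurableT_comp.
have irv : mu.-integrable setT (EFin \o (fun x => r * v x ^+ 2)).
  rewrite (_ : _ \o _ = (fun x => r%:E * (v x ^+ 2)%:E)%E)//.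
  exact: integrableZl.
have t_le n x : `|t n x| <= r * v x ^+ 2.
  have -> : r * v x ^+ 2 = r * `|v x| * `|v x|.
    by rewrite -mulrA -expr2 real_normK ?num_real.
  rewrite /t ger0_norm.
    by rewrite ler_wpM2r// ge_min lexx orbT.
  by rewrite mulr_ge0// le_min normr_ge0 (mulr_ge0 (ltW r0)).
have it n : mu.-integrable setT (EFin \o t n).
  exact: integrableT_bounded irv (t_le n).
have tcvg : (fun n => \int[mu]_x t n x) @ \oo --> (0 : R).
  have [||_ _] := @dominated_convergence _ _ _ mu setT measurableT
    (fun n => EFin \o t n) (cst 0%E) (EFin \o (fun x => r * v x ^+ 2))
    (fun n => measurable_int mu (it n)) (measurable_cst 0%E) _ irv.
  - apply: aeW => x _; apply: cvg_EFin; first exact: nearW.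
    have wx : (fun n => `|w n x| * `|v x|) @ \oo --> (0 : R).
      rewrite -(mul0r `|v x|); apply: cvgM; last exact: cvg_cst.
      by rewrite -(normr0 R); apply: cvg_norm.
    apply: (squeeze_cvgr _ (cvg_cst 0) wx).
    apply: nearW => n /=; rewrite /t mulr_ge0//= ?le_min ?normr_ge0 ?(mulr_ge0 (ltW r0))//.
    by rewrite ler_wpM2r// ge_min lexx.
  - by apply: aeW => x n _ /=; rewrite lee_fin; exact: t_le.
  by rewrite integral_cst// mul0e => /fine_cvg.
move/cvgrPdist_le : tcvg => /(_ (e / 2)); rewrite divr_gt0// => /(_ isT).
apply: filterS => n; rewrite !sub0r !normrN => tn.
rewrite ger0_norm; last by apply: Rintegral_ge0 => x _; rewrite mulr_ge0.
have iw2 : mu.-integrable setT (EFin \o (fun x => w n x ^+ 2)) by case: (sw n).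
apply: (@le_trans _ _ (\int[mu]_x (r^-1 * w n x ^+ 2 + t n x))).
  apply: le_Rintegral => //.
  - by apply: sqi_mul; exact: sabs.
  - exact: integrable_lin.
  - move=> x _; rewrite /t; have a0 := normr_ge0 (w n x); have b0 := normr_ge0 (v x).
    rewrite -(real_normK (num_real (w n x))).
    have ri0 : 0 <= r^-1 by rewrite invr_ge0 ltW.
    have [h|/ltW h] := leP `|w n x| (r * `|v x|).
      by rewrite lerDr mulr_ge0.
    apply: (@le_trans _ _ (r^-1 * `|w n x| ^+ 2)); last first.
      by rewrite lerDl !mulr_ge0// ltW.
    by rewrite ler_pdivlMl// expr2 mulrCA ler_wpM2l.
rewrite (@RintegralD _ _ _ mu setT (fun x => r^-1 * w n x ^+ 2))//; last first.
  rewrite (_ : _ \o _ = (fun x => r^-1%:E * (w n x ^+ 2)%:E)%E)//.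
  exact: integrableZl.
rewrite RintegralZl//.
have -> : \int[mu]_x w n x ^+ 2 = ip (w n) (w n).
  by apply: eq_Rintegral => x _; rewrite expr2.
rewrite [leRHS](splitr e); apply: lerD; last exact: le_trans (ler_norm _) tn.
by apply: le_trans rM; rewrite ler_wpM2l// invr_ge0 ltW.
Qed.

End SquareIntegrable.

(** * Elementary inequalities for real powers *)

Section PowerInequality.
Variable R : realType.

Lemma onem_exp_le (n : nat) (r : R) : 0 <= r <= 1 -> 1 - r ^+ n <= n%:R * (1 - r).
Proof.
move=> /andP[r0 r1]; elim: n => [|n IH]; first by rewrite expr0 mul0r subrr.
have rn0 : 0 <= r ^+ n by rewrite exprn_ge0.
have rn1 : r ^+ n <= 1 by rewrite exprn_ile1.
rewrite exprS -natr1; nra.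
Qed.

(** The mean value inequality with the exponent rounded up to an integer n: for r = t / s in [0, 1]
    one has r^n <= r^p, which reduces it to the polynomial bound [onem_exp_le]. *)
Lemma powRB_le (p s t : R) : 2 < p -> 0 <= t -> t <= s ->
  s `^ p - t `^ p <= (Num.truncn p).+1%:R * (s `^ (p - 1) * (s - t)).
Proof.
move=> p2 t0 ts.
have p0 : 0 < p by lra.
have [s0|sn0] := eqVneq s 0.
  have -> : t = 0 by apply/eqP; rewrite eq_le t0 -s0 ts.
  by rewrite s0 subrr subr0 !mulr0.
have s0 : 0 < s by rewrite lt_neqAle eq_sym sn0 (le_trans t0).
set n := (Num.truncn p).+1.
have pn : p <= n%:R.
  by rewrite ltW// /n truncnS_gt.
set r := t / s.
have r0 : 0 <= r by rewrite divr_ge0// ltW.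
have r1 : r <= 1 by rewrite ler_pdivrMr// mul1r.
have -> : t = s * r by rewrite /r mulrCA mulfV ?mulr1.
rewrite powRM// ?(ltW s0)//.
have -> : s `^ p = s `^ (p - 1) * s.
  by rewrite -{3}(powRr1 (ltW s0)) -powRD ?subrK// sn0 implybT.
have rp : r ^+ n <= r `^ p.
  rewrite -powR_mulrn//.
  have [->|rn0] := eqVneq r 0; first by rewrite !powR0// ?gt_eqF// pnatr_eq0.
  by rewrite ger_powR// r1 lt_neqAle eq_sym rn0 r0.
have h := onem_exp_le n (introT andP (conj r0 r1)).
rewrite [leLHS](_ : _ = s `^ (p - 1) * s * (1 - r `^ p)); last by ring.
rewrite [leRHS](_ : _ = s `^ (p - 1) * s * (n%:R * (1 - r))); last by ring.
rewrite ler_wpM2l ?mulr_ge0 ?powR_ge0 ?(ltW s0)//.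
by apply: le_trans h; rewrite lerD2l lerN2.
Qed.

(** Boundedness of a and b replaces the usual epsilon form of the Brezis-Lieb inequality: for p > 2
    the defect is then at most bilinear. The constant [c] bounds x^(p - 2) on [0, 2 M], where |a +
    b| and 2 |a| live. *)
Lemma powRD_le_cross (p M : R) : 2 < p -> 0 < M -> exists2 K, 0 <= K &
  forall a b : R, `|a| <= M -> `|b| <= M ->
  `| `|a + b| `^ p - `|a| `^ p - `|b| `^ p | <= K * (`|a| * `|b|).
Proof.
move=> p2 M0; set n : R := (Num.truncn p).+1%:R; set c := (2 * M) `^ (p - 2).
have c0 : 0 <= c by exact: powR_ge0.
have n0 : 0 <= n by exact: ler0n.
exists ((2 * n + 1) * c); first by rewrite mulr_ge0// addr_ge0// mulr_ge0.
have pow1 x : 0 <= x <= 2 * M -> x `^ (p - 1) <= c * x.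
  move=> /andP[x0 xM]; rewrite -mulr_powRB1 ?subr_gt0//; last by lra.
  rewrite mulrC ler_wpM2r// (_ : p - 1 - 1 = p - 2); last by ring.
  by apply: ge0_ler_powR; rewrite ?nnegrE//; lra.
have pow2 x : 0 <= x <= 2 * M -> x `^ p <= c * x ^+ 2.
  move=> /andP[x0 xM]; rewrite -mulr_powRB1//; last by lra.
  by rewrite expr2 mulrCA ler_wpM2l// pow1// x0.
(* By symmetry |b| <= |a|; then |a + b|^p - |a|^p is linear in |b| by the mean value inequality, and
   |b|^p <= c |a| |b|. *)
suff key (a b : R) : `|a| <= M -> `|b| <= `|a| ->
  `| `|a + b| `^ p - `|a| `^ p - `|b| `^ p | <= (2 * n + 1) * c * (`|a| * `|b|).
  move=> a b aM bM; have [ba|/ltW ab] := leP `|b| `|a|; first exact: key.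
  by rewrite (addrC a) [X in `|X|]addrAC [ `|a| * _]mulrC; exact: key.
move=> aM ba; have a0 := normr_ge0 a; have b0 := normr_ge0 b.
have diff : `| `|a + b| `^ p - `|a| `^ p | <= n * (c * (2 * `|a|) * `|b|).
  have gen s t : 0 <= t -> t <= s -> s <= 2 * `|a| -> s - t <= `|b| ->
     s `^ p - t `^ p <= n * (c * (2 * `|a|) * `|b|).
    move=> t0 ts sa stb; apply: le_trans (powRB_le p2 t0 ts) _.
    rewrite ler_wpM2l// ler_pM ?powR_ge0 ?subr_ge0//.
    apply: le_trans (pow1 s _) _; last by rewrite ler_wpM2l.
    by apply/andP; split; lra.
  have ab1 := ler_normD a b.
  have ab2 : `|a| <= `|a + b| + `|b|.
    by have := ler_normB (a + b) b; rewrite addrK.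
  have [h|/ltW h] := leP `|a + b| `|a|.
    rewrite distrC ger0_norm; last by rewrite subr_ge0 ge0_ler_powR ?nnegrE//; lra.
    by apply: gen => //; lra.
  rewrite ger0_norm; last by rewrite subr_ge0 ge0_ler_powR ?nnegrE//; lra.
  by apply: gen => //; lra.
apply: le_trans (ler_normB _ _) _.
rewrite (ger0_norm (powR_ge0 _ _)).
have hb : `|b| `^ p <= c * (`|a| * `|b|).
  apply: le_trans (pow2 _ _) _; first by rewrite b0; lra.
  by rewrite ler_wpM2l// expr2 ler_wpM2r.
apply: le_trans (lerD diff hb) _.
by rewrite le_eqVlt; apply/orP; left; apply/eqP; ring.
Qed.

End PowerInequality.

(** * Integrals of p-th powers and the Brezis-Lieb lemma *)

Section LpPower.
Context d (T : measurableType d) (R : realType).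
Variable mu : {measure set T -> \bar R}.
Implicit Types f g : T -> R.

Definition powint (p : R) f : R := \int[mu]_x (`|f x| `^ p).

Lemma powR_le_sqr (p M x : R) : 2 < p -> `|x| <= M -> `|x| `^ p <= M `^ (p - 2) * x ^+ 2.
Proof.
move=> p2 xM; have M0 : 0 <= M := le_trans (normr_ge0 _) xM.
rewrite -(real_normK (num_real x)) expr2 mulrA.
rewrite -mulr_powRB1//; last by lra.
rewrite mulrC ler_wpM2r// -mulr_powRB1 ?subr_gt0//; last by lra.
rewrite mulrC ler_wpM2r// (_ : p - 1 - 1 = p - 2); last by ring.
by apply: ge0_ler_powR; rewrite ?nnegrE//; lra.
Qed.

Lemma integrable_powR (p M : R) f : 2 < p -> sqi mu f -> (forall x, `|f x| <= M) ->
  mu.-integrable setT (EFin \o (fun x => `|f x| `^ p)).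
Proof.
move=> p2 [mf if2] fM.
apply: (@integrableT_bounded _ _ _ _ _ (fun x => M `^ (p - 2) * f x ^+ 2)).
- by apply: (measurableT_comp (measurable_powR _)); exact: measurableT_comp.
- rewrite (_ : _ \o _ = (fun x => (M `^ (p - 2))%:E * (f x ^+ 2)%:E)%E)//.
  exact: integrableZl.
- by move=> x; rewrite ger0_norm ?powR_ge0//; exact: powR_le_sqr.
Qed.

Lemma powint_ge0 p f : 0 <= powint p f.
Proof. by apply: Rintegral_ge0 => x _; exact: powR_ge0. Qed.

Lemma powint_mono (p M : R) f g : 2 < p -> sqi mu f -> sqi mu g ->
  (forall x, `|g x| <= M) -> (forall x, `|f x| <= `|g x|) -> powint p f <= powint p g.
Proof.
move=> p2 sf sg gM fg; apply: le_Rintegral => //.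
- by apply: integrable_powR p2 sf _ => x; exact: le_trans (fg x) (gM x).
- exact: integrable_powR p2 sg gM.
- by move=> x _; apply: ge0_ler_powR; rewrite ?nnegrE//; lra.
Qed.

Lemma powint_eq0 (p M : R) f : 2 < p -> sqi mu f -> (forall x, `|f x| <= M) ->
  powint p f = 0 -> ip mu f f = 0.
Proof.
move=> p2 sf fM pf0; have [mf _] := sf.
have ifp := integrable_powR p2 sf fM.
have : (\int[mu]_x `|(`|f x| `^ p)%:E| = 0)%E.
  have /eqP := pf0; rewrite /powint /Rintegral fine_eq0; last exact: integrable_fin_num.
  move=> /eqP E0; rewrite -[RHS]E0; apply: eq_integral => x _.
  by rewrite gee0_abs// lee_fin powR_ge0.
move=> /(ae_eq_integral_abs mu measurableT (measurable_int mu ifp)) aef.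
have s0 : sqi mu (fun=> 0 : R).
  split; first exact: measurable_cst.
  by rewrite expr0n; exact: integrable0.
have [|_ ->] := @sqi_ae _ _ _ mu (fun=> 0) f s0 mf.
  apply: filterS aef => x /(_ I) [] /eqP; rewrite powR_eq0 normr_eq0.
  by move=> /andP[/eqP -> _].
rewrite /ip -[RHS](mul0r (\int[mu]_x 0)).
by under eq_Rintegral do rewrite mul0r; rewrite Rintegral_cst// !mul0r.
Qed.

(** By [powRD_le_cross] the defect is at most K times the integral of |f n - g| |g|, and
    [ip_norm_cvg0] sends it to 0: f n - g is bounded in L^2 and tends to 0 pointwise. *)
Lemma brezis_lieb (p M C : R) (f : nat -> T -> R) g : 2 < p -> 0 < M ->
  (forall n, sqi mu (f n)) -> sqi mu g ->
  (forall n x, `|f n x| <= M) -> (forall x, `|g x| <= M) ->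
  (forall n, ip mu (fun x => f n x - g x) (fun x => f n x - g x) <= C) ->
  (forall x, f ^~ x @ \oo --> g x) ->
  (fun n => powint p (f n) - powint p (fun x => f n x - g x)) @ \oo --> powint p g.
Proof.
move=> p2 M0 sf sg fM gM fC fg.
have sw n : sqi mu (fun x => f n x - g x) by exact: sqiB.
have wM n x : `|f n x - g x| <= 2 * M.
  by apply: le_trans (ler_normB _ _) _; have := fM n x; have := gM x; lra.
have gM' x : `|g x| <= 2 * M by have := gM x; lra.
have [K K0 hK] := powRD_le_cross p2 (mulr_gt0 (ltr0n _ 2) M0).
have w0 x : (fun n => f n x - g x) @ \oo --> (0 : R).
  by rewrite -(subrr (g x)); apply: cvgB; [exact: fg|exact: cvg_cst].
have cv : (fun n => K * ip mu (fun x => `|f n x - g x|) (fun x => `|g x|)) @ \oo --> K * 0.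
  by apply: cvgM; [exact: cvg_cst|exact: (ip_norm_cvg0 sw sg fC w0)].
apply/cvgrPdist_le => e e0.
move/cvgrPdist_le : cv => /(_ e e0); apply: filterS => n.
rewrite mulr0 !sub0r !normrN => cvn.
apply: le_trans (le_trans (ler_norm _) cvn).
have Ifn := integrable_powR p2 (sf n) (fM n).
have Iwn := integrable_powR p2 (sw n) (wM n).
have Ig := integrable_powR p2 sg gM.
have Id : mu.-integrable setT (EFin \o (fun x => `|f n x| `^ p - `|f n x - g x| `^ p)).
  rewrite (_ : _ \o _ = EFin \o (fun x => -1 * `|f n x - g x| `^ p + `|f n x| `^ p)).
    exact: integrable_lin.
  by apply/funext => x /=; rewrite mulN1r addrC.
have -> : powint p g - (powint p (f n) - powint p (fun x => f n x - g x)) =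
   - \int[mu]_x (`|f n x| `^ p - `|f n x - g x| `^ p - `|g x| `^ p).
  have E := RintegralB measurableT Id Ig; rewrite (RintegralB measurableT Ifn Iwn) in E.
  by rewrite E /powint [RHS]opprB.
have ID : mu.-integrable setT (EFin \o (fun x => `|f n x| `^ p - `|f n x - g x| `^ p - `|g x| `^ p)).
  rewrite (_ : _ \o _ = EFin \o (fun x => -1 * `|g x| `^ p +
     (`|f n x| `^ p - `|f n x - g x| `^ p))); first exact: integrable_lin.
  by apply/funext => x /=; rewrite mulN1r addrC.
rewrite normrN; apply: le_trans (le_normr_Rintegral measurableT ID) _.
have Iwg : mu.-integrable setT (EFin \o (fun x => `|f n x - g x| * `|g x|)).
  rewrite (_ : _ \o _ = (abse \o (fun x => ((f n x - g x) * g x)%:E))).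
    by apply: integrable_abse; exact: sqi_mul.
  by apply/funext => x /=; rewrite normrM.
rewrite /ip -RintegralZl//; apply: le_Rintegral => //.
- by rewrite (_ : _ \o _ = abse \o (EFin \o (fun x => `|f n x| `^ p - `|f n x - g x| `^ p - `|g x| `^ p)))//; exact: integrable_abse.
- by rewrite (_ : _ \o _ = (fun x => K%:E * (`|f n x - g x| * `|g x|)%:E)%E)//; exact: integrableZl.
- by move=> x _; have := hK _ _ (wM n x) (gM' x); rewrite subrK.
Qed.

End LpPower.

(** * Functions that are primitives of square-integrable functions *)

Section Primitive.
Variable R : realType.
Local Notation mu := (@lebesgue_measure R).
Implicit Types (f g h : R -> R) (x y z : R).

Definition itvint g x y : R := \int[mu]_(t in `[x, y]) g t.

Definition linteg g : Prop :=
  measurable_fun setT g /\ forall x y, mu.-integrable `[x, y] (EFin \o g).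

(** Absolute continuity in integral form. The order x <= y is required because [itvint] is 0, not
    the opposite, when the bounds are reversed. *)
Definition primitive f g : Prop := forall x y, x <= y -> f y - f x = itvint g x y.

Lemma linteg_cts g : continuous g -> linteg g.
Proof.
move=> cg; split; first exact: continuous_measurable_fun.
move=> x y; apply: continuous_compact_integrable; first exact: segment_compact.
exact: continuous_subspaceT.
Qed.

Lemma linteg_cst (a : R) : linteg (fun=> a).
Proof. by apply: linteg_cts => x; exact: cvg_cst. Qed.

Lemma linteg_le g h : measurable_fun setT g -> linteg h -> (forall x, `|g x| <= h x) -> linteg g.
Proof.
move=> mg [mh ih] gh; split => // x y.
apply: (le_integrable _ _ _ (ih x y)) => //.
- by apply/measurable_EFinP; exact: measurable_funTS.
- by move=> t _ /=; rewrite lee_fin (le_trans (gh t)) ?ler_norm.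
Qed.

Lemma linteg_lin a g h : linteg g -> linteg h -> linteg (fun t => a * g t + h t).
Proof.
move=> [mg ig] [mh ih]; split; last by move=> x y; exact: integrable_lin.
by apply: measurable_funD => //; exact: measurable_funM.
Qed.

Lemma lintegZ a g : linteg g -> linteg (fun t => a * g t).
Proof.
by move=> lg; have := linteg_lin a lg (linteg_cst 0); under eq_fun do rewrite addr0.
Qed.

Lemma lintegD g h : linteg g -> linteg h -> linteg (fun t => g t + h t).
Proof.
by move=> lg lh; have := linteg_lin 1 lg lh; under eq_fun do rewrite mul1r.
Qed.

Lemma linteg_norm g : linteg g -> linteg (fun t => `|g t|).
Proof.
move=> [mg ig]; split; first exact: measurableT_comp.
move=> x y; rewrite (_ : _ \o _ = abse \o (EFin \o g))//.
exact: integrable_abse.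
Qed.

Lemma lintegM g h K : linteg g -> measurable_fun setT h -> (forall x, `|h x| <= K) ->
  linteg (fun x => g x * h x).
Proof.
move=> lg mh hK; have [mg _] := lg; apply: (@linteg_le _ (fun x => K * `|g x|)).
- exact: measurable_funM.
- by apply: lintegZ; exact: linteg_norm.
- by move=> x; rewrite normrM mulrC ler_wpM2r.
Qed.

Lemma linteg_sqr g : sqi mu g -> linteg (fun x => g x ^+ 2).
Proof.
move=> [mg ig]; split; first exact: measurable_funX.
by move=> x y; exact: integrableS ig.
Qed.

Lemma sqi_linteg g : sqi mu g -> linteg g.
Proof.
move=> sg; have [mg _] := sg.
apply: (@linteg_le _ (fun t => g t ^+ 2 + 1)) => //.
  by apply: lintegD; [exact: linteg_sqr|exact: linteg_cst].
move=> t; rewrite -(real_normK (num_real (g t))); have := sqr_ge0 (`|g t| - 1).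
by have := normr_ge0 (g t); nra.
Qed.

Lemma itvint_lin a g h x y : linteg g -> linteg h ->
  itvint (fun t => a * g t + h t) x y = a * itvint g x y + itvint h x y.
Proof.
move=> [_ ig] [_ ih]; rewrite /itvint -RintegralZl// -RintegralD//.
rewrite (_ : _ \o _ = (fun t => a%:E * (EFin \o g) t)%E)//.
exact: integrableZl.
Qed.

Lemma itvintZ a g x y : linteg g -> itvint (fun t => a * g t) x y = a * itvint g x y.
Proof. by move=> [_ ig]; rewrite /itvint RintegralZl. Qed.

Lemma itvintB g h x y : linteg g -> linteg h ->
  itvint (fun t => g t - h t) x y = itvint g x y - itvint h x y.
Proof. by move=> [_ ig] [_ ih]; rewrite /itvint RintegralB. Qed.

Lemma itvintD g h x y : linteg g -> linteg h ->
  itvint (fun t => g t + h t) x y = itvint g x y + itvint h x y.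
Proof. by move=> [_ ig] [_ ih]; rewrite /itvint RintegralD. Qed.

Lemma eq_itvint g h x y : (forall t, x <= t <= y -> g t = h t) -> itvint g x y = itvint h x y.
Proof. by move=> gh; apply: eq_Rintegral => t; rewrite inE /= in_itv /= => /gh. Qed.

Lemma itvint_cst a x y : x <= y -> itvint (fun=> a) x y = a * (y - x).
Proof.
move=> xy; rewrite /itvint Rintegral_cst//= lebesgue_measure_itv/= lte_fin.
move: xy; rewrite le_eqVlt => /predU1P[->|->]; first by rewrite ltxx subrr.
by rewrite -EFinD.
Qed.

Lemma itvintxx g x : itvint g x x = 0.
Proof. by rewrite /itvint set_itv1 Rintegral_set1. Qed.

Lemma itvint_chasles g x y z : linteg g -> x <= y -> y <= z ->
  itvint g x z = itvint g x y + itvint g y z.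
Proof.
move=> [_ ig] xy yz.
have := @Rintegral_itvB _ g (BLeft x) (BRight z) y (ig x z).
rewrite !bnd_simp => /(_ xy yz) E.
rewrite /itvint -(@Rintegral_itv_obnd_cbnd _ y); last first.
  by apply: integrableS (ig y z) => //; exact: subset_itv_oc_cc.
by rewrite -E addrC subrK.
Qed.

Lemma le_itvint g h x y : linteg g -> linteg h ->
  (forall t, x <= t <= y -> g t <= h t) -> itvint g x y <= itvint h x y.
Proof.
move=> [_ ig] [_ ih] gh; exact: le_Rintegral.
Qed.

Lemma norm_itvint_le g h x y : linteg g -> linteg h ->
  (forall t, x <= t <= y -> `|g t| <= h t) -> `|itvint g x y| <= itvint h x y.
Proof.
move=> lg lh gh; have [_ ig] := lg.
apply: le_trans (le_normr_Rintegral _ (ig x y)) _ => //.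
by apply: le_itvint => //; exact: linteg_norm.
Qed.

Lemma itvint_ge0 g x y : (forall t, 0 <= g t) -> 0 <= itvint g x y.
Proof. by move=> g0; apply: Rintegral_ge0. Qed.

Lemma sqi_indic g (A : set R) : measurable A -> sqi mu g -> sqi mu (fun t => g t * \1_A t).
Proof.
move=> mA [mg ig].
have mgA : measurable_fun setT (fun t => g t * \1_A t).
  by apply: measurable_funM => //; exact: measurable_indic.
split => //.
apply: integrableT_bounded ig _; first exact: measurable_funX.
move=> t; rewrite ger0_norm ?sqr_ge0// indicE.
by case: (_ \in _); rewrite ?mulr1// mulr0 expr0n sqr_ge0.
Qed.

Lemma ip_indic g h (A : set R) : ip mu (fun t => g t * \1_A t) h = \int[mu]_(t in A) (g t * h t).
Proof.
rewrite /ip [RHS]Rintegral_mkcond; apply: eq_Rintegral => t _.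
by rewrite patchE indicE; case: (_ \in _); rewrite ?mulr1// mulr0 mul0r.
Qed.

Lemma itvint_sqr_le g x y : sqi mu g -> x <= y ->
  itvint g x y ^+ 2 <= (y - x) * itvint (fun t => g t ^+ 2) x y.
Proof.
move=> sg xy.
have s1 : sqi mu (fun t : R => 1 * \1_`[x, y] t).
  split; first by apply: measurable_funM => //; exact: measurable_indic.
  rewrite (_ : (fun t => _) = (EFin \o cst 1) \_ `[x, y]).
    by apply/(integrable_mkcond (EFin \o cst 1)) => //; have [_ ] := linteg_cst 1; apply.
  apply/funext => t; rewrite patchE indicE mul1r.
  by case: (_ \in _); rewrite /= ?expr1n// expr0n.
have := ip_sqr_le (sqi_indic (measurable_itv `[x, y]) sg) s1.
have -> : ip mu (fun t => g t * \1_`[x, y] t) (fun t => 1 * \1_`[x, y] t) = itvint g x y.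
  rewrite ip_indic; apply: eq_Rintegral => t; rewrite indicE => ->.
  by rewrite !mulr1.
have -> : ip mu (fun t => g t * \1_`[x, y] t) (fun t => g t * \1_`[x, y] t) =
   itvint (fun t => g t ^+ 2) x y.
  by rewrite ip_indic; apply: eq_Rintegral => t; rewrite indicE => ->; rewrite mulr1 expr2.
have -> : ip mu (fun t : R => 1 * \1_`[x, y] t) (fun t => 1 * \1_`[x, y] t) = y - x.
  rewrite ip_indic -[RHS]mul1r -(itvint_cst 1 xy).
  by apply: eq_Rintegral => t; rewrite indicE => ->; rewrite !mulr1.
by rewrite [_ * (y - x)]mulrC.
Qed.

Lemma itvint_sqr_le_ip g x y : sqi mu g -> itvint (fun t => g t ^+ 2) x y <= ip mu g g.
Proof.
move=> sg; have [mg ig] := sg.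
rewrite -lee_fin -ipE// /itvint /Rintegral fineK; last first.
  by apply: integrable_fin_num => //; exact: integrableS ig.
apply: ge0_subset_integral => //.
- exact: measurable_int ig.
- by move=> t _; rewrite lee_fin sqr_ge0.
Qed.

Lemma primitive_hoelder f g x y : sqi mu g -> primitive f g ->
  (f y - f x) ^+ 2 <= `|y - x| * ip mu g g.
Proof.
move=> sg fg; wlog xy : x y / x <= y.
  move=> H; have [xy|/ltW yx] := leP x y; first exact: H.
  by rewrite -sqrrN opprB distrC H.
rewrite fg// ger0_norm ?subr_ge0//.
apply: le_trans (itvint_sqr_le sg xy) _.
by rewrite ler_wpM2l ?subr_ge0//; exact: itvint_sqr_le_ip.
Qed.

Lemma primitive_continuous f g : sqi mu g -> primitive f g -> continuous f.
Proof.
move=> sg fg x; apply/cvgrPdist_lt => e e0.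
have C1 : 0 < ip mu g g + 1 by rewrite ltr_wpDl// ip_ge0.
exists (e ^+ 2 / (ip mu g g + 1)); first by rewrite /= divr_gt0 ?exprn_gt0.
move=> y /=; rewrite ltr_pdivlMr// => xy.
rewrite -(@ltr_pXn2r _ 2)// ?nnegrE ?ltW//.
rewrite real_normK ?num_real//.
apply: le_lt_trans (primitive_hoelder _ _ sg fg) _.
by apply: le_lt_trans xy; rewrite ler_wpM2l// lerDl.
Qed.

(* Halving [[x, y]] k times gains a factor [2 ^ k]. *)
Lemma additive_squeeze0 (h m : R -> R -> R) x y :
  (forall x y z, x <= y -> y <= z -> h x z = h x y + h y z) ->
  (forall x y z, x <= y -> y <= z -> m x z = m x y + m y z) ->
  (forall x y, x <= y -> 0 <= m x y) ->
  (forall x y, x <= y -> `|h x y| <= (y - x) * m x y) -> x <= y -> h x y = 0.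
Proof.
move=> hA mA m0 hm.
have key k a b : a <= b -> `|h a b| <= (b - a) * m a b / 2 ^+ k.
  elim: k a b => [|k IH] a b ab; first by rewrite expr0 divr1 hm.
  pose c := (a + b) / 2.
  have ac : a <= c by rewrite /c; lra.
  have cb : c <= b by rewrite /c; lra.
  rewrite (hA a c b)// (mA a c b)//; apply: le_trans (ler_normD _ _) _.
  apply: le_trans (lerD (IH _ _ ac) (IH _ _ cb)) _.
  rewrite exprS invfM -mulrDl mulrA ler_wpM2r ?invr_ge0 ?exprn_ge0//.
  by rewrite /c; have := m0 _ _ ac; have := m0 _ _ cb; nra.
move=> xy; apply/eqP; rewrite -normr_le0; apply/ler_addgt0Pl => e e0.
rewrite addr0; set M := (y - x) * m x y.
have M0 : 0 <= M by rewrite mulr_ge0 ?subr_ge0 ?m0.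
pose k := (Num.truncn (M / e)).+1.
have hk : M / e <= 2 ^+ k.
  apply: (@le_trans _ _ k%:R); first by rewrite ltW// truncnS_gt.
  by rewrite -natrX ler_nat ltnW// ltn_expl.
apply: le_trans (key k _ _ xy) _.
by rewrite -/M ler_pdivrMr ?exprn_gt0// mulrC -ler_pdivrMr.
Qed.

(** The class C^{1,1}, as a quadratic bound on the Taylor remainder. It forces F' to be the
    derivative and to be 2K-Lipschitz, and for piecewise quadratic functions it is checked by
    algebra. *)
Definition C11 (F F' : R -> R) (K : R) : Prop :=
  forall a b, `|F b - F a - F' a * (b - a)| <= K * (b - a) ^+ 2.

(** Add the Taylor remainders at [a] and at [b]: the values of F cancel. *)
Lemma C11_lip F F' K a b : C11 F F' K -> `|F' b - F' a| <= 2 * K * `|b - a|.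
Proof.
move=> FK; have [->|ab] := eqVneq b a; first by rewrite !subrr normr0 mulr0.
have ba0 : 0 < `|b - a| by rewrite normr_gt0 subr_eq0.
rewrite -(ler_pM2r ba0) -normrM.
have -> : 2 * K * `|b - a| * `|b - a| = 2 * K * (b - a) ^+ 2.
  by rewrite -[LHS]mulrA -expr2 real_normK ?num_real.
have := ler_normD (F b - F a - F' a * (b - a)) (F a - F b - F' b * (a - b)).
have -> : F b - F a - F' a * (b - a) + (F a - F b - F' b * (a - b)) =
   (F' b - F' a) * (b - a) by ring.
move=> /le_trans; apply; apply: le_trans (lerD (FK a b) (FK b a)) _.
by rewrite le_eqVlt; apply/orP; left; apply/eqP; ring.
Qed.

Lemma C11_continuous F F' K : C11 F F' K -> continuous F'.
Proof.
move=> FK x; apply/cvgrPdist_lt => e e0.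
have K1 : 0 < 2 * `|K| + 1 by rewrite ltr_wpDl// mulr_ge0.
exists (e / (2 * `|K| + 1)); first by rewrite /= divr_gt0.
move=> y /=; rewrite ltr_pdivlMr// => xy.
apply: le_lt_trans (C11_lip _ _ FK) _; apply: le_lt_trans xy.
rewrite mulrC ler_wpM2l//; have := ler_norm K; lra.
Qed.

Lemma C11_derive F F' K x : C11 F F' K -> is_derive x 1 F (F' x).
Proof.
move=> FK.
have cv : h^-1 *: (F (h *: 1 + x) - F x) @[h --> 0^'] --> F' x.
  apply/cvgrPdist_lt => e e0.
  have K1 : 0 < `|K| + 1 by rewrite ltr_wpDl.
  exists (e / (`|K| + 1)); first by rewrite /= divr_gt0.
  move=> h /=; rewrite sub0r normrN ltr_pdivlMr// => hx h0.
  have h00 : 0 < `|h| by rewrite normr_gt0.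
  rewrite /GRing.scale /= mulr1 -(ltr_pM2r h00) -normrM.
  have -> : (F' x - h^-1 * (F (h + x) - F x)) * h = - (F (h + x) - F x - F' x * (h + x - x)).
    by field.
  rewrite normrN; apply: le_lt_trans (FK x (h + x)) _.
  rewrite addrK -(real_normK (num_real h)) expr2 mulrA ltr_pM2r// mulrC.
  apply: le_lt_trans hx; rewrite ler_wpM2l//; have := ler_norm K; lra.
by apply: DeriveDef; [apply/cvg_ex; exists (F' x)|apply: cvg_lim].
Qed.

Lemma C11_primitive F F' K : C11 F F' K -> primitive F F'.
Proof.
move=> FK x y xy.
have lF : linteg F' by apply: linteg_cts; exact: C11_continuous FK.
apply/eqP; rewrite -subr_eq0; apply/eqP.
have K0 : 0 <= K.
  by have := FK 0 1; rewrite subr0 expr1n !mulr1; apply: le_trans.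
apply: (@additive_squeeze0 (fun x y => F y - F x - itvint F' x y) (fun x y => 3 * K * (y - x))) => //.
- by move=> a b c ab bc; rewrite (itvint_chasles lF ab bc); ring.
- by move=> a b c _ _; ring.
- by move=> a b ab; rewrite !mulr_ge0// subr_ge0.
- move=> a b ab.
  have -> : F b - F a - itvint F' a b =
     (F b - F a - F' a * (b - a)) - itvint (fun t => F' t - F' a) a b.
    by rewrite itvintB//; [rewrite itvint_cst//; ring|exact: linteg_cst].
  have : `|itvint (fun t => F' t - F' a) a b| <= 2 * K * (b - a) * (b - a).
    rewrite -[leRHS](itvint_cst _ ab); apply: norm_itvint_le => [||t /andP[ta tb]].
    - have := linteg_lin (-1) (linteg_cst (F' a)) lF.
      by under eq_fun do rewrite mulN1r addrC.
    - exact: linteg_cst.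
    - apply: le_trans (C11_lip _ _ FK) _; rewrite ger0_norm ?subr_ge0//.
      by rewrite ler_wpM2l ?mulr_ge0// lerB.
  move=> h; apply: le_trans (ler_normB _ _) _.
  apply: le_trans (lerD (FK a b) h) _.
  by rewrite le_eqVlt; apply/orP; left; apply/eqP; ring.
Qed.

(** With I the integral of |g| over [a, b], the defect of the chain rule is at most 3 K I^2, hence
    at most (b - a) times 3 K times the integral of g^2 by Cauchy-Schwarz. Being additive, it
    vanishes by [additive_squeeze0]; [f] is never differentiated pointwise. *)
Lemma primitive_chain f g F F' K L : sqi mu g -> primitive f g -> C11 F F' K ->
  (forall x, `|F' x| <= L) -> primitive (F \o f) (fun t => g t * F' (f t)).
Proof.
move=> sg fg FK FL x y xy; have lg := sqi_linteg sg; have [mg _] := sg.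
have cf := primitive_continuous sg fg.
have mF : measurable_fun setT (fun t => F' (f t)).
  apply: continuous_measurable_fun => t; apply: continuous_comp; first exact: cf.
  exact: C11_continuous FK _.
have lFg : linteg (fun t => g t * F' (f t)) by apply: lintegM lg mF _ => t; exact: FL.
have lag := linteg_norm lg.
have K0 : 0 <= K.
  by have := FK 0 1; rewrite subr0 expr1n !mulr1; apply: le_trans.
have lg2 := linteg_sqr sg.
apply/eqP; rewrite -subr_eq0; apply/eqP.
apply: (@additive_squeeze0 (fun x y => F (f y) - F (f x) - itvint (fun t => g t * F' (f t)) x y)
   (fun x y => 3 * K * itvint (fun t => g t ^+ 2) x y)) => //.
- by move=> a b c ab bc; rewrite (itvint_chasles lFg ab bc); ring.
- by move=> a b c ab bc; rewrite (itvint_chasles lg2 ab bc); ring.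
- by move=> a b ab; rewrite mulr_ge0 ?mulr_ge0// itvint_ge0// => t; exact: sqr_ge0.
- move=> a b ab; set I := itvint (fun t => `|g t|) a b.
  have I2 : I ^+ 2 <= (b - a) * itvint (fun t => g t ^+ 2) a b.
    have [] := @sqi_lin _ _ _ mu 0 g g sg sg.
    move=> _ _; have sng : sqi mu (fun t => `|g t|).
      by split; [case: lag|under eq_fun do rewrite real_normK ?num_real//; case: sg].
    apply: le_trans (itvint_sqr_le sng ab) _.
    by under eq_itvint do rewrite real_normK ?num_real//.
  have I0 : 0 <= I by exact: itvint_ge0.
  have fI t : a <= t <= b -> `|f t - f a| <= I.
    move=> /andP[at_ tb]; rewrite (fg _ _ at_).
    apply: (@le_trans _ _ (itvint (fun t => `|g t|) a t)).
      by apply: norm_itvint_le.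
    by rewrite /I (itvint_chasles lag at_ tb) lerDl itvint_ge0.
  have lgFa : linteg (fun t => g t * F' (f a)).
    by have := lintegZ (F' (f a)) lg; under eq_fun do rewrite mulrC.
  have -> : F (f b) - F (f a) - itvint (fun t => g t * F' (f t)) a b =
     (F (f b) - F (f a) - F' (f a) * (f b - f a)) -
     itvint (fun t => g t * F' (f t) - g t * F' (f a)) a b.
    rewrite itvintB//.
    have -> : itvint (fun t => g t * F' (f a)) a b = F' (f a) * (f b - f a).
      by rewrite fg// -itvintZ//; apply: eq_itvint => t _; rewrite mulrC.
    ring.
  have h : `|itvint (fun t => g t * F' (f t) - g t * F' (f a)) a b| <= 2 * K * I * I.
    rewrite {2}/I -itvintZ//; apply: norm_itvint_le => [||t tab].
    - have := linteg_lin (-1) lgFa lFg.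
      by under eq_fun do rewrite mulN1r addrC.
    - exact: lintegZ.
    - rewrite -mulrBr normrM mulrC ler_wpM2r//.
      apply: le_trans (C11_lip _ _ FK) _.
      by rewrite ler_wpM2l ?mulr_ge0//; exact: fI.
  apply: le_trans (ler_normB _ _) _.
  apply: le_trans (lerD (FK _ _) h) _.
  have fI2 : (f b - f a) ^+ 2 <= I ^+ 2.
    by rewrite -(real_normK (num_real (f b - f a))) ler_pXn2r ?nnegrE// fI// ab lexx.
  have := ler_wpM2l K0 fI2; have := ler_wpM2l K0 I2; nra.
Qed.

(** The same squeeze: over [a, b] the defect is the integral of (phi b - phi t) g t - (f t - f a)
    dphi t, which is at most 2 L (b - a) times the integral of |g|. *)
Lemma primitive_mul f g phi dphi L : sqi mu g -> primitive f g ->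
  primitive phi dphi -> continuous dphi -> (forall x, `|dphi x| <= L) ->
  linteg (fun t => g t * phi t + f t * dphi t) ->
  primitive (fun t => f t * phi t) (fun t => g t * phi t + f t * dphi t).
Proof.
move=> sg fg pd cd dL lint x y xy; have lg := sqi_linteg sg; have [mg _] := sg.
have cf := primitive_continuous sg fg; have ld := linteg_cts cd.
have lag := linteg_norm lg.
have L0 : 0 <= L by apply: le_trans (dL 0).
apply/eqP; rewrite -subr_eq0; apply/eqP.
apply: (@additive_squeeze0 (fun x y => f y * phi y - f x * phi x -
     itvint (fun t => g t * phi t + f t * dphi t) x y)
   (fun x y => 2 * L * itvint (fun t => `|g t|) x y)) => //.
- by move=> a b c ab bc; rewrite (itvint_chasles lint ab bc); ring.
- by move=> a b c ab bc; rewrite (itvint_chasles lag ab bc); ring.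
- by move=> a b ab; rewrite mulr_ge0 ?mulr_ge0// itvint_ge0.
- move=> a b ab; set I := itvint (fun t => `|g t|) a b.
  have I0 : 0 <= I by exact: itvint_ge0.
  have fI t : a <= t <= b -> `|f t - f a| <= I.
    move=> /andP[at_ tb]; rewrite (fg _ _ at_).
    apply: (@le_trans _ _ (itvint (fun t => `|g t|) a t)).
      by apply: norm_itvint_le.
    by rewrite /I (itvint_chasles lag at_ tb) lerDl itvint_ge0.
  have pI t : a <= t <= b -> `|phi b - phi t| <= L * (b - a).
    move=> /andP[at_ tb]; rewrite (pd _ _ tb).
    apply: (@le_trans _ _ (L * (b - t))); last by rewrite ler_wpM2l// lerB.
    by rewrite -itvint_cst//; apply: norm_itvint_le => //; exact: linteg_cst.
  pose lhs := linteg_lin (phi b) lg (lintegZ (f a) ld).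
  have E : f b * phi b - f a * phi a = itvint (fun t => phi b * g t + f a * dphi t) a b.
    by rewrite itvint_lin// ?itvintZ//; [rewrite -fg// -pd//; ring|exact: lintegZ].
  rewrite E -itvintB//.
  have -> : (b - a) * (2 * L * I) = itvint (fun t => L * (b - a) * `|g t| + I * L) a b.
    rewrite itvint_lin//; last exact: linteg_cst.
    by rewrite itvint_cst// -/I; ring.
  apply: norm_itvint_le => [||t tab].
  - have := linteg_lin (-1) lint lhs.
    by under eq_fun do rewrite mulN1r addrC.
  - by apply: linteg_lin => //; exact: linteg_cst.
  - have -> : phi b * g t + f a * dphi t - (g t * phi t + f t * dphi t) =
      (phi b - phi t) * g t - (f t - f a) * dphi t by ring.
    apply: le_trans (ler_normB _ _) _; rewrite !normrM.
    by apply: lerD; apply: ler_pM => //; [exact: pI|exact: fI].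
Qed.

End Primitive.

(** * The positive part of a primitive, and uniqueness of the derivative *)

Section PositivePart.
Variable R : realType.
Local Notation mu := (@lebesgue_measure R).
Implicit Types (f g h : R -> R) (x y z : R).

(** The C^{1,1} building block: both the smoothed positive part and the cut-off [step] are
    combinations of its shifts. *)
Definition sqpos (s : R) : R := Num.max s 0 ^+ 2.

Lemma sqpos_C11 : C11 sqpos (fun s => 2 * Num.max s 0) 1.
Proof.
move=> a b; rewrite /sqpos mul1r ler_norml.
have ab2 := sqr_ge0 (b - a); have a2 := sqr_ge0 a; have b2 := sqr_ge0 b.
have [ha|ha] := leP a 0; have [hb|hb] := leP b 0.
- by apply/andP; split; nra.
- have ? : 0 <= - a * b by rewrite mulr_ge0 ?oppr_ge0// ltW.
  by apply/andP; split; nra.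
- have ? : 0 <= a * - b by rewrite mulr_ge0 ?oppr_ge0// ltW.
  by apply/andP; split; nra.
- by apply/andP; split; nra.
Qed.

Lemma C11_shift F F' (K c : R) : C11 F F' K -> C11 (fun s => F (s - c)) (fun s => F' (s - c)) K.
Proof.
move=> FK a b; have := FK (a - c) (b - c).
by rewrite (_ : b - c - (a - c) = b - a)//; ring.
Qed.

Lemma C11_lin (k K1 K2 : R) F1 F1' F2 F2' : C11 F1 F1' K1 -> C11 F2 F2' K2 ->
  C11 (fun s => k * F1 s + F2 s) (fun s => k * F1' s + F2' s) (`|k| * K1 + K2).
Proof.
move=> h1 h2 a b.
have -> : k * F1 b + F2 b - (k * F1 a + F2 a) - (k * F1' a + F2' a) * (b - a) =
  k * (F1 b - F1 a - F1' a * (b - a)) + (F2 b - F2 a - F2' a * (b - a)) by ring.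
apply: le_trans (ler_normD _ _) _; rewrite normrM mulrDl.
by apply: lerD; [rewrite -mulrA ler_wpM2l//; exact: h1|exact: h2].
Qed.

Lemma C11_0 : C11 (fun=> 0) (fun=> 0) (0 : R).
Proof. by move=> a b; rewrite subr0 !mul0r subr0 normr0. Qed.

(* A [C11] approximation of [max s 0]; its derivative is [s / e] clamped to [[0, 1]]. *)
Definition pos_smooth (e s : R) : R := (2 * e)^-1 * sqpos s - (2 * e)^-1 * sqpos (s - e).
Definition pos_smooth' (e s : R) : R :=
  (2 * e)^-1 * (2 * Num.max s 0) - (2 * e)^-1 * (2 * Num.max (s - e) 0).

Lemma pos_smooth_C11 e : exists K, C11 (pos_smooth e) (pos_smooth' e) K.
Proof.
have h := C11_lin (2 * e)^-1 sqpos_C11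
  (C11_lin (- (2 * e)^-1) (C11_shift e sqpos_C11) C11_0).
eexists => a b; have := h a b; rewrite !addr0 !mulNr; exact.
Qed.

Lemma pos_smooth'E e s : 0 < e ->
  pos_smooth' e s = if s <= 0 then 0 else if s <= e then s / e else 1.
Proof.
move=> e0; rewrite /pos_smooth'.
case: (leP s 0) => s0; first by rewrite (max_r (_ : s - e <= 0)) ?mulr0 ?subr0//; lra.
case: (leP s e) => se; first by rewrite max_r ?subr_le0// !mulr0 subr0; field; lra.
by rewrite max_l ?subr_ge0 ?ltW//; field; lra.
Qed.

Lemma pos_smooth'_itv e s : 0 < e -> 0 <= pos_smooth' e s <= 1.
Proof.
move=> e0; rewrite pos_smooth'E//; case: (leP s 0) => s0; first by rewrite lexx ler01.
case: (leP s e) => se; last by rewrite lexx ler01.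
by rewrite (divr_ge0 (ltW s0) (ltW e0))/= ler_pdivrMr// mul1r.
Qed.

Lemma pos_smooth_near e s : 0 < e -> `|pos_smooth e s - Num.max s 0| <= e.
Proof.
move=> e0; rewrite /pos_smooth /sqpos -mulrBr.
have e20 : 0 < (2 * e)^-1 by rewrite invr_gt0 mulr_gt0.
rewrite (_ : _ - Num.max s 0 =
  (2 * e)^-1 * (Num.max s 0 ^+ 2 - Num.max (s - e) 0 ^+ 2 - 2 * e * Num.max s 0)); last first.
  by field; rewrite gt_eqF.
rewrite normrM gtr0_norm// ler_pdivrMl ?mulr_gt0//.
rewrite ler_norml.
case: (leP s 0) => s0; first by rewrite max_r; [apply/andP; split; nra|lra].
by case: (leP (s - e) 0) => se; apply/andP; split; nra.
Qed.

(** Chain rule for [pos_smooth], then e -> 0 by dominated convergence with bound |g|. The smoothed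
    derivative is 0 for s <= 0, so it converges everywhere to the indicator of s > 0, and the zero
    set of f asks for no separate argument. *)
Lemma primitive_pos f g : sqi mu g -> primitive f g ->
  primitive (fun x => Num.max (f x) 0) (fun x => g x * \1_[set t | 0 < f t] x).
Proof.
move=> sg fg x y xy; have lg := sqi_linteg sg; have [mg ig] := lg.
have cf := primitive_continuous sg fg.
have mf : measurable_fun setT f by exact: continuous_measurable_fun.
pose e (n : nat) : R := n.+1%:R^-1.
have e0 n : 0 < e n by rewrite invr_gt0.
pose h n t := g t * pos_smooth' (e n) (f t).
have ph n : primitive (pos_smooth (e n) \o f) (h n).
  have [K hK] := pos_smooth_C11 (e n).
  apply: (primitive_chain sg fg hK (L := 1)) => s.
  by have /andP[? ?] := pos_smooth'_itv s (e0 n); rewrite ger0_norm.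
have mh n : measurable_fun setT (h n).
  apply: measurable_funM => //; have [K hK] := pos_smooth_C11 (e n).
  apply: continuous_measurable_fun => t; apply: continuous_comp; first exact: cf.
  exact: C11_continuous hK _.
have ecv : e @ \oo --> (0 : R) by exact: cvg_harmonic.
have cvI : (fun n => itvint (h n) x y) @ \oo -->
    itvint (fun x => g x * \1_[set t | 0 < f t] x) x y.
  have [] := @dominated_convergence _ _ _ mu `[x, y] (measurable_itv _)
    (fun n => EFin \o h n) (EFin \o (fun x => g x * \1_[set t | 0 < f t] x))
    (EFin \o (fun t => `|g t|)).
  - by move=> n; apply/measurable_EFinP; exact: measurable_funTS (mh n).
  - apply/measurable_EFinP; apply: measurable_funTS; apply: measurable_funM; first exact: mg.
    apply: measurable_indic; rewrite (_ : [set t | _] = setT `&` f @^-1` `]0, +oo[).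
      exact: (mf measurableT).
    by rewrite setTI; apply/seteqP; split => t /=; rewrite in_itv/= andbT.
  - apply: aeW => t _; apply: cvg_EFin; first exact: nearW.
    apply: cvgM; first exact: cvg_cst.
    rewrite indicE; have [f0|f0] := ltP 0 (f t).
      rewrite mem_set//; apply: cvg_near_cst.
      have /cvgrPdist_lt /(_ _ f0) := ecv; apply: filterS => n.
      rewrite sub0r normrN (ger0_norm (ltW (e0 n))) => en.
      by rewrite pos_smooth'E// leNgt f0 /= leNgt en.
    rewrite memNset /=; last by apply/negP; rewrite -leNgt.
    under eq_fun do rewrite pos_smooth'E// f0.
    exact: cvg_cst.
  - by have [_] := linteg_norm lg; apply.
  - apply: aeW => t n _ /=; rewrite lee_fin /h normrM ler_piMr//.
    by have /andP[? ?] := pos_smooth'_itv (f t) (e0 n); rewrite ger0_norm.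
  move=> I1 _; rewrite -(fineK (integrable_fin_num _ I1))// => h2.
  exact: (fine_cvg h2).
have cvL : (fun n => pos_smooth (e n) (f y) - pos_smooth (e n) (f x)) @ \oo -->
   Num.max (f y) 0 - Num.max (f x) 0.
  have cv1 t : (fun n => pos_smooth (e n) t) @ \oo --> Num.max t 0.
    apply/cvgrPdist_le => d d0; have /cvgrPdist_lt /(_ _ d0) := ecv.
    apply: filterS => n; rewrite sub0r normrN (ger0_norm (ltW (e0 n))) => en.
    by rewrite distrC; apply: le_trans (pos_smooth_near _ (e0 n)) (ltW en).
  by apply: cvgB.
apply: (cvg_unique _ cvL) => //.
have -> : (fun n => pos_smooth (e n) (f y) - pos_smooth (e n) (f x)) =
   (fun n => itvint (h n) x y) by apply/funext => n; rewrite -ph.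
exact: cvI.
Qed.

(** The difference has zero integral over every interval, hence is 0 at each of its Lebesgue
    points. *)
Lemma primitive_unique f g1 g2 : linteg g1 -> linteg g2 -> primitive f g1 -> primitive f g2 ->
  {ae mu, forall x, g1 x = g2 x}.
Proof.
move=> l1 l2 p1 p2; pose g t := g1 t - g2 t.
have lg : linteg g.
  by have := linteg_lin (-1) l2 l1; under eq_fun do rewrite mulN1r addrC.
have g0 x y : x <= y -> itvint g x y = 0.
  by move=> xy; rewrite itvintB// -p1// -p2// subrr.
have [mg ig] := lg.
have loc : locally_integrable setT g.
  split => //; first exact: openT.
  move=> K _ cK; have [M [_ hM]] := compact_bounded cK.
  have /integrableP[_] := ig (- (M + 1)) (M + 1).
  apply: le_lt_trans; apply: ge0_subset_integral => //.
  - exact: compact_measurable.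
  - by apply/measurable_EFinP; apply: measurable_funTS; exact: measurableT_comp.
  - move=> t Kt; rewrite /= in_itv /= -ler_norml.
    by apply: (hM (M + 1)) => //; rewrite ltrDl.
move: (lebesgue_differentiation loc); apply: filterS; first exact: (ae_filter_ringOfSetsType mu).
move=> x ptx.
apply/eqP; rewrite -subr_eq0 -/(g x).
have [] := @FTC1_lebesgue_pt _ g (BLeft (x - 1)) x (x + 1) _ (ig _ _) _ ptx.
- by rewrite ltrDl.
- by rewrite (@lte_fin R) gtrBl.
move=> _ <-; rewrite (_ : (fun y => _) = cst 0) ?derive1_cst//.
apply/funext => y; have [h|h] := leP (x - 1) y; first exact: g0.
by rewrite set_itv_ge ?Rintegral_set0// bnd_simp -ltNge.
Qed.

End PositivePart.

(** * Weak derivatives on an interval versus primitives *)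

Section WeakDerivative.
Variable R : realType.
Local Notation mu := (@lebesgue_measure R).
Implicit Types (f g h : R -> R) (x y z : R).

Lemma Rintegral_eq_supp (A B : set R) h :
  (forall x, ~ A x -> h x = 0) -> (forall x, ~ B x -> h x = 0) ->
  \int[mu]_(x in A) h x = \int[mu]_(x in B) h x.
Proof.
move=> hA hB; rewrite [LHS]Rintegral_mkcond [RHS]Rintegral_mkcond.
apply: eq_Rintegral => x _; rewrite !patchE.
case: ifPn; rewrite ?inE ?notin_setE => xA; case: ifPn; rewrite ?inE ?notin_setE => xB //.
- by rewrite hB.
- by rewrite hA.
Qed.

Lemma primitive_C1 phi : (forall x, derivable phi x 1) -> continuous (derive1 phi) ->
  primitive phi (derive1 phi).
Proof.
move=> dphi cphi x y; rewrite le_eqVlt => /predU1P[->|xy]; first by rewrite subrr itvintxx.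
have cp z : {for z, continuous phi} by apply: differentiable_continuous; exact/derivable1_diffP.
have dp : derivable_oo_LRcontinuous phi x y.
  split=> [z _||]; first exact: dphi.
    by apply: cvg_at_right_filter; exact: cp.
  by apply: cvg_at_left_filter; exact: cp.
have := continuous_FTC2 xy (continuous_subspaceT cphi) dp (fun z _ => erefl).
by rewrite /itvint /Rintegral => ->.
Qed.

Lemma C1cP (D : set R) phi : C1c D phi -> exists a b M, [/\ a < b,
  forall x, ~ (a < x < b) -> phi x = 0 /\ derive1 phi x = 0,
  forall x, ~ D x -> phi x = 0 /\ derive1 phi x = 0 &
  forall x, `|phi x| <= M /\ `|derive1 phi x| <= M].
Proof.
move=> [dphi cphi [K [cK KD phi0]]].
have dphi0 x : ~ K x -> derive1 phi x = 0.
  move=> Kx; rewrite derive1E.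
  have oK : open (~` K) by apply: closed_openC; apply: compact_closed.
  rewrite (@near_eq_derive _ _ _ phi (cst 0)).
    by rewrite derive_cst.
  have := open_nbhs_nbhs (conj oK Kx); apply: filterS => t Kt /=.
  exact: phi0.
have [M [_ hM]] := compact_bounded cK.
have KM x : K x -> - (`|M| + 1) <= x <= `|M| + 1.
  by move=> Kx; rewrite -ler_norml hM// (le_lt_trans (ler_norm _))// ltrDl.
have bnd h : continuous h -> exists C, forall x, K x -> `|h x| <= C.
  move=> ch; have [] := @EVT_max R (fun x => `|h x|) (- (`|M| + 1)) (`|M| + 1).
  - by have := normr_ge0 M; lra.
  - apply: continuous_subspaceT => x; apply: continuous_comp; first exact: ch.
    exact: norm_continuous.
  - move=> c _ hc; exists `|h c| => x Kx; apply: hc.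
    by rewrite in_itv/= KM.
have cp : continuous phi by move=> z; apply: differentiable_continuous; exact/derivable1_diffP.
have [C1 hC1] := bnd _ cp; have [C2 hC2] := bnd _ cphi.
exists (- (`|M| + 2)), (`|M| + 2), (`|C1| + `|C2|); split.
- by have := normr_ge0 M; lra.
- move=> x xab; have Kx : ~ K x by move=> /KM /andP[? ?]; apply: xab; apply/andP; split; lra.
  by split; [exact: phi0|exact: dphi0].
- by move=> x Dx; have Kx : ~ K x by [move=> /KD]; split; [exact: phi0|exact: dphi0].
- move=> x; have [Kx|Kx] := pselect (K x).
    have := hC1 _ Kx; have := hC2 _ Kx; have := ler_norm C1; have := ler_norm C2.
    by have := normr_ge0 C1; have := normr_ge0 C2; split; lra.
  by rewrite phi0// dphi0// normr0 addr_ge0.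
Qed.

(** Integration by parts: [primitive_mul] on a segment at whose ends phi vanishes, phi and its
    derivative being 0 outside. *)
Lemma primitive_weak (D : set R) f g : sqi mu g -> primitive f g ->
  (forall x, ~ D x -> g x = 0) -> is_weak_derivative D f g.
Proof.
move=> sg fg gD phi cphi; have [a [b [M [ab pab pD pM]]]] := C1cP cphi.
have [dphi cdphi _] := cphi.
have cp : continuous phi by move=> z; apply: differentiable_continuous; exact/derivable1_diffP.
have cf := primitive_continuous sg fg.
have lgp : linteg (fun t => g t * phi t).
  apply: (@lintegM _ _ _ M (sqi_linteg sg)); first exact: continuous_measurable_fun.
  by move=> t; have [] := pM t.
have lfp : linteg (fun t => f t * derive1 phi t).
  by apply: linteg_cts => t; apply: cvgM; [exact: cf|exact: cdphi].
have p := primitive_mul sg fg (primitive_C1 dphi cdphi) cdphi (fun t => (pM t).2) (lintegD lgp lfp).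
have := p _ _ (ltW ab).
have /pab[-> _] : ~ (a < a < b) by rewrite ltxx.
have /pab[-> _] : ~ (a < b < b) by rewrite ltxx andbF.
rewrite !mulr0 subrr itvintD// => /esym/eqP; rewrite addr_eq0 => /eqP E.
have off h : (forall x, ~ (a < x < b) -> h x = 0) -> forall x, ~ `[a, b]%classic x -> h x = 0.
  by move=> h0 x xab; apply: h0 => /andP[ax xb]; apply: xab; rewrite /= in_itv/= !ltW.
have -> : \int[mu]_(x in D) (f x * derive1 phi x) = itvint (fun x => f x * derive1 phi x) a b.
  apply: Rintegral_eq_supp => [x /pD[_ ->]|]; first by rewrite mulr0.
  by apply: off => x /pab[_ ->]; rewrite mulr0.
have -> : \int[mu]_(x in D) (g x * phi x) = itvint (fun x => g x * phi x) a b.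
  apply: Rintegral_eq_supp => [x /pD[-> _]|]; first by rewrite mulr0.
  by apply: off => x /pab[-> _]; rewrite mulr0.
by rewrite E opprK.
Qed.

(* A C1 step from [0] to [1] on [[0, e]]: a quadratic spline. *)
Definition step (e s : R) : R :=
  2 / e ^+ 2 * (sqpos s - 2 * sqpos (s - e / 2) + sqpos (s - e)).
Definition step' (e s : R) : R :=
  4 / e ^+ 2 * (Num.max s 0 - 2 * Num.max (s - e / 2) 0 + Num.max (s - e) 0).

Lemma step_C11 e : exists K, C11 (step e) (step' e) K.
Proof.
pose c := 2 / e ^+ 2.
have h := C11_lin c (@sqpos_C11 R) (C11_lin (-2 * c) (C11_shift (e / 2) (@sqpos_C11 R))
  (C11_lin c (C11_shift e (@sqpos_C11 R)) (@C11_0 R))).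
eexists => a b; apply: le_trans (h a b).
by rewrite le_eqVlt; apply/orP; left; apply/eqP; congr `| _ |; rewrite /step /step' /c; ring.
Qed.

Lemma step_val e s : 0 < e ->
  [/\ s <= 0 -> step e s = 0, e <= s -> step e s = 1,
      0 <= step' e s & ~ (0 <= s <= e) -> step' e s = 0].
Proof.
move=> e0; have e2 : 0 < e ^+ 2 by rewrite exprn_gt0.
have en : e != 0 by rewrite gt_eqF.
split.
- move=> s0; rewrite /step /sqpos !max_r; [by rewrite expr0n /=; ring|lra..].
- move=> es; rewrite /step /sqpos !max_l; [by field|lra..].
- rewrite /step'; apply: mulr_ge0; first by apply: divr_ge0 => //; exact: ltW.
  case: (leP s 0) => s0; case: (leP (s - e / 2) 0) => s1; case: (leP (s - e) 0) => s2; lra.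
- move=> /negP; rewrite negb_and -!ltNge => /orP[s0|es].
    by rewrite /step' !max_r; [ring|lra..].
  by rewrite /step' !max_l; [field|lra..].
Qed.

(** [step'] is a nonnegative kernel of mass 1 on [x, x + e], so the integral is an average of values
    of k within d of k x. *)
Lemma step_average (k : R -> R) x e d : continuous k -> 0 < e ->
  (forall t, x <= t <= x + e -> `|k t - k x| <= d) ->
  `|itvint (fun t => k t * step' e (t - x)) x (x + e) - k x| <= d.
Proof.
move=> ck e0 kd; have xe : x <= x + e by rewrite lerDl ltW.
have [K hK] := step_C11 e.
have hKx := C11_shift x hK.
have cs := C11_continuous hKx; have ls := linteg_cts cs.
have I1 : itvint (fun t => step' e (t - x)) x (x + e) = 1.
  rewrite -(C11_primitive hKx xe) subrr.
  rewrite (_ : x + e - x = e); last by ring.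
  have [_ /(_ (lexx e)) -> _ _] := step_val e e0.
  by have [/(_ (lexx 0)) -> _ _ _] := step_val 0 e0; rewrite subr0.
have lk : linteg (fun t => k t * step' e (t - x)).
  by apply: linteg_cts => t; apply: cvgM; [exact: ck|exact: cs].
rewrite -[k x]mulr1 -[X in k x * X]I1 -itvintZ// -itvintB//; last exact: lintegZ.
rewrite -[leRHS]mulr1 -[X in d * X]I1 -itvintZ//.
apply: norm_itvint_le => [||t txe].
- have := linteg_lin (-1) (lintegZ (k x) ls) lk.
  by under eq_fun do rewrite mulN1r addrC.
- exact: lintegZ.
- have [_ _ s0 _] := step_val (t - x) e0.
  by rewrite -mulrBl normrM (ger0_norm s0) ler_wpM2r// kd.
Qed.

(** The lemma of du Bois-Reymond. The difference of a step at x and a step at y has compact support,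
    and its derivative is the difference of two averaging kernels; so the averages of k just after x
    and just after y agree, and each is within d / 2 of the value there. *)
Lemma weak_constant (D : set R) (k : R -> R) : continuous k -> open D ->
  (forall x y z, D x -> D z -> x <= y <= z -> D y) ->
  (forall phi, C1c D phi -> \int[mu]_(x in D) (k x * derive1 phi x) = 0) ->
  forall x y, D x -> D y -> k x = k y.
Proof.
move=> ck oD iD kphi x y; wlog xy : x y / x < y.
  move=> H Dx Dy; have [xy|yx|->//] := ltgtP x y; first exact: H.
  by apply/esym; exact: H.
move=> Dx Dy; apply/eqP; rewrite -subr_eq0 -normr_le0; apply/ler_addgt0Pl => d d0.
rewrite addr0.
have d20 : 0 < d / 2 by rewrite divr_gt0.
have near_pt z : D z -> exists2 e, 0 < e & forall e' : R, 0 < e' <= e ->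
    D (z + e') /\ forall t, z <= t <= z + e' -> `|k t - k z| <= d / 2.
  move=> Dz.
  have : \forall t \near z, D t /\ `|k z - k t| < d / 2.
    near=> t; split; near: t; first exact: open_nbhs_nbhs.
    by move/cvgrPdist_lt : (ck z); exact.
  move=> [e /= e0 he]; exists (e / 2); first by rewrite divr_gt0.
  move=> e' /andP[e'0 e'e].
  have in_ball t : z <= t <= z + e' -> ball z e t.
    by move=> /andP[zt tz]; rewrite /ball /= distrC ger0_norm ?subr_ge0//; lra.
  split; first by have [] := he (z + e') (in_ball _ _) => //; rewrite lexx lerDl ltW.
  by move=> t /in_ball /he[_ /ltW]; rewrite distrC.
have [e1 e10 h1] := near_pt x Dx; have [e2 e20 h2] := near_pt y Dy.
pose e := Num.min e1 e2.
have e0 : 0 < e by rewrite lt_min e10.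
have ee1 : 0 < e <= e1 by rewrite e0 /e ge_min lexx.
have ee2 : 0 < e <= e2 by rewrite e0 /e ge_min lexx orbT.
have [_ kx] := h1 e ee1; have [Dye ky] := h2 e ee2.
have ax := step_average ck e0 kx; have ay := step_average ck e0 ky.
have Dxy t : x <= t <= y + e -> D t by move=> /iD; exact.
have [K hK] := step_C11 e.
have hx := C11_shift x hK; have hy := C11_shift y hK.
pose phi t := step e (t - x) - step e (t - y).
have hphi : C11 phi (fun t => step' e (t - x) - step' e (t - y)) (K + K).
  move=> a b; have := C11_lin (-1) hy hx a b; rewrite normrN normr1 mul1r.
  by apply: le_trans; rewrite le_eqVlt /phi; apply/orP; left; apply/eqP; congr `|_|; ring.
have dphi t : derive1 phi t = step' e (t - x) - step' e (t - y).
  by rewrite derive1E; have [_ ->] := C11_derive t hphi.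
have cphi : continuous (derive1 phi).
  by rewrite (_ : derive1 phi = (fun t => step' e (t - x) - step' e (t - y)));
    [exact: C11_continuous hphi|exact/funext].
have supp_step z t : ~ (z <= t <= z + e) -> step' e (t - z) = 0.
  move=> zt; have [_ _ _ ->//] := step_val (t - z) e0.
  by rewrite subr_ge0 lerBlDl.
have test : C1c D phi.
  split; [by move=> t; have [] := C11_derive t hphi|exact: cphi|].
  exists `[x, y + e]%classic; split; first exact: segment_compact.
    by move=> t; rewrite /= in_itv/=; exact: Dxy.
  move=> t; rewrite /= in_itv/= => /negP; rewrite negb_and -!ltNge => /orP[tx|yt].
    have [h0 _ _ _] := step_val (t - x) e0; have [h0' _ _ _] := step_val (t - y) e0.
    by rewrite /phi h0 ?h0' ?subrr//; lra.
  have [_ h0 _ _] := step_val (t - x) e0; have [_ h0' _ _] := step_val (t - y) e0.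
  by rewrite /phi h0 ?h0' ?subrr//; lra.
have lk h K' h' : C11 h h' K' -> linteg (fun t => k t * h' t).
  move=> hh; apply: linteg_cts => t; apply: cvgM; first exact: ck.
  exact: (C11_continuous hh).
have := kphi _ test.
have -> : \int[mu]_(t in D) (k t * derive1 phi t) =
   itvint (fun t => k t * step' e (t - x) - k t * step' e (t - y)) x (y + e).
  rewrite /itvint; under eq_Rintegral do rewrite dphi mulrBr.
  apply: Rintegral_eq_supp => t Dt.
    by rewrite !supp_step ?mulr0 ?subrr// => /andP[? ?]; apply: Dt; apply: Dxy; lra.
  rewrite !supp_step ?mulr0 ?subrr// => /andP[? ?]; apply: Dt; rewrite /= in_itv/=; lra.
rewrite itvintB; [|exact: lk hx|exact: lk hy].
have -> : itvint (fun t => k t * step' e (t - x)) x (y + e) =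
    itvint (fun t => k t * step' e (t - x)) x (x + e).
  apply: Rintegral_eq_supp => t; rewrite /= in_itv/= => ht; rewrite supp_step ?mulr0// => /andP[? ?].
  by apply: ht; lra.
have -> : itvint (fun t => k t * step' e (t - y)) x (y + e) =
    itvint (fun t => k t * step' e (t - y)) y (y + e).
  apply: Rintegral_eq_supp => t; rewrite /= in_itv/= => ht; rewrite supp_step ?mulr0// => /andP[? ?].
  by apply: ht; lra.
move=> /eqP; rewrite subr_eq0 => /eqP E.
rewrite E in ax.
have -> : k x - k y = (itvint (fun t => k t * step' e (t - y)) y (y + e) - k y) -
   (itvint (fun t => k t * step' e (t - y)) y (y + e) - k x) by ring.
apply: le_trans (ler_normB _ _) _; rewrite [leRHS](splitr d); exact: lerD.
Unshelve. all: end_near. Qed.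

Lemma primitive_exists g : linteg g -> exists G, primitive G g.
Proof.
move=> lg; exists (fun t => if 0 <= t then itvint g 0 t else - itvint g t 0) => x y xy.
have [y0|y0] := leP 0 y; have [x0|x0] := leP 0 x.
- by rewrite (itvint_chasles lg x0 xy); ring.
- by rewrite (itvint_chasles lg (ltW x0) y0); ring.
- by have := lt_le_trans y0 (le_trans x0 xy); rewrite ltxx.
- by rewrite (itvint_chasles lg xy (ltW y0)); ring.
Qed.

Lemma powR2 (a : R) : `|a| `^ 2 = a ^+ 2.
Proof. by rewrite -[2]/(2%:R) powR_mulrn// real_normK ?num_real. Qed.

Lemma square_integrable_sqi (D : set R) g : measurable D ->
  square_integrable D g <-> sqi mu (fun x => g x * \1_D x).
Proof.
move=> mD.
have gE : (fun x => g x * \1_D x) = g \_ D.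
  by apply/funext => x; rewrite patchE indicE; case: ifP; rewrite ?mulr1 ?mulr0.
have E : (\int[mu]_(x in D) (`|g x| `^ 2)%:E = \int[mu]_x ((g x * \1_D x) ^+ 2)%:E)%E.
  rewrite [LHS]integral_mkcond; apply: eq_integral => x _; rewrite patchE indicE powR2.
  by case: ifP; rewrite ?mulr1// mulr0 expr0n.
split => [[mg ig]|[mg ig]].
  have mgD : measurable_fun setT (fun x => g x * \1_D x).
    by rewrite gE; apply/(measurable_restrictT _ mD).
  split => //; apply/integrableP; split.
    by apply/measurable_EFinP; exact: measurable_funX.
  by under eq_integral do rewrite gee0_abs ?lee_fin ?sqr_ge0//; rewrite -E.
split; first by apply/(measurable_restrictT _ mD); rewrite -gE.
rewrite E; exact: (integrable_lty measurableT ig).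
Qed.

Lemma Lpow_sqi (D : set R) g : measurable D -> square_integrable D g ->
  (\int[mu]_(x in D) (`|g x| `^ 2)%:E = (ip mu (fun x => g x * \1_D x) (fun x => g x * \1_D x))%:E)%E.
Proof.
move=> mD /(square_integrable_sqi _ mD) sg; rewrite -ipE// [LHS]integral_mkcond.
apply: eq_integral => x _; rewrite patchE indicE powR2.
by case: ifP; rewrite ?mulr1// mulr0 expr0n.
Qed.

(** [edge_interior e] is convertible to [oitv (edge_length e)]; this transfers statements about
    intervals to edges. *)
Definition oitv (l : \bar R) : set R := [set x | (0 < x) && (x%:E < l)%E].

Lemma oitvE l : [\/ exists r, oitv l = `]0, r[%classic, oitv l = `]0, +oo[%classic | oitv l = set0].
Proof.
case: l => [r||]; [apply: Or31; exists r|apply: Or32|apply: Or33].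
- by apply/seteqP; split => x; rewrite /oitv /= in_itv/= lte_fin.
- by apply/seteqP; split => x; rewrite /oitv /= in_itv/= ltry.
- by apply/seteqP; split => x; rewrite /oitv /= ?andbF.
Qed.

Lemma oitv_measurable l : measurable (oitv l).
Proof. by have [[r ->]|->|->] := oitvE l. Qed.

Lemma oitv_open l : open (oitv l).
Proof. by have [[r ->]|->|->] := oitvE l; [exact: interval_open..|exact: open0]. Qed.

Lemma oitv_convex l x y z : oitv l x -> oitv l z -> x <= y <= z -> oitv l y.
Proof.
move=> /= /andP[x0 _] /andP[_ zl] /andP[xy yz].
by rewrite /oitv /= (lt_le_trans x0 xy)/= (le_lt_trans _ zl)// lee_fin.
Qed.

Lemma integrable_C1c (D : set R) h phi : measurable D -> continuous h -> C1c D phi ->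
  mu.-integrable D (EFin \o (fun x => h x * derive1 phi x)).
Proof.
move=> mD ch cphi; have [a [b [M [ab pab _ _]]]] := C1cP cphi.
have [_ cd _] := cphi.
have lh : linteg (fun x => h x * derive1 phi x).
  by apply: linteg_cts => t; apply: cvgM; [exact: ch|exact: cd].
apply: (@integrableS _ _ _ mu setT) => //.
have E : EFin \o (fun x => h x * derive1 phi x) =
    (EFin \o (fun x => h x * derive1 phi x)) \_ `[a, b].
  apply/funext => x; rewrite patchE; case: ifPn => //; rewrite notin_setE /= in_itv/= => xab.
  by rewrite (pab x _).2 ?mulr0// => /andP[ax xb]; apply: xab; rewrite !ltW.
rewrite E -integrable_mkcond//.
by have [_] := lh; apply.
Qed.

Lemma oitv_near0 l : (0 < l)%E -> exists2 r : R, 0 < r & forall t : R, 0 < t <= r -> oitv l t.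
Proof.
case: l => [r| |//].
  rewrite lte_fin => r0; exists (r / 2); first by rewrite divr_gt0.
  by move=> t /andP[t0 tr]; rewrite /oitv /= t0 lte_fin; lra.
by move=> _; exists 1 => // t /andP[t0 _]; rewrite /oitv/= t0 ltry.
Qed.

(** Converse of [primitive_weak]. Subtract from f a primitive G of g cut to the interval: f - G is
    constant inside by [weak_constant], at the ends by continuity, and beyond them because f is
    frozen there, as [on_edge] is, and the cut g is 0. *)
Lemma weak_primitive (l : \bar R) f g : (0 < l)%E -> continuous f ->
  (forall x, x <= 0 -> f x = f 0) -> (forall x r, l = r%:E -> r <= x -> f x = f r) ->
  square_integrable (oitv l) g -> is_weak_derivative (oitv l) f g ->
  primitive f (fun x => g x * \1_(oitv l) x).
Proof.
move=> l0 cf f0 fl sg wg; set D := oitv l; set g' := fun x => g x * \1_D x.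
have mD : measurable D by exact: oitv_measurable.
have sg' : sqi mu g' by apply/square_integrable_sqi.
have lg' := sqi_linteg sg'.
have [G pG] := primitive_exists lg'.
have cG := primitive_continuous sg' pG.
have g'D x : ~ D x -> g' x = 0.
  by move=> Dx; rewrite /g' indicE memNset ?mulr0.
pose k x := f x - G x.
have ck : continuous k by move=> x; apply: cvgB; [exact: cf|exact: cG].
have kD x y : D x -> D y -> k x = k y.
  apply: weak_constant => //; [exact: oitv_open|exact: oitv_convex|move=> phi cphi].
  have := primitive_weak sg' pG g'D cphi.
  have -> : \int[mu]_(x in D) (g' x * phi x) = \int[mu]_(x in D) (g x * phi x).
    by apply: eq_Rintegral => t tD; rewrite /g' indicE tD mulr1.
  rewrite -(wg _ cphi) => E; under eq_Rintegral do rewrite /k mulrBl.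
  by rewrite RintegralB// ?E ?subrr//; exact: integrable_C1c.
have kcl x d : D d -> (forall e : R, 0 < e -> exists2 t, D t & `|x - t| < e) -> k x = k d.
  move=> Dd cl; apply/eqP; rewrite -subr_eq0 -normr_le0; apply/ler_addgt0Pl => e e0.
  rewrite addr0; have /cvgrPdist_lt /(_ _ e0) [r /= r0 hr] := ck x.
  have [t Dt xt] := cl _ r0.
  by rewrite -(kD _ _ Dt Dd); apply/ltW/hr.
have [r0 r00 Dr0] := oitv_near0 l0.
have k0 : k 0 = k r0.
  apply: kcl; first by apply: Dr0; rewrite r00 lexx.
  move=> e e0; exists (Num.min (e / 2) r0).
    by apply: Dr0; rewrite lt_min divr_gt0//= r00 ge_min lexx orbT.
  rewrite sub0r normrN gtr0_norm ?lt_min ?divr_gt0//.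
  by rewrite gt_min; apply/orP; left; lra.
have kx x : k x = k r0.
  have [x0|x0] := leP x 0.
    rewrite -k0 /k f0//; congr (_ - _); apply/eqP; rewrite eq_sym -subr_eq0 pG//.
    rewrite (@eq_itvint _ _ (fun=> 0)) ?itvint_cst ?mul0r// => t /andP[_ t0].
    by apply: g'D; rewrite /D /oitv/= ltNge t0.
  have [xl|lx] := ltP x%:E l.
    by apply: kD; [rewrite /D /oitv/= x0|apply: Dr0; rewrite r00 lexx].
  have [r lr] : exists r : R, l = r%:E.
    by move: l0 lx; clear; case: l => [r _ _| |]//; exists r.
  move: lx l0; rewrite lr lee_fin lte_fin => lx l0.
  have -> : k x = k r.
    rewrite /k (fl _ r)//; congr (_ - _); apply/eqP; rewrite -subr_eq0 pG//.
    rewrite (@eq_itvint _ _ (fun=> 0)) ?itvint_cst ?mul0r// => t /andP[rt _].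
    by apply: g'D; rewrite /D /oitv/= lr lte_fin (ltNge t r) rt andbF.
  apply: kcl; first by apply: Dr0; rewrite r00 lexx.
  move=> e e0; exists (r - Num.min (e / 2) (r / 2)).
    have m0 : 0 < Num.min (e / 2) (r / 2) by rewrite lt_min !divr_gt0.
    have mr : Num.min (e / 2) (r / 2) < r by rewrite gt_min; apply/orP; right; lra.
    by rewrite /D /oitv /= lr lte_fin; apply/andP; split; lra.
  rewrite opprB addrC subrK gtr0_norm ?lt_min ?divr_gt0//.
  by rewrite gt_min; apply/orP; left; lra.
move=> x y xy; rewrite -(pG _ _ xy).
have := kx x; rewrite -(kx y) /k => E.
by apply/eqP; rewrite -subr_eq0; apply/eqP; move: E; lra.
Qed.

End WeakDerivative.

(** * The space H^1 of a metric graph *)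

Section EdgeBundle.
Variables (R : realType) (G : metric_graph R).
Local Notation mu := (@lebesgue_measure R).

(* The disjoint union of the edges, edge [e] being placed over [pickle e]; all the
   norms of the graph become integrals over this single measure space. *)
Definition bundle : measurableType _ := (nat * measurableTypeR R)%type.
Definition slice_measure (n : nat) : {measure set bundle -> \bar R} :=
  measure_function_pushforward__canonical__measure_function_Measure
    (@lebesgue_measure R) (@pair1_measurable _ _ nat (measurableTypeR R) n).

(** Every natural number carries a full line, even one that codes no edge, and the line over an edge
    is longer than its interior; hence the recurring condition of vanishing off [bundle_supp]. *)
Definition bmu : {measure set bundle -> \bar R} := mseries slice_measure 0.

Implicit Types (F : bundle -> R) (phi : edge G -> R -> R) (e : edge G) (x y : R).

Definition bundle_supp : set bundle :=
  [set z | exists2 e : edge G, z.1 = pickle e & edge_interior e z.2].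

Definition spread phi : bundle -> R := fun z =>
  if pickle_inv z.1 is Some e then phi e z.2 * \1_(edge_interior e) z.2 else 0.

Lemma spreadE phi e x : spread phi (pickle e, x) = phi e x * \1_(edge_interior e) x.
Proof. by rewrite /spread /= pickleK_inv. Qed.

Lemma spread_slice phi e :
  (fun x => spread phi (pickle e, x)) = (fun x => phi e x * \1_(edge_interior e) x).
Proof. by apply/funext => x; exact: spreadE. Qed.

Lemma spread_out phi z : ~ bundle_supp z -> spread phi z = 0.
Proof.
move=> zS; rewrite /spread; case E : (pickle_inv z.1) => [e|//].
rewrite indicE memNset ?mulr0// => ez; apply: zS; exists e => //.
by have := @pickle_invK (edge G) z.1; rewrite E /= => ->.
Qed.

Lemma edge_interior_measurable e : measurable (edge_interior e).
Proof. exact: oitv_measurable. Qed.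

Lemma bundle_measurable_fun F :
  (forall n, measurable_fun setT (fun x : R => F (n, x))) -> measurable_fun setT F.
Proof.
move=> mF _ Y mY; rewrite setTI.
have -> : F @^-1` Y = \bigcup_n ([set n] `*` ((fun x : R => F (n, x)) @^-1` Y)).
  apply/seteqP; split=> [[n x] /= Fx|[n x] [m _ [/= -> Fx]]//]; by exists n.
apply: bigcup_measurable => n _; apply: measurableX => //.
by rewrite -[X in measurable X]setTI; exact: mF.
Qed.

Lemma slice_measurable_fun F n : measurable_fun setT F ->
  measurable_fun setT (fun x : R => F (n, x)).
Proof.
by move=> mF; exact: (measurableT_comp mF (@pair1_measurable _ _ _ (measurableTypeR R) n)).
Qed.

Lemma bundle_integral F : measurable_fun setT F -> (forall z, 0 <= F z) ->
  (forall z, ~ bundle_supp z -> F z = 0) ->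
  (\int[bmu]_z (F z)%:E = \esum_(e in [set: edge G]) \int[mu]_x (F (pickle e, x))%:E)%E.
Proof.
move=> mF F0 FS.
have I0 n : (0 <= \int[mu]_x (F (n, x))%:E)%E.
  by apply: integral_ge0 => x _; rewrite lee_fin.
have -> : (\int[bmu]_z (F z)%:E = \sum_(n <oo) \int[mu]_x (F (n, x))%:E)%E.
  have mFE : measurable_fun setT (fun z : bundle => (F z)%:E) by exact/measurable_EFinP.
  have F0' z : (0 <= (F z)%:E)%E by rewrite lee_fin.
  rewrite [LHS](ge0_integral_measure_series slice_measure measurableT (fun z _ => F0' z) mFE).
  apply: eq_eseriesr => n _.
  by rewrite [LHS](ge0_integral_pushforward (pair1_measurable n) _ measurableT mFE).
rewrite nneseries_esumT//.
rewrite -(@reindex_esum _ _ _ [set: edge G] (range (@pickle (edge G)))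
  (@pickle (edge G)) (fun n => \int[mu]_x (F (n, x))%:E)%E); last first.
  split; [by move=> e _; exists e|move=> e e' _ _; exact: (pcan_inj pickleK_inv)|by []].
rewrite [RHS]esum_mkcond; apply: eq_esum => n _.
case: ifPn => //; rewrite notin_setE => nr.
have F0n x : F (n, x) = 0.
  by apply: FS => -[e /= ne _]; apply: nr; exists e.
by under eq_integral do rewrite F0n; rewrite integral0.
Qed.

Lemma sqi_spread phi : (forall e, square_integrable (edge_interior e) (phi e)) ->
  (Lpow 2 phi < +oo)%E -> sqi bmu (spread phi).
Proof.
move=> sphi Lphi.
have mslice n : measurable_fun setT (fun x : R => spread phi (n, x)).
  rewrite /spread /=; case: (pickle_inv n) => [e|]; last exact: measurable_cst.
  by have /square_integrable_sqi[] := sphi e; first exact: edge_interior_measurable.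
have ms : measurable_fun setT (spread phi) by exact: bundle_measurable_fun.
have ms2 : measurable_fun setT (fun z => spread phi z ^+ 2) by exact: measurable_funX.
split => //; apply/integrableP; split; first exact/measurable_EFinP.
under eq_integral do rewrite gee0_abs ?lee_fin ?sqr_ge0//.
rewrite bundle_integral//; last first.
- by move=> z /(@spread_out phi) ->; rewrite expr0n.
- by move=> z; exact: sqr_ge0.
apply: le_lt_trans Lphi; rewrite le_eqVlt; apply/orP; left; apply/eqP.
apply: eq_esum => e _.
rewrite (Lpow_sqi (edge_interior_measurable e) (sphi e)) -ipE; last first.
  by apply/square_integrable_sqi => //; exact: edge_interior_measurable.
by apply: eq_integral => x _; rewrite spreadE.
Qed.

Lemma sqi_slice F n : sqi bmu F -> (forall z, ~ bundle_supp z -> F z = 0) ->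
  sqi mu (fun x => F (n, x)) /\ ip mu (fun x => F (n, x)) (fun x => F (n, x)) <= ip bmu F F.
Proof.
move=> [mF iF] FS.
have mn : measurable_fun setT (fun x : R => F (n, x)) by exact: slice_measurable_fun.
have mn2 : measurable_fun setT (fun x : R => (F (n, x) ^+ 2)%:E).
  by apply/measurable_EFinP; exact: measurable_funX.
have le : (\int[mu]_x (F (n, x) ^+ 2)%:E <= \int[bmu]_z (F z ^+ 2)%:E)%E.
  have [[e ->]|ne] := pselect (exists e : edge G, n = pickle e).
    rewrite bundle_integral//; [|exact: measurable_funX|by move=> z; exact: sqr_ge0|].
      apply: esum_ge; exists [set e]; first by split => //; exact: finite_set1.
      by rewrite fsbig_set1.
    by move=> z /FS ->; rewrite expr0n.
  have F0n x : F (n, x) = 0 by apply: FS => -[e /= E _]; apply: ne; exists e.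
  have -> : (\int[mu]_x (F (n, x) ^+ 2)%:E = 0)%E.
    by under eq_integral do rewrite F0n expr0n; rewrite integral0.
  by apply: integral_ge0 => z _; rewrite lee_fin sqr_ge0.
have sn : sqi mu (fun x => F (n, x)).
  split => //; apply/integrableP; split => //.
  under eq_integral do rewrite gee0_abs ?lee_fin ?sqr_ge0//.
  by apply: le_lt_trans le _; exact: integrable_lty.
by split => //; rewrite -lee_fin -!ipE.
Qed.

Lemma ip_bundle F : sqi bmu F -> (forall z, ~ bundle_supp z -> F z = 0) ->
  (ip bmu F F)%:E = (\esum_(e in [set: edge G])
     (ip mu (fun x => F (pickle e, x)) (fun x => F (pickle e, x)))%:E)%E.
Proof.
move=> sF FS; rewrite -ipE// bundle_integral//.
- by apply: eq_esum => e _; rewrite ipE//; have [] := sqi_slice (pickle e) sF FS.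
- by have [mF _] := sF; exact: measurable_funX.
- by move=> z; exact: sqr_ge0.
- by move=> z /FS ->; rewrite expr0n.
Qed.

End EdgeBundle.

(** * Functions on the graph, their gradients and norms over the bundle *)

Section GraphFunctions.
Variables (R : realType) (G : metric_graph R).
Hypothesis hG : class_G G.
Local Notation mu := (@lebesgue_measure R).
Local Notation bmu := (@bmu R).
Implicit Types (u v : graph_point G -> R) (e : edge G) (x y : R).

Lemma edge_length_gt0 e : (0 < edge_length e)%E.
Proof.
by have [_ _ h _] := hG; apply: lt_le_trans h _; apply: ereal_inf_lbound; exists e.
Qed.

Lemma edge_length_inf : exists2 l : R, 0 < l & forall e, (l%:E <= edge_length e)%E.
Proof.
have [_ _ h _] := hG.
have lb e : (ereal_inf (range (@edge_length R G)) <= edge_length e)%E.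
  by apply: ereal_inf_lbound; exists e.
move: h lb; case: (ereal_inf _) => [l| |//] h lb.
  by exists l.
by exists 1 => // e; apply: le_trans (lb e); rewrite leey.
Qed.

Lemma on_edge_le0 u e x : x <= 0 -> on_edge u e x = on_edge u e 0.
Proof. by move=> x0; rewrite /on_edge /edge_coord x0 lexx. Qed.

Lemma on_edge_ge u e x r : edge_length e = r%:E -> r <= x -> on_edge u e x = on_edge u e r.
Proof.
move=> er rx; have := edge_length_gt0 e; rewrite er lte_fin => r0.
by rewrite /on_edge /edge_coord er !lee_fin !leNgt r0 (lt_le_trans r0 rx) -!leNgt rx lexx.
Qed.

Lemma on_edge_lin (a : R) u v e x :
  on_edge (fun q => a * u q + v q) e x = a * on_edge u e x + on_edge v e x.
Proof. by rewrite /on_edge; case: insub => [q//|]; rewrite mulr0 addr0. Qed.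

Lemma on_edge_map (f : R -> R) u e x : f 0 = 0 ->
  on_edge (fun q => f (u q)) e x = f (on_edge u e x).
Proof. by rewrite /on_edge; case: insub. Qed.

Lemma on_edgeP e x : exists q, forall u, on_edge u e x = u q.
Proof.
have ip := edge_coordP e x hG.
by exists (Sub _ ip) => u; rewrite /on_edge insubT.
Qed.

(** The point to settle is an isolated vertex: connectedness joins each vertex to an end of [e0], so
    it is incident to some edge. *)
Lemma graph_point_on_edge (e0 : edge G) (q : graph_point G) :
  exists e x, forall u, on_edge u e x = u q.
Proof.
case: q => -[v|[e x]] ip; last first.
  exists e, x => u; have /andP[x0 xl] := ip.
  have E : edge_coord e x = inr (e, x).
    by rewrite /edge_coord leNgt x0 /= leNgt xl.
  rewrite /on_edge insubT ?E// => ip'; congr u; exact/val_inj.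
have [e ev] : exists e, origin e = v \/ terminus e = v.
  have [conn _ _ _] := hG.
  have P a b : Relation_Operators.clos_refl_sym_trans (vertex G) (@Defs.adjacent R G) a b ->
     (a = b) \/ ((exists e, origin e = a \/ terminus e = a) /\ (exists e, origin e = b \/ terminus e = b)).
    elim=> {a b} [a b [e [<- <-]]|a|a b _ [->|[]]|a b c _ IH1 _ IH2].
    - by right; split; exists e; [left|right].
    - by left.
    - by left.
    - by right.
    - by case: IH1 => [->//|[A1 A2]]; case: IH2 => [<-|[B1 B2]]; right.
  have [->|[]//] := P _ _ (conn v (origin e0)).
  by exists e0; left.
have vE y : edge_coord e y = inl v -> forall u, on_edge u e y = u (exist _ (inl v) ip).
  by move=> E u; rewrite /on_edge insubT ?E// => ip'; congr u; exact/val_inj.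
case: ev => ev.
  by exists e, 0; apply: vE; rewrite /edge_coord lexx ev.
have : edge_length e != +oo%E.
  apply/negP => /eqP eoo; have := ip; rewrite /= => /negP; apply.
  by rewrite inE; exists e.
have := edge_length_gt0 e; case El : (edge_length e) => [r| |]// r0 _.
rewrite lte_fin in r0.
by exists e, r; apply: vE; rewrite /edge_coord El leNgt r0 /= lexx ev.
Qed.

Lemma on_edge_continuous u e : graph_continuous u -> continuous (on_edge u e).
Proof.
move=> /(_ e)/subspace_continuousP cu.
(* [c] is the 1-Lipschitz retraction of the line onto the closed edge, and [on_edge] factors through
   it. *)
have [c [cE cD cL]] : exists c : R -> R, [/\ forall x, on_edge u e x = on_edge u e (c x),
    forall x, edge_closure e (c x) & forall x y, `|c x - c y| <= `|x - y|].
  have := edge_length_gt0 e; case El : (edge_length e) => [r| |//].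
    rewrite lte_fin => r0; exists (fun x => Num.max 0 (Num.min x r)); split.
    - move=> x; have [xr|rx] := leP x r.
        by have [x0|/ltW x0] := leP 0 x => //; exact: on_edge_le0.
      by rewrite (on_edge_ge _ El (ltW rx)) max_r ?ltW.
    - move=> x; rewrite /edge_closure /= El lee_fin le_max lexx/= ge_max ge_min lexx orbT andbT.
      exact: ltW.
    - move=> x y; rewrite ler_norml.
      have h1 := ler_norm (x - y); have := ler_norm (y - x); rewrite distrC => h2.
      have [xr|rx] := leP x r; have [yr|ry] := leP y r;
        repeat (case: (leP 0 _) => ?); apply/andP; split; lra.
  move=> _; exists (fun x => Num.max 0 x); split.
  - by move=> x; have [x0|/ltW x0] := leP 0 x => //; exact: on_edge_le0.
  - by move=> x; rewrite /edge_closure /= El leey le_max lexx.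
  - move=> x y; rewrite ler_norml.
    have h1 := ler_norm (x - y); have := ler_norm (y - x); rewrite distrC => h2.
    repeat (case: (leP 0 _) => ?); apply/andP; split; lra.
move=> x; rewrite /continuous_at; apply/cvgrPdist_lt => eps eps0.
have /cvgrPdist_lt /(_ _ eps0) [d /= d0 hd] := cu _ (cD x).
exists d => // y /= xy; rewrite cE (cE y); apply: hd => //=.
exact: le_lt_trans xy.
Qed.

Definition bval u : bundle R -> R := spread (on_edge u).
Definition gder u : bundle R -> R := spread (graph_derivative u).

(** A relation instead of a function: [graph_derivative] comes from a choice by [xget], so gradients
    of sums, limits and positive parts can only be identified up to null sets. *)
Definition weak_grad u (g : bundle R -> R) : Prop :=
  [/\ sqi bmu g, forall z, ~ bundle_supp G z -> g z = 0 &
      forall e, primitive (on_edge u e) (fun x => g (pickle e, x))].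

Lemma H1_weak_grad u : H1 u -> sqi bmu (bval u) /\ weak_grad u (gder u).
Proof.
move=> [cu Hu Lu Ldu].
have wd e : L2_weak_derivatives (edge_interior e) (on_edge u e) (graph_derivative u e).
  by have [_ ex] := Hu e; rewrite /graph_derivative /weak_derivative; case: xgetP => // h0; have [g /h0] := ex.
split; first by apply: sqi_spread => // e; have [] := Hu e.
split.
- by apply: sqi_spread => // e; have [] := wd e.
- exact: spread_out.
- move=> e; have [sg wg] := wd e.
  rewrite /gder spread_slice.
  exact: (weak_primitive (edge_length_gt0 e) (on_edge_continuous cu)
    (@on_edge_le0 u e) (@on_edge_ge u e) sg wg).
Qed.

Lemma weak_grad_primitive_sqi u g e : weak_grad u g ->
  sqi mu (fun x => g (pickle e, x)) /\ primitive (on_edge u e) (fun x => g (pickle e, x)).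
Proof. by move=> [sg gS pg]; split => //; have [] := sqi_slice (pickle e) sg gS. Qed.

(** Together with [H1_weak_grad] this characterizes [H1] by primitives along the edges; stability of
    [H1] under an operation is then proved by exhibiting a weak gradient. *)
Lemma weak_grad_H1 u g : sqi bmu (bval u) -> weak_grad u g -> H1 u.
Proof.
move=> sv wg; have [sg gS pg] := wg.
have cu e : continuous (on_edge u e).
  by have [sge pge] := weak_grad_primitive_sqi e wg; exact: primitive_continuous sge pge.
have geE e x : g (pickle e, x) * \1_(edge_interior e) x = g (pickle e, x).
  rewrite indicE; case: (boolP (x \in _)) => [|/negP ex]; first by rewrite mulr1.
  rewrite mulr0 gS// => -[e' /= /(pcan_inj pickleK_inv) ee' ex']; apply: ex.
  by rewrite ee' inE.
have mD := edge_interior_measurable (G := G).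
have gW e : L2_weak_derivatives (edge_interior e) (on_edge u e) (fun x => g (pickle e, x)).
  have [sge pge] := weak_grad_primitive_sqi e wg; split.
    by apply/square_integrable_sqi => //; under eq_fun do rewrite geE.
  by apply: (primitive_weak sge pge) => x ex; rewrite -geE indicE memNset ?mulr0.
have sf e : square_integrable (edge_interior e) (on_edge u e).
  apply/square_integrable_sqi => //.
  have [] := sqi_slice (pickle e) sv (@spread_out _ _ _).
  by rewrite /bval spread_slice.
have Hu e : H1_interval (edge_interior e) (on_edge u e).
  by split; [exact: sf|exists (fun x => g (pickle e, x))].
have Lu : (Lpow 2 (on_edge u) < +oo)%E.
  have -> : Lpow 2 (on_edge u) = (ip bmu (bval u) (bval u))%:E.
    rewrite (@ip_bundle _ G)//; last exact: spread_out.
    apply: eq_esum => e _; rewrite Lpow_sqi//.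
    by rewrite /bval spread_slice.
  exact: ltry.
split; [by move=> e; apply: continuous_subspaceT; exact: cu|exact: Hu|exact: Lu|].
have wd e : L2_weak_derivatives (edge_interior e) (on_edge u e) (graph_derivative u e).
  by rewrite /graph_derivative /weak_derivative; case: xgetP => // h0; have /h0 := gW e.
have -> : Lpow 2 (graph_derivative u) = (ip bmu g g)%:E.
  rewrite (@ip_bundle _ G)//; apply: eq_esum => e _; have [sd wde] := wd e.
  rewrite Lpow_sqi//; congr EFin.
  have [sge pge] := weak_grad_primitive_sqi e wg.
  have pd := weak_primitive (edge_length_gt0 e) (cu e) (@on_edge_le0 u e) (@on_edge_ge u e) sd wde.
  have sd' : sqi mu (fun x => graph_derivative u e x * \1_(edge_interior e) x).
    by apply/square_integrable_sqi.
  have [mge _] := sge.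
  have [_ ->//] := sqi_ae sd' mge (primitive_unique (sqi_linteg sd') (sqi_linteg sge) pd pge).
exact: ltry.
Qed.

Lemma weak_grad_lin (a : R) u v g h : weak_grad u g -> weak_grad v h ->
  weak_grad (fun q => a * u q + v q) (fun z => a * g z + h z).
Proof.
move=> wu wv; have [sg gS pg] := wu; have [sh hS ph] := wv; split.
- exact: sqi_lin.
- by move=> z zS; rewrite gS// hS// mulr0 addr0.
- move=> e x y xy; have [sge _] := weak_grad_primitive_sqi e wu.
  have [she _] := weak_grad_primitive_sqi e wv.
  rewrite itvint_lin; [|exact: sqi_linteg..].
  by rewrite -pg// -ph// !on_edge_lin; ring.
Qed.

Lemma bval_lin (a : R) u v z :
  bval (fun q => a * u q + v q) z = a * bval u z + bval v z.
Proof.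
rewrite /bval /spread; case: (pickle_inv _) => [e|]; last by rewrite mulr0 addr0.
by rewrite on_edge_lin; ring.
Qed.

(** On each edge the difference of the gradients is 0 almost everywhere by [primitive_unique], so
    its norm over the bundle is 0, and Cauchy-Schwarz removes it from the product with [h]. *)
Lemma weak_grad_unique u g1 g2 h : weak_grad u g1 -> weak_grad u g2 -> sqi bmu h ->
  ip bmu g1 h = ip bmu g2 h.
Proof.
move=> w1 w2 sh; have [s1 S1 p1] := w1; have [s2 S2 p2] := w2.
pose d z := -1 * g2 z + g1 z.
have sd : sqi bmu d by exact: sqi_lin.
have d0 : ip bmu d d = 0.
  apply: EFin_inj; rewrite (@ip_bundle _ G)//; last by move=> z zS; rewrite /d S1// S2// mulr0 addr0.
  apply: esum1 => e _; congr EFin.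
  have [s1e p1e] := weak_grad_primitive_sqi e w1; have [s2e p2e] := weak_grad_primitive_sqi e w2.
  have ae := primitive_unique (sqi_linteg s1e) (sqi_linteg s2e) p1e p2e.
  have s0 : sqi mu (fun x => 0 * g1 (pickle e, x)) by exact: sqiZ.
  have sde : sqi mu (fun x => d (pickle e, x)) by exact: sqi_lin.
  have [mde _] := sde.
  have [|_ ->] := @sqi_ae _ _ _ mu (fun x => 0 * g1 (pickle e, x)) (fun x => d (pickle e, x)) s0 mde.
    move: ae; apply: filterS; first exact: (ae_filter_ringOfSetsType mu).
    by move=> x; rewrite /d => ->; rewrite mulN1r mul0r addNr.
  rewrite /ip; under eq_Rintegral do rewrite !mul0r.
  by rewrite Rintegral_cst// mul0r.
have := ip_sqr_le sd sh; rewrite d0 mul0r => dh.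
have /eqP : ip bmu d h = 0 by apply/eqP; rewrite -sqrf_eq0 eq_le dh sqr_ge0.
by rewrite ip_lin// mulN1r addrC subr_eq0 => /eqP.
Qed.

Lemma Lpow_fineK q (phi : edge G -> R -> R) : (Lpow q phi < +oo)%E ->
  (fine (Lpow q phi))%:E = Lpow q phi.
Proof.
move=> Lfin; have L0 : (0 <= Lpow q phi)%E.
  by apply: esum_ge0 => e _; apply: integral_ge0 => x _; rewrite lee_fin powR_ge0.
by move: L0 Lfin; move: (Lpow q phi) => [r| |].
Qed.

Lemma normL2sqE u : H1 u -> normL2sq u = ip bmu (bval u) (bval u).
Proof.
move=> Hu; have [sv _] := H1_weak_grad Hu; have [_ Hue _ _] := Hu.
apply: EFin_inj; rewrite (@ip_bundle _ G)//; last exact: spread_out.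
have -> : (normL2sq u)%:E = Lpow 2 (on_edge u) by apply: Lpow_fineK; have [] := Hu.
apply: eq_esum => e _; rewrite Lpow_sqi//; [|exact: edge_interior_measurable|by have [] := Hue e].
by rewrite /bval spread_slice.
Qed.

Lemma normL2sq_derivE u : H1 u -> normL2sq_deriv u = ip bmu (gder u) (gder u).
Proof.
move=> Hu; have [_ [sg gS _]] := H1_weak_grad Hu; have [_ Hue _ _] := Hu.
apply: EFin_inj; rewrite (@ip_bundle _ G)//.
have -> : (normL2sq_deriv u)%:E = Lpow 2 (graph_derivative u).
  by apply: Lpow_fineK; have [] := Hu.
apply: eq_esum => e _; rewrite Lpow_sqi//; last 2 first.
- exact: edge_interior_measurable.
- apply/square_integrable_sqi; first exact: edge_interior_measurable.
  have [] := sqi_slice (pickle e) sg gS.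
  by rewrite /gder spread_slice.
by rewrite /gder spread_slice.
Qed.

Lemma normLp_powE p M u : 2 < p -> H1 u -> (forall q, `|u q| <= M) ->
  normLp_pow p u = powint bmu p (bval u).
Proof.
move=> p2 Hu uM; have [sv _] := H1_weak_grad Hu; have [mv _] := sv.
have p0 : p != 0 by rewrite gt_eqF//; lra.
rewrite /normLp_pow /powint /Rintegral; congr fine.
rewrite (@bundle_integral _ G).
- apply: eq_esum => e _; rewrite integral_mkcond; apply: eq_integral => x _.
  rewrite patchE /bval spreadE indicE; case: ifPn => _; first by rewrite mulr1.
  by rewrite mulr0 normr0 powR0.
- by apply: (measurableT_comp (measurable_powR _)); exact: measurableT_comp.
- by move=> z; exact: powR_ge0.
- by move=> z zS; rewrite /bval spread_out// normr0 powR0.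
Qed.

End GraphFunctions.

(** * Diagonal extraction *)

Section Diagonal.
Variable R : realType.

(** Tychonoff gives a cluster point in a product of segments; phi k is an index beyond k that is
    close to it in the first k coordinates. The map phi need not be increasing: n <= phi n is enough
    for limits. *)
Lemma diagonal_cvg (a : nat -> nat -> R) (M : R) : (forall n i, `|a n i| <= M) ->
  exists phi : nat -> nat, (forall n, (n <= phi n)%N) /\ forall i, cvgn (fun n => a (phi n) i).
Proof.
move=> aM; pose T := prod_topology (fun _ : nat => R : topologicalType).
pose A (i : nat) : set R := `[- M, M]%classic.
have cK : @compact T [set f | forall i, A i (f i)].
  exact: (@tychonoff nat (fun _ => R) A (fun i => @segment_compact R (- M) M)).
have FA : (a @ \oo) [set f : T | forall i, A i (f i)].
  by exists 0%N => // n _ i; rewrite /A /= in_itv/= -ler_norml.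
have [l [_ cl]] := cK (a @ \oo) _ FA.
have nb k (eps : R) : 0 < eps ->
    nbhs (l : T) [set f : T | forall i, (i < k)%N -> `|l i - f i| < eps].
  move=> eps0; elim: k => [|k IH]; first by apply: filterS filterT => f _ i.
  have nk : nbhs (l : T) [set f : T | `|l k - f k| < eps].
    have nlk : nbhs (l k : R) [set r : R | `|l k - r| < eps].
      by apply/nbhs_ballP; exists eps.
    exact: (@proj_continuous nat (fun _ => R : topologicalType) k l _ nlk).
  apply: filterS (filterI IH nk) => f [/= h1 h2] i.
  by rewrite ltnS leq_eqVlt => /predU1P[->//|]; exact: h1.
have /choice[phi hphi] k : exists n, (k <= n)%N /\ forall i, (i < k)%N -> `|l i - a n i| < k.+1%:R^-1.
  have k0 : 0 < k.+1%:R^-1 :> R by rewrite invr_gt0.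
  have Fk : (a @ \oo) (a @` [set n | (k <= n)%N]) by exists k => // n /= kn; exists n.
  by have [f [[n /= kn <-] h]] := cl _ _ Fk (nb k _ k0); exists n.
exists phi; split => [n|i]; first by have [] := hphi n.
apply/cvg_ex; exists (l i); apply/cvgrPdist_lt => eps eps0.
have := @cvg_harmonic R; move=> /cvgrPdist_lt /(_ eps eps0) [N _ hN].
exists (maxn N i.+1) => // n /=; rewrite geq_max => /andP[Nn ni].
have [_ h] := hphi n; apply: lt_trans (h i ni) _.
by have := hN n Nn; rewrite /= sub0r normrN; apply: le_lt_trans; exact: ler_norm.
Qed.

End Diagonal.

(** * H^1 of the graph: pointwise bounds, positive parts, completeness, compactness *)

Section GraphSpace.
Variables (R : realType) (G : metric_graph R).
Hypothesis hG : class_G G.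
Variable e0 : edge G.
Local Notation mu := (@lebesgue_measure R).
Local Notation bmu := (@bmu R).
Implicit Types (u v w : graph_point G -> R) (e : edge G) (x y : R) (q : graph_point G).

Definition dform u v : R := ip bmu (gder u) (gder v).
Definition lform u v : R := ip bmu (bval u) (bval v).
Definition h1sq u : R := dform u u + lform u u.

Lemma H1_lin (a : R) u v : H1 u -> H1 v -> H1 (fun q => a * u q + v q).
Proof.
move=> Hu Hv; have [su wu] := H1_weak_grad hG Hu; have [sv wv] := H1_weak_grad hG Hv.
apply: (weak_grad_H1 hG _ (weak_grad_lin a wu wv)).
rewrite (_ : bval _ = fun z => a * bval u z + bval v z); first exact: sqi_lin.
by apply/funext => z; exact: bval_lin.
Qed.

Lemma sqi_gder u : H1 u -> sqi bmu (gder u).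
Proof. by move=> /(H1_weak_grad hG)[_ []]. Qed.

Lemma sqi_bval u : H1 u -> sqi bmu (bval u).
Proof. by move=> /(H1_weak_grad hG)[]. Qed.

Lemma dform_eq u g h : H1 u -> weak_grad u g -> sqi bmu h -> ip bmu (gder u) h = ip bmu g h.
Proof.
by move=> Hu wg sh; apply: weak_grad_unique wg sh; have [] := H1_weak_grad hG Hu.
Qed.

Lemma dform_eq2 u g : H1 u -> weak_grad u g -> dform u u = ip bmu g g.
Proof.
move=> Hu wg; have [sg _ _] := wg; by rewrite /dform (dform_eq Hu wg (sqi_gder Hu)) ipC (dform_eq Hu wg sg).
Qed.

Lemma dform_lin (a : R) u v w : H1 u -> H1 v -> H1 w ->
  dform (fun q => a * u q + v q) w = a * dform u w + dform v w.
Proof.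
move=> Hu Hv Hw; have [_ wu] := H1_weak_grad hG Hu; have [_ wv] := H1_weak_grad hG Hv.
rewrite /dform (dform_eq (H1_lin a Hu Hv) (weak_grad_lin a wu wv) (sqi_gder Hw)).
by rewrite ip_lin//; exact: sqi_gder.
Qed.

Lemma lform_lin (a : R) u v w : H1 u -> H1 v -> H1 w ->
  lform (fun q => a * u q + v q) w = a * lform u w + lform v w.
Proof.
move=> Hu Hv Hw; rewrite /lform.
have -> : bval (fun q => a * u q + v q) = (fun z => a * bval u z + bval v z).
  by apply/funext => z; exact: bval_lin.
by rewrite ip_lin//; exact: sqi_bval.
Qed.

(** Which case holds, and the point q, do not depend on u; so pointwise operations, inequalities and
    limits pass through [bval] at once. *)
Lemma bvalP (z : bundle R) : (forall u, bval u z = 0) \/ exists q, forall u, bval u z = u q.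
Proof.
rewrite /bval /spread; case: (pickle_inv _) => [e|]; last by left.
rewrite indicE; case: (_ \in _); last by left=> u; rewrite mulr0.
by right; have [q hq] := on_edgeP hG e z.2; exists q => u; rewrite mulr1 hq.
Qed.

Lemma bval_bounded u M : 0 <= M -> (forall q, `|u q| <= M) -> forall z, `|bval u z| <= M.
Proof.
move=> M0 uM z; have [h|[q h]] := bvalP z; rewrite h//.
by rewrite normr0.
Qed.

Lemma bval_cvg (f : nat -> graph_point G -> R) u : (forall q, f ^~ q @ \oo --> u q) ->
  forall z, (fun n => bval (f n) z) @ \oo --> bval u z.
Proof.
move=> fu z; have [h|[q h]] := bvalP z; rewrite h; under eq_fun do rewrite h//.
- exact: cvg_cst.
- exact: fu.
Qed.

(** Integrate f(x1)^2 <= 2 f(t)^2 + 2 (f(x1) - f(t))^2 over t in a stretch of length h / 2 near x1,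
    the last square being at most h times [dform u u]. The scale h stays free: it is fixed in
    [sup_norm_bound] and tends to 0 in [lform_eq0]. *)
Lemma sup_bound : exists2 h0 : R, 0 < h0 & forall h u q, 0 < h <= h0 -> H1 u ->
  u q ^+ 2 <= 4 / h * lform u u + 2 * h * dform u u.
Proof.
have [l l0 hl] := edge_length_inf hG.
exists (l / 2); first by rewrite divr_gt0.
move=> h u q /andP[h0 hle] Hu.
have [su wu] := H1_weak_grad hG Hu.
have [e [x xq]] := graph_point_on_edge hG e0 q; rewrite -xq.
have [sge pge] := weak_grad_primitive_sqi e wu.
have [_ Hue _ _] := Hu.
have [sfe sfle] := sqi_slice (pickle e) su (@spread_out _ _ _).
set f := on_edge u e in pge *.
have fE : (fun x => bval u (pickle e, x)) = (fun x => f x * \1_(edge_interior e) x).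
  by rewrite /bval spread_slice.
have dle : ip mu (fun x => gder u (pickle e, x)) (fun x => gder u (pickle e, x)) <= dform u u.
  have [sg gS _] := wu.
  by have [] := sqi_slice (pickle e) sg gS.
(* As h is at most half of the least edge length, there is room for [a, a + h] inside the edge on
   one side of x or the other; x1 is x moved back to the edge when it lies outside. *)
have [x1 [a [-> /andP[ax xa] aD]]] : exists x1 a, [/\ f x = f x1, a <= x1 <= a + h &
    forall t, a < t < a + h -> edge_interior e t].
  have le := hl e.
  have [x0|x0] := leP x 0.
    exists 0, 0; split; first exact: on_edge_le0.
      by rewrite lexx add0r ltW.
    move=> t /andP[t0 th]; rewrite /edge_interior /= t0 (lt_le_trans _ le)// lte_fin.
    by lra.
  have [xh|xh] := leP (x + h)%:E (edge_length e).
    exists x, x; split=> //; first by rewrite lexx lerDl ltW.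
    move=> t /andP[t0 th]; rewrite /edge_interior /= (lt_trans x0 t0) (lt_le_trans _ xh)//.
  have [r er] : exists r : R, edge_length e = r%:E.
    by move: le xh; case: (edge_length e) => [r _ _| |]//; exists r.
  rewrite er lte_fin in xh; rewrite er lee_fin in le.
  have [xr|rx] := leP x r.
    exists x, (x - h); split=> //; first by rewrite subrK lexx gerBl ltW.
    move=> t /andP[t0 th]; rewrite /edge_interior /= er lte_fin.
    by apply/andP; split; lra.
  exists r, (r - h); split; first by apply: (on_edge_ge hG) => //; exact: ltW.
    by rewrite subrK lexx gerBl ltW.
  move=> t /andP[t0 th]; rewrite /edge_interior /= er lte_fin.
  by apply/andP; split; lra.
(* The middle half of [a, a + h] stays in the open edge, where [bval] agrees with f; its length h /
   2 yields the constants 4 / h and 2 h. *)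
pose b := a + h / 4; pose c := a + 3 * h / 4.
have bc : b <= c by rewrite /b /c; lra.
have cb : c - b = h / 2 by rewrite /b /c; lra.
have lf2 : linteg (fun t => bval u (pickle e, t) ^+ 2) by exact: linteg_sqr.
have key : f x1 ^+ 2 * (h / 2) <= 2 * lform u u + h * h * dform u u.
  rewrite -cb -(itvint_cst _ bc).
  apply: (@le_trans _ _ (itvint (fun t => 2 * bval u (pickle e, t) ^+ 2 + 2 * h * dform u u) b c)).
    apply: le_itvint; [exact: linteg_cst|apply: linteg_lin => //; exact: linteg_cst|].
    move=> t /andP[bt tc].
    have Dt : edge_interior e t by apply: aD; rewrite /b /c in bt tc; apply/andP; split; lra.
    have -> : bval u (pickle e, t) = f t.
      by rewrite /bval spreadE indicE mem_set ?mulr1.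
    have ht : (f x1 - f t) ^+ 2 <= h * dform u u.
      apply: le_trans (primitive_hoelder _ _ sge pge) _.
      apply: ler_pM => //; first exact: ip_ge0.
      by rewrite ler_norml /b /c in bt tc *; apply/andP; split; lra.
    have := sqr_ge0 (f t - (f x1 - f t)); nra.
  rewrite itvint_lin ?itvint_cst//; last exact: linteg_cst.
  apply: lerD.
    rewrite ler_wpM2l//; apply: le_trans (itvint_sqr_le_ip _ _ sfe) _.
    exact: sfle.
  by rewrite cb le_eqVlt; apply/orP; left; apply/eqP; field.
rewrite -(ler_pM2r (_ : 0 < h / 2)) ?divr_gt0//; apply: le_trans key _.
by rewrite le_eqVlt; apply/orP; left; apply/eqP; field; rewrite gt_eqF.
Qed.

Lemma sup_norm_bound : exists2 C : R, 0 < C & forall u q, H1 u -> u q ^+ 2 <= C * h1sq u.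
Proof.
have [h0 h00 hb] := sup_bound.
exists (4 / h0 + 2 * h0); first by rewrite addr_gt0 ?mulr_gt0 ?invr_gt0.
move=> u q Hu; apply: le_trans (hb h0 u q _ Hu) _; first by rewrite h00 lexx.
have := ip_ge0 bmu (gder u); have := ip_ge0 bmu (bval u).
have i0 : 0 < h0^-1 by rewrite invr_gt0.
rewrite /h1sq /dform /lform; move: (ip _ _ _) (ip _ _ _) => a b a0 b0; nra.
Qed.

(** [lform] sees u only almost everywhere on open edges, yet u must vanish at every point, vertices
    included: let h tend to 0 in [sup_bound]. *)
Lemma lform_eq0 u : H1 u -> lform u u = 0 -> u = cst 0.
Proof.
move=> Hu L0; have [h0 h00 hb] := sup_bound; apply/funext => q /=.
have D0 : 0 <= dform u u by exact: ip_ge0.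
have key h : 0 < h <= h0 -> u q ^+ 2 <= 2 * h * dform u u.
  by move=> hh; have := hb h u q hh Hu; rewrite L0 mulr0 add0r.
apply/eqP; rewrite -sqrf_eq0 eq_le sqr_ge0 andbT; apply/ler_addgt0Pl => e e00; rewrite addr0.
pose h := Num.min h0 (e / (2 * (dform u u + 1))).
have D1 : 0 < dform u u + 1 by rewrite ltr_wpDl.
have hp : 0 < h by rewrite lt_min h00 divr_gt0// mulr_gt0.
apply: le_trans (key h _) _; first by rewrite hp ge_min lexx.
have : h <= e / (2 * (dform u u + 1)) by rewrite ge_min lexx orbT.
rewrite ler_pdivlMr ?mulr_gt0// => hle; apply: le_trans hle.
by nra.
Qed.

Lemma pos_weak_grad u g : sqi bmu (bval u) -> weak_grad u g ->
  weak_grad (fun q => Num.max (u q) 0) (fun z => g z * \1_[set z | 0 < bval u z] z).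
Proof.
move=> su wg; have [sg gS pg] := wg; have [mu' _] := su; have [mg ig] := sg.
have mpos : measurable [set z | 0 < bval u z].
  rewrite (_ : [set z | _] = setT `&` bval u @^-1` `]0, +oo[); first exact: mu'.
  by rewrite setTI; apply/seteqP; split => z /=; rewrite in_itv/= andbT.
split.
- have mg' : measurable_fun setT (fun z => g z * \1_[set z | 0 < bval u z] z).
    by apply: measurable_funM => //; exact: measurable_indic.
  split => //; apply: integrableT_bounded ig _; first exact: measurable_funX.
  move=> z; rewrite ger0_norm ?sqr_ge0// indicE.
  by case: (_ \in _); rewrite ?mulr1// mulr0 expr0n sqr_ge0.
- by move=> z zS; rewrite gS// mul0r.
- move=> e; have [sge pge] := weak_grad_primitive_sqi e wg.
  have := primitive_pos sge pge.
  rewrite (_ : (fun x => g (pickle e, x) * \1_[set z | 0 < bval u z] (pickle e, x)) =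
    (fun x => g (pickle e, x) * \1_[set t | 0 < on_edge u e t] x)).
    by move=> h x y xy; rewrite -h// !(on_edge_map (f := fun s : R => Num.max s 0))// maxxx.
  apply/funext => x; have [ex|ex] := pselect (edge_interior e x).
    congr (_ * _); rewrite !indicE; congr (nat_of_bool _)%:R.
    by apply/idP/idP; rewrite !inE /bval /= spreadE indicE mem_set// mulr1.
  rewrite gS ?mul0r// => -[e' /= /(pcan_inj pickleK_inv) ee' ex']; apply: ex.
  by rewrite ee'.
Qed.

Lemma bval_map (f : R -> R) u z : f 0 = 0 -> bval (fun q => f (u q)) z = f (bval u z).
Proof. by move=> f0; have [h|[q h]] := bvalP z; rewrite !h. Qed.

Lemma sqi_bval_le u v : H1 u -> measurable_fun setT (bval v) ->
  (forall q, `|v q| <= `|u q|) -> sqi bmu (bval v).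
Proof.
move=> Hu mv vu; have [_ iu] := sqi_bval Hu; split => //.
apply: integrableT_bounded iu _; first exact: measurable_funX.
move=> z; rewrite ger0_norm ?sqr_ge0// -(real_normK (num_real (bval v z))).
rewrite -(real_normK (num_real (bval u z))) ler_pXn2r ?nnegrE//.
by have [h|[q h]] := bvalP z; rewrite !h.
Qed.

Local Notation posp u := (fun q => Num.max (u q) 0).
Local Notation negp u := (fun q => Num.min (u q) 0).

Lemma H1_pos_neg u : H1 u -> exists g1 g2,
  [/\ sqi bmu (bval (posp u)) /\ sqi bmu (bval (negp u)),
      weak_grad (posp u) g1, weak_grad (negp u) g2 & forall z, g1 z * g2 z = 0].
Proof.
move=> Hu; have [su wu] := H1_weak_grad hG Hu; have [mbu _] := su.
have sp : sqi bmu (bval (posp u)).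
  apply: sqi_bval_le Hu _ _ => [|q].
    rewrite (_ : bval _ = fun z => Num.max (bval u z) 0); first exact: measurable_maxr.
    by apply/funext => z; rewrite (bval_map (f := fun s : R => Num.max s 0))// maxxx.
  by case: (leP (u q) 0) => h; rewrite ?normr0 ?normr_ge0 ?lexx.
have sn : sqi bmu (bval (negp u)).
  apply: sqi_bval_le Hu _ _ => [|q].
    rewrite (_ : bval _ = fun z => Num.min (bval u z) 0); first exact: measurable_minr.
    by apply/funext => z; rewrite (bval_map (f := fun s : R => Num.min s 0))// minxx.
  by case: (leP (u q) 0) => h; rewrite ?normr0 ?normr_ge0 ?lexx.
pose g := gder u.
(* Negation is written -2 u + u to be an instance of [weak_grad_lin]. The negative part is then
   minus the positive part of -u, and the two gradients have disjoint supports, u > 0 and u < 0. *)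
have wz : weak_grad (fun q => -2 * u q + u q) (fun z => -2 * g z + g z) by exact: weak_grad_lin.
have suN : sqi bmu (bval (fun q => -2 * u q + u q)) by exact/sqi_bval/H1_lin.
have wp := pos_weak_grad su wu.
have wn := pos_weak_grad suN wz.
have wn2 := weak_grad_lin (-2) wn wn.
eexists _, _; split; [by split| exact: wp| |].
  have -> : negp u = (fun q => -2 * Num.max (-2 * u q + u q) 0 + Num.max (-2 * u q + u q) 0).
    apply/funext => q; have -> : -2 * u q + u q = - u q by ring.
    by case: (leP (u q) 0) => h; case: (leP (- u q) 0) => h'; lra.
  exact: wn2.
move=> z /=; rewrite !indicE.
have [h|h] := ltP 0 (bval u z); last first.
  by rewrite memNset ?mulr0 ?mul0r//= => /lt_geF; rewrite h.
have -> : (z \in [set z | 0 < bval (fun q => -2 * u q + u q) z]) = false.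
  by apply/negP; rewrite inE /= bval_lin; lra.
by rewrite /= !mulr0 addr0 mulr0.
Qed.

Lemma pos_neg_split u : H1 u -> [/\ H1 (posp u), H1 (negp u),
  dform u u = dform (posp u) (posp u) + dform (negp u) (negp u) &
  lform u u = lform (posp u) (posp u) + lform (negp u) (negp u)].
Proof.
move=> Hu; have [g1 [g2 [[sp sn] w1 w2 g12]]] := H1_pos_neg Hu.
have Hp := weak_grad_H1 hG sp w1; have Hn := weak_grad_H1 hG sn w2.
have uE : u = (fun q => 1 * Num.max (u q) 0 + Num.min (u q) 0).
  by apply/funext => q; rewrite mul1r; case: (leP (u q) 0); rewrite ?add0r ?addr0.
split => //.
  have w12 := weak_grad_lin 1 w1 w2; rewrite -uE in w12.
  have [s1 _ _] := w1; have [s2 _ _] := w2.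
  rewrite (dform_eq2 Hu w12) (dform_eq2 Hp w1) (dform_eq2 Hn w2) ipD2//.
  rewrite (_ : ip _ g1 g2 = 0) ?mulr0; first by ring.
  by rewrite /ip; under eq_Rintegral do rewrite g12; rewrite Rintegral_cst// mul0r.
rewrite {1 2}uE /lform.
rewrite (_ : bval _ = fun z => 1 * bval (posp u) z + bval (negp u) z); last first.
  by apply/funext => z; exact: bval_lin.
rewrite ipD2//.
have -> : ip bmu (bval (posp u)) (bval (negp u)) = 0.
  rewrite -[RHS](mul0r (fine (bmu setT))) -(Rintegral_cst bmu measurableT).
  apply: eq_Rintegral => z _.
  rewrite (bval_map (f := fun s : R => Num.max s 0)) ?maxxx//.
  rewrite (bval_map (f := fun s : R => Num.min s 0)) ?minxx//.
  by case: (leP (bval u z) 0); rewrite ?mul0r ?mulr0.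
by ring.
Qed.

Lemma cauchy_real_cvg (a : nat -> R) :
  (forall eps : R, 0 < eps -> exists N, forall m n, (N <= m)%N -> (N <= n)%N -> `|a m - a n| <= eps) ->
  cvgn a.
Proof.
move=> ca; apply: cauchy_cvg; apply/cauchy_exP => eps eps0.
have [N hN] := ca (eps / 2) (divr_gt0 eps0 (ltr0n _ 2)).
exists (a N); exists N => // n Nn; rewrite /ball /=.
by apply: le_lt_trans (hN _ _ (leqnn N) Nn) _; lra.
Qed.

Lemma H1B u v : H1 u -> H1 v -> H1 (fun q => u q - v q).
Proof.
move=> Hu Hv; have := H1_lin (-1) Hv Hu.
by under eq_fun do rewrite mulN1r addrC.
Qed.

Lemma bvalB u v z : bval (fun q => u q - v q) z = bval u z - bval v z.
Proof. by have [h|[q h]] := bvalP z; rewrite !h ?subr0. Qed.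

Lemma weak_gradB u v g h : weak_grad u g -> weak_grad v h ->
  weak_grad (fun q => u q - v q) (fun z => g z - h z).
Proof.
move=> wu wv; have W := weak_grad_lin (-1) wv wu.
have E1 : (fun q => -1 * v q + u q) = (fun q => u q - v q) by apply: funext => q; ring.
have E2 : (fun z => -1 * h z + g z) = (fun z => g z - h z) by apply: funext => z; ring.
by rewrite -E1 -E2.
Qed.

Lemma h1sqB u v : H1 u -> H1 v ->
  h1sq (fun q => u q - v q) =
  ip bmu (fun z => gder u z - gder v z) (fun z => gder u z - gder v z) +
  ip bmu (fun z => bval u z - bval v z) (fun z => bval u z - bval v z).
Proof.
move=> Hu Hv; have [_ wu] := H1_weak_grad hG Hu; have [_ wv] := H1_weak_grad hG Hv.
rewrite /h1sq (dform_eq2 (H1B Hu Hv) (weak_gradB wu wv)) /lform.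
by rewrite (_ : bval _ = fun z => bval u z - bval v z)//; apply/funext => z; exact: bvalB.
Qed.

(** A limit given by [sqi_complete] may live off the edges. Multiplying it by the indicator of
    [bundle_supp], which is the spread of 1, brings it no further from functions supported there. *)
Lemma sqi_restrict_supp (g : bundle R -> R) : sqi bmu g ->
  sqi bmu (fun z => g z * spread (fun (_ : edge G) _ => 1) z) /\
  forall f : bundle R -> R, sqi bmu f -> (forall z, ~ bundle_supp G z -> f z = 0) ->
    ip bmu (fun z => f z - g z * spread (fun (_ : edge G) _ => 1) z)
           (fun z => f z - g z * spread (fun (_ : edge G) _ => 1) z) <=
    ip bmu (fun z => f z - g z) (fun z => f z - g z).
Proof.
move=> [mg ig]; pose s := spread (fun (_ : edge G) (_ : R) => 1 : R).
have ms : measurable_fun setT s.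
  apply: bundle_measurable_fun => n; rewrite /s /spread /=.
  case: (pickle_inv n) => [e|]; last exact: measurable_cst.
  by apply: measurable_funM => //; apply: measurable_indic; exact: edge_interior_measurable.
have s01 z : s z = 0 \/ s z = 1.
  rewrite /s /spread; case: (pickle_inv z.1) => [e|]; last by left.
  by rewrite mul1r indicE; case: (_ \in _); [right|left].
have s1 z : bundle_supp G z -> s z = 1.
  by case: z => n x [e /= -> ex]; rewrite /s spreadE indicE mem_set// mulr1.
have sgs : sqi bmu (fun z => g z * s z).
  have m : measurable_fun setT (fun z => g z * s z) by exact: measurable_funM.
  split => //; apply: integrableT_bounded ig _; first exact: measurable_funX.
  move=> z; rewrite ger0_norm ?sqr_ge0//.
  by case: (s01 z) => ->; rewrite ?mulr1// mulr0 expr0n sqr_ge0.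
split => // f sf fS.
have sg : sqi bmu g by [].
rewrite -lee_fin -!ipE; [|exact: sqiB|exact: sqiB].
have m1 : measurable_fun setT (fun z => ((f z - g z * s z) ^+ 2)%:E).
  by apply/measurable_EFinP; apply: measurable_funX; have [] := sqiB sf sgs.
have m2 : measurable_fun setT (fun z => ((f z - g z) ^+ 2)%:E).
  by apply/measurable_EFinP; apply: measurable_funX; have [] := sqiB sf sg.
have p1 z : (0 <= ((f z - g z * s z) ^+ 2)%:E)%E by rewrite lee_fin sqr_ge0.
have p2 z : (0 <= ((f z - g z) ^+ 2)%:E)%E by rewrite lee_fin sqr_ge0.
apply: ge0_le_integral => //.
- move=> z _; rewrite lee_fin -/(s z).
  have [zS|zS] := pselect (bundle_supp G z); first by rewrite s1// mulr1.
  rewrite fS// !sub0r !sqrrN; case: (s01 z) => ->; rewrite ?mulr1// mulr0 expr0n.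
  exact: sqr_ge0.
Qed.

(** Values converge at every point by the sup bound, gradients converge in L^2, and the integral
    relation between them passes to the limit on each segment by Cauchy-Schwarz. *)
Lemma H1_complete (f : nat -> graph_point G -> R) : (forall n, H1 (f n)) ->
  (forall eps : R, 0 < eps -> exists N, forall m n, (N <= m)%N -> (N <= n)%N ->
     h1sq (fun q => f m q - f n q) <= eps) ->
  exists u, [/\ H1 u, forall q, f ^~ q @ \oo --> u q &
    forall eps : R, 0 < eps -> exists N, forall n, (N <= n)%N ->
      h1sq (fun q => f n q - u q) <= eps].
Proof.
move=> Hf cf; have [C C0 hC] := sup_norm_bound.
have cq q : cvgn (f ^~ q).
  apply: cauchy_real_cvg => eps eps0.
  have [N hN] := cf (eps ^+ 2 / C) (divr_gt0 (exprn_gt0 2 eps0) C0).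
  exists N => m n Nm Nn.
  rewrite -(@ler_pXn2r _ 2)// ?nnegrE ?normr_ge0 ?(ltW eps0)// real_normK ?num_real//.
  apply: le_trans (hC _ q (H1B (Hf m) (Hf n))) _.
  by rewrite -ler_pdivlMl// mulrC; exact: hN.
pose u q := limn (f ^~ q).
have fu q : f ^~ q @ \oo --> u q by exact: cq.
have cfE m n := h1sqB (Hf m) (Hf n).
have [g sg hg] : exists2 g, sqi bmu g & forall eps : R, 0 < eps -> exists N, forall n, (N <= n)%N ->
    ip bmu (fun z => gder (f n) z - g z) (fun z => gder (f n) z - g z) <= eps.
  apply: sqi_complete => [n|eps eps0]; first exact: sqi_gder.
  have [N hN] := cf eps eps0; exists N => m n Nm Nn.
  apply: le_trans (hN m n Nm Nn); rewrite cfE lerDl; exact: ip_ge0.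
have [sg' g'le] := sqi_restrict_supp sg.
set g' := fun z => _ in sg' g'le.
have gS n z : ~ bundle_supp G z -> gder (f n) z = 0 by exact: spread_out.
have hg' (eps : R) : 0 < eps -> exists N, forall n, (N <= n)%N ->
    ip bmu (fun z => gder (f n) z - g' z) (fun z => gder (f n) z - g' z) <= eps.
  move=> eps0; have [N hN] := hg eps eps0; exists N => n Nn.
  by apply: le_trans (hN n Nn); apply: g'le; [exact: sqi_gder|exact: gS].
have g'S z : ~ bundle_supp G z -> g' z = 0.
  by move=> zS; rewrite /g' spread_out// mulr0.
have hb (eps : R) : 0 < eps -> exists N, forall n, (N <= n)%N -> sqi bmu (fun z => bval (f n) z - bval u z) /\
    ip bmu (fun z => bval (f n) z - bval u z) (fun z => bval (f n) z - bval u z) <= eps.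
  move=> eps0; have [N hN] := cf eps eps0; exists N => n Nn.
  apply: (@fatou_ip _ _ _ bmu (fun m z => bval (f n) z - bval (f m) z)).
  - by move=> m; apply: sqiB; exact: sqi_bval.
  - by move=> z; apply: cvgB; [exact: cvg_cst|exact: (bval_cvg fu)].
  - exists N => // m /= Nm; apply: le_trans (hN n m Nn Nm).
    by rewrite cfE lerDr; exact: ip_ge0.
have su : sqi bmu (bval u).
  have [N /(_ N (leqnn N))[s _]] := hb 1 ltr01.
  have := sqiB (sqi_bval (Hf N)) s.
  by under eq_fun do rewrite opprB addrC subrK.
have wu : weak_grad u g'.
  split => // e x y xy.
  have [sge _] := sqi_slice (pickle e) sg' g'S.
  have cL : (fun n => on_edge (f n) e y - on_edge (f n) e x) @ \oo --> on_edge u e y - on_edge u e x.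
    have [qx hx] := on_edgeP hG e x; have [qy hy] := on_edgeP hG e y.
    rewrite hx hy; under eq_fun do rewrite hx hy.
    by apply: cvgB; exact: fu.
  apply: (cvg_unique _ cL) => //.
  apply/cvgrPdist_le => eps eps0.
  have yx0 : 0 < y - x + 1 by rewrite ltr_wpDl// subr_ge0.
  have [N hN] := hg' (eps ^+ 2 / (y - x + 1)) (divr_gt0 (exprn_gt0 2 eps0) yx0).
  exists N => // n /= Nn.
  have [_ wn] := H1_weak_grad hG (Hf n).
  have [sne pne] := weak_grad_primitive_sqi e wn.
  rewrite (pne _ _ xy) distrC -itvintB; [|exact: sqi_linteg..].
  rewrite -(@ler_pXn2r _ 2)// ?nnegrE ?normr_ge0 ?(ltW eps0)// real_normK ?num_real//.
  have sd := sqiB sne sge.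
  apply: le_trans (itvint_sqr_le sd xy) _.
  have dS z : ~ bundle_supp G z -> gder (f n) z - g' z = 0.
    by move=> zS; rewrite gS// g'S// subrr.
  have [_ le1] := sqi_slice (pickle e) (sqiB (sqi_gder (Hf n)) sg') dS.
  have le2 := le_trans (itvint_sqr_le_ip x y sd) (le_trans le1 (hN n Nn)).
  apply: le_trans (ler_wpM2l _ le2) _; first by rewrite subr_ge0.
  by rewrite mulrA ler_pdivrMr// mulrC ler_wpM2l ?sqr_ge0// lerDl.
have Hu : H1 u := weak_grad_H1 hG su wu.
exists u; split => // eps eps0.
have e2 : 0 < eps / 2 by rewrite divr_gt0.
have [N1 h1] := hg' _ e2; have [N2 h2] := hb _ e2.
exists (maxn N1 N2) => n; rewrite geq_max => /andP[n1 n2].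
have [_ wn] := H1_weak_grad hG (Hf n).
rewrite /h1sq (dform_eq2 (H1B (Hf n) Hu) (weak_gradB wn wu)) /lform.
rewrite (_ : bval _ = fun z => bval (f n) z - bval u z); last by apply/funext => z; exact: bvalB.
have [_ h2n] := h2 n n2; rewrite [leRHS](splitr eps); apply: lerD => //; exact: h1.
Qed.

Lemma H1_hoelder u e x y : H1 u -> (on_edge u e y - on_edge u e x) ^+ 2 <= `|y - x| * dform u u.
Proof.
move=> Hu; have [_ wu] := H1_weak_grad hG Hu.
have [sge pge] := weak_grad_primitive_sqi e wu.
apply: le_trans (primitive_hoelder x y sge pge) _; rewrite ler_wpM2l//.
have [sg gS _] := wu; have [_] := sqi_slice (pickle e) sg gS; exact.
Qed.

(** As in Arzela-Ascoli: extract at the countably many pairs of an edge and a rational coordinate,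
    then reach every point through the common Hoelder modulus of exponent 1/2. *)
Lemma H1_compact (f : nat -> graph_point G -> R) (M : R) : (forall n, H1 (f n)) ->
  (forall n, h1sq (f n) <= M) ->
  exists phi : nat -> nat, (forall n, (n <= phi n)%N) /\ forall q, cvgn (fun n => f (phi n) q).
Proof.
move=> Hf fM; have [C C0 hC] := sup_norm_bound.
have M0 : 0 <= M by apply: le_trans (fM 0); rewrite addr_ge0// ip_ge0.
have dM n : dform (f n) (f n) <= M.
  by apply: le_trans (fM n); rewrite /h1sq lerDl ip_ge0.
have CM0 : 0 <= C * M by rewrite mulr_ge0// ltW.
have fb n q : `|f n q| <= C * M + 1.
  have := hC _ q (Hf n); have := ler_wpM2l (ltW C0) (fM n).
  rewrite -(real_normK (num_real (f n q))); have := normr_ge0 (f n q); nra.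
pose a n (j : nat) : R :=
  if pickle_inv j is Some (e, r) then on_edge (f n) e (@ratr R r) else 0.
have [n j|phi [phin ac]] := @diagonal_cvg R a (C * M + 1).
  rewrite /a; case: (pickle_inv j) => [[e r]|]; last by rewrite normr0 addr_ge0.
  by have [q ->] := on_edgeP hG e (ratr r).
exists phi; split => // q.
have [e [x xq]] := graph_point_on_edge hG e0 q.
under eq_fun do rewrite -xq.
apply: cauchy_real_cvg => eps eps0.
have M1 : 0 < M + 1 by rewrite ltr_wpDl.
(* Chosen so that d (M + 1) = (eps / 3)^2: within distance d, all the f n vary by at most eps /
   3. *)
pose d := (eps / 3) ^+ 2 / (M + 1).
have d0 : 0 < d by rewrite divr_gt0// exprn_gt0// divr_gt0.
have [r /andP[xr rd]] : exists r : rat, (x < ratr r < x + d).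
  have /rat_in_itvoo[r] : x < x + d by rewrite ltrDl.
  by move=> rI; exists r; rewrite !(itvP rI).
have close n : `|on_edge (f n) e (ratr r) - on_edge (f n) e x| <= eps / 3.
  rewrite -(@ler_pXn2r _ 2)// ?nnegrE ?normr_ge0 ?divr_ge0 ?(ltW eps0)// real_normK ?num_real//.
  apply: le_trans (H1_hoelder e _ _ (Hf n)) _.
  have nd : `|ratr r - x| <= d by rewrite ger0_norm; lra.
  apply: (@le_trans _ _ (d * (M + 1))).
    apply: ler_pM => //; first exact: ip_ge0.
    by apply: le_trans (dM n) _; rewrite lerDl.
  by rewrite /d divfK// gt_eqF.
have := ac (pickle (e, r)).
under eq_fun do rewrite /a pickleK_inv.
move=> cv; have /cvg_ex [l /cvgrPdist_le hl] := cv.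
have e60 : 0 < eps / 6 by rewrite divr_gt0.
have [N _ hN] := hl _ e60.
exists N => m n Nm Nn.
have h1 := hN m Nm; have h2 := hN n Nn; have h3 := close (phi m); have h4 := close (phi n).
rewrite /= in h1 h2; move: h1 h2 h3 h4; rewrite !ler_norml => /andP[? ?] /andP[? ?] /andP[? ?] /andP[? ?].
by apply/andP; split; lra.
Qed.

End GraphSpace.

(** * Nehari sets in a Hilbert space of functions *)

Section HilbertFunctionSpace.
Variables (R : realType) (X : Type) (H : set (X -> R)) (N : (X -> R) -> R).
Implicit Types (u v w : X -> R) (f : nat -> X -> R).

Hypothesis H0 : H (fun=> 0).
Hypothesis H_lin : forall (a : R) u v, H u -> H v -> H (fun q => a * u q + v q).
Hypothesis N_ge0 : forall u, 0 <= N u.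
Hypothesis N_scale : forall (a : R) u, H u -> N (fun q => a * u q) = a ^+ 2 * N u.
Hypothesis N_parallelogram : forall u v, H u -> H v ->
  N (fun q => u q + v q) + N (fun q => u q - v q) = 2 * N u + 2 * N v.
Hypothesis H_complete : forall f, (forall n, H (f n)) ->
  (forall eps : R, 0 < eps -> exists k, forall m n, (k <= m)%N -> (k <= n)%N ->
     N (fun q => f m q - f n q) <= eps) ->
  exists u, [/\ H u, forall q, f ^~ q @ \oo --> u q &
    forall eps : R, 0 < eps -> exists k, forall n, (k <= n)%N ->
      N (fun q => f n q - u q) <= eps].

Lemma HZ (a : R) u : H u -> H (fun q => a * u q).
Proof. by move=> Hu; have := H_lin a Hu H0; under eq_fun do rewrite addr0. Qed.

Lemma HD u v : H u -> H v -> H (fun q => u q + v q).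
Proof. by move=> Hu Hv; have := H_lin 1 Hu Hv; under eq_fun do rewrite mul1r. Qed.

Lemma HB u v : H u -> H v -> H (fun q => u q - v q).
Proof. by move=> Hu Hv; have := H_lin (-1) Hv Hu; under eq_fun do rewrite mulN1r addrC. Qed.

(** Convex combinations with dyadic weights of the tail of f from n on; midpoints suffice because
    the parallelogram identity compares nothing else. *)
Inductive mid_hull f (n : nat) : (X -> R) -> Prop :=
| mid_hull_base k : (n <= k)%N -> mid_hull f n (f k)
| mid_hull_mid u v : mid_hull f n u -> mid_hull f n v ->
    mid_hull f n (fun q => 2^-1 * (u q + v q)).

Lemma mid_hull_ind_prop f n (A : (X -> R) -> Prop) : (forall k, (n <= k)%N -> A (f k)) ->
  (forall u v, A u -> A v -> A (fun q => 2^-1 * (u q + v q))) ->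
  forall u, mid_hull f n u -> A u.
Proof. by move=> Af Am u; elim=> [k nk|{}u v _ Au _ Av]; [exact: Af|exact: Am]. Qed.

Lemma mid_hull_H f n u : (forall k, H (f k)) -> mid_hull f n u -> H u.
Proof.
move=> Hf; apply: mid_hull_ind_prop => [k _//|v w Hv Hw].
by apply: HZ; exact: HD.
Qed.

Lemma N_mid u v : H u -> H v ->
  N (fun q => 2^-1 * (u q + v q)) = (2 * N u + 2 * N v - N (fun q => u q - v q)) / 4.
Proof.
by move=> Hu Hv; rewrite N_scale -?N_parallelogram//; [field|exact: HD].
Qed.

Lemma mid_hull_anti f m n u : (m <= n)%N -> mid_hull f n u -> mid_hull f m u.
Proof.
move=> mn; apply: mid_hull_ind_prop => [k nk|v w]; last exact: mid_hull_mid.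
by apply: mid_hull_base; exact: leq_trans nk.
Qed.

(* Nearly norm-minimal elements of the shrinking hulls form a Cauchy sequence, by the
   parallelogram identity: this replaces weak compactness. *)
Lemma mazur f M : (forall n, H (f n)) -> (forall n, N (f n) <= M) ->
  exists (g : nat -> X -> R) u, [/\ forall n, mid_hull f n (g n), H u,
    forall q, g ^~ q @ \oo --> u q & forall eps : R, 0 < eps -> exists k, forall n, (k <= n)%N ->
      N (fun q => g n q - u q) <= eps].
Proof.
move=> Hf fM; pose S n := [set N w | w in [set w | mid_hull f n w]].
have S0 n : S n !=set0 by exists (N (f n)), (f n) => //; exact: mid_hull_base.
have Slb n : has_lbound (S n) by exists 0 => _ [w _ <-]; exact: N_ge0.
have Sinf n : has_inf (S n) by split.
pose d n := inf (S n).
have dle n w : mid_hull f n w -> d n <= N w by move=> hw; apply: ge_inf => //; exists w.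
have dmono : {homo d : m n / (m <= n)%N >-> m <= n}.
  move=> m n mn; apply: lb_le_inf => // _ [w hw <-]; apply: dle; exact: mid_hull_anti hw.
have dM n : d n <= M.
  by apply: le_trans (fM n); apply: dle; exact: mid_hull_base.
have cd : cvgn d by apply: nondecreasing_is_cvgn => //; exists M => _ [n _ <-].
have dlim n : d n <= limn d by exact: nondecreasing_cvgn_le.
have /choice[v hv] n : exists w, mid_hull f n w /\ N w <= d n + n.+1%:R^-1.
  have [|_ [w hw <-] Nw] := @inf_adherent _ (S n) n.+1%:R^-1 _ (Sinf n); first by rewrite invr_gt0.
  by exists w; split => //; exact: ltW.
have Hv n : H (v n) by have [hw _] := hv n; exact: mid_hull_H hw.
have [] := @H_complete v Hv; last first.
  move=> u [Hu vu Nu]; exists v, u; split => // n; by have [] := hv n.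
move=> eps eps0.
have /cvgrPdist_lt /(_ (eps / 8)) := cd; rewrite divr_gt0// => /(_ isT)[k1 _ h1].
have := @cvg_harmonic R; move=> /cvgrPdist_lt /(_ (eps / 8)); rewrite divr_gt0// => /(_ isT)[k2 _ h2].
have harm n : (k2 <= n)%N -> n.+1%:R^-1 < eps / 8.
  by move=> /h2; rewrite /= sub0r normrN; apply: le_lt_trans; exact: ler_norm.
have dn n : (k1 <= n)%N -> limn d - eps / 8 < d n.
  by move=> /h1 /= h; have := le_lt_trans (ler_norm _) h; lra.
have key m n : (m <= n)%N -> (maxn k1 k2 <= m)%N -> N (fun q => v m q - v n q) <= eps.
  move=> mn; rewrite geq_max => /andP[km1 km2].
  have [hm Nm] := hv m; have [hn Nn] := hv n.
  (* The midpoint also competes for the infimum [d m], which bounds the parallelogram defect by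
     three errors below eps / 8, each counted twice. *)
  have hmid := mid_hull_mid hm (mid_hull_anti mn hn).
  have := dle _ _ hmid; rewrite N_mid// => hd.
  rewrite ler_pdivlMr// in hd.
  have arith (a b y dm dn' l h h' : R) : dm * 4 <= 2 * a + 2 * b - y -> a <= dm + h ->
    b <= dn' + h' -> dn' <= l -> l - eps / 8 < dm -> h < eps / 8 -> h' < eps / 8 -> y <= eps.
    by move=> *; lra.
  exact: (arith _ _ _ _ _ _ _ _ hd Nm Nn (dlim n) (dn _ km1) (harm _ km2) (harm _ (leq_trans km2 mn))).
exists (maxn k1 k2) => m n km kn; have [mn|/ltnW nm] := leqP m n; first exact: key.
rewrite (_ : (fun q => _) = (fun q => -1 * (v n q - v m q))).
  by rewrite N_scale ?sqrrN ?expr1n ?mul1r; [exact: key|exact: HB].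
by apply/funext => q; ring.
Qed.

Lemma mid_hull_ptwise f (l : X -> R) q : (forall q, f ^~ q @ \oo --> l q) ->
  forall g : nat -> X -> R, (forall n, mid_hull f n (g n)) -> g ^~ q @ \oo --> l q.
Proof.
move=> fl v hv; apply/cvgrPdist_le => eps eps0.
have /cvgrPdist_le /(_ eps eps0) [k _ hk] := fl q.
exists k => // n /= kn; have := hv n; move: (v n).
apply: mid_hull_ind_prop => [j nj|u w hu hw]; first by apply: hk => /=; exact: leq_trans nj.
move: hu hw; rewrite /= !ler_norml => /andP[? ?] /andP[? ?]; apply/andP; split; lra.
Qed.

(** Mazur averages converge in norm, so their limit is in H, and they keep the pointwise limit l of
    the sequence. *)
Lemma ptwise_limit_H f l M : (forall n, H (f n)) -> (forall n, N (f n) <= M) ->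
  (forall q, f ^~ q @ \oo --> l q) -> H l.
Proof.
move=> Hf fM fl; have [v [u [hv Hu vu _]]] := mazur Hf fM.
rewrite (_ : l = u)//; apply/funext => q.
exact: cvg_unique (mid_hull_ptwise fl hv) (vu q).
Qed.

Definition dual_functional (F : (X -> R) -> R) : Prop :=
  (forall (a : R) u v, H u -> H v -> F (fun q => a * u q + v q) = a * F u + F v) /\
  exists C : R, forall u, H u -> `|F u| <= C * Num.sqrt (N u).

Lemma dual_functional0 F : dual_functional F -> F (fun=> 0) = 0.
Proof.
move=> [Fl _]; have := Fl 1 _ _ H0 H0; under eq_fun do rewrite mulr0 addr0.
by rewrite mul1r => /eqP; rewrite -subr_eq0 opprD addrA subrr sub0r oppr_eq0 => /eqP.
Qed.

Lemma dual_functionalZ F (a : R) u : dual_functional F -> H u -> F (fun q => a * u q) = a * F u.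
Proof.
move=> FF Hu; have [Fl _] := FF; have := Fl a _ _ Hu H0.
by rewrite dual_functional0// addr0; under eq_fun do rewrite addr0.
Qed.

(** If |F (f n)| >= eps infinitely often, multiplying by signs makes F >= eps along a subsequence.
    Midpoints preserve this, whereas the Mazur averages tend to 0 in norm, against the continuity of
    F. *)
Lemma ptwise_null_weakly_null f M : (forall n, H (f n)) -> (forall n, N (f n) <= M) ->
  (forall q, f ^~ q @ \oo --> (0 : R)) ->
  forall F, dual_functional F -> (fun n => F (f n)) @ \oo --> (0 : R).
Proof.
move=> Hf fM f0 F FF; have [Fl [C FC]] := FF.
apply: contrapT => nF.
have [eps eps0 heps] : exists2 eps : R, 0 < eps & forall k, exists2 n, (k <= n)%N & eps <= `|F (f n)|.
  apply: contrapT => nex; apply: nF; apply/cvgrPdist_lt => eps eps0.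
  apply: contrapT => nn; apply: nex; exists eps => // k.
  apply: contrapT => nk; apply: nn; exists k => // n /= kn.
  rewrite sub0r normrN ltNge; apply/negP => hn; apply: nk; by exists n.
have /choice[s hs] k : exists n, (k <= n)%N /\ eps <= `|F (f n)|.
  by have [n ? ?] := heps k; exists n.
pose g k q := Num.sg (F (f (s k))) * f (s k) q.
have sg2 (x : R) : Num.sg x ^+ 2 <= 1.
  by rewrite sqr_sg; case: (x != 0).
have Hg k : H (g k) by exact: HZ.
have gM k : N (g k) <= M.
  rewrite N_scale//; apply: le_trans (fM (s k)).
  by rewrite ler_piMl// sg2.
have g0 q : g ^~ q @ \oo --> (0 : R).
  apply/cvgrPdist_le => e e0; have /cvgrPdist_le /(_ e e0) [k _ hk] := f0 q.
  exists k => // n /= kn; have [sn _] := hs n.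
  have := hk (s n) (leq_trans kn sn); rewrite !sub0r !normrN; apply: le_trans.
  rewrite /g normrM ler_piMl// normr_sg; by case: (_ != 0).
have Fg k : eps <= F (g k).
  have [_ h] := hs k; apply: le_trans h _.
  by rewrite /g dual_functionalZ// normrEsg.
have [w [u [hw Hu wu Nw]]] := mazur Hg gM.
have u0 : u = fun=> 0.
  apply/funext => q; apply: cvg_unique (wu q) _ => //.
  exact: mid_hull_ptwise g0 _ hw.
have Fw n : eps <= F (w n).
  have : H (w n) /\ eps <= F (w n); last by case.
  have := hw n; move: (w n); apply: mid_hull_ind_prop => [k _//|a b [Ha Fa] [Hb Fb]].
  split; first by apply: HZ; exact: HD.
  rewrite dual_functionalZ//; last exact: HD.
  have -> : (fun q => a q + b q) = (fun q => 1 * a q + b q) by apply/funext => q; rewrite mul1r.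
  by rewrite Fl// mul1r; lra.
have C1 : 0 < `|C| + 1 by rewrite ltr_wpDl.
have [k hk] := Nw ((eps / 2 / (`|C| + 1)) ^+ 2) (exprn_gt0 2 (divr_gt0 (divr_gt0 eps0 (ltr0n _ 2)) C1)).
have := hk k (leqnn k); rewrite u0; under eq_fun do rewrite subr0.
move=> Nk; have Hw : H (w k) by exact: mid_hull_H (hw k).
have := le_trans (Fw k) (le_trans (ler_norm _) (FC _ Hw)).
have sqN : Num.sqrt (N (w k)) <= eps / 2 / (`|C| + 1).
  rewrite -(@ler_pXn2r _ 2)// ?nnegrE ?sqrtr_ge0 ?divr_ge0 ?(ltW eps0) ?(ltW C1)//.
  by rewrite sqr_sqrtr.
move=> h; have : C * Num.sqrt (N (w k)) <= (`|C| + 1) * (eps / 2 / (`|C| + 1)).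
  apply: le_trans (ler_wpM2r (sqrtr_ge0 _) (ler_norm C)) _.
  by apply: ler_pM => //; rewrite ?sqrtr_ge0// lerDl.
rewrite [leRHS]mulrC divfK ?gt_eqF// => h2; lra.
Qed.

End HilbertFunctionSpace.

Lemma cvg_subseq (R : realType) (b : nat -> R) (phi : nat -> nat) (l : R) :
  (forall n, (n <= phi n)%N) -> b @ \oo --> l -> (fun n => b (phi n)) @ \oo --> l.
Proof.
move=> phin /cvgrPdist_lt bl; apply/cvgrPdist_lt => e /bl[k _ hk].
by exists k => // n /= kn; apply: hk => /=; exact: leq_trans kn (phin n).
Qed.

Lemma cvg_lip1 (R : realType) (b : nat -> R) (g : R -> R) (l : R) :
  (forall x y, `|g x - g y| <= `|x - y|) -> b @ \oo --> l -> (fun n => g (b n)) @ \oo --> g l.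
Proof.
move=> gL /cvgrPdist_lt bl; apply/cvgrPdist_lt => e /bl; apply: filterS => n.
exact: le_lt_trans (gL _ _).
Qed.

Lemma maxr0_lip (R : realType) (x y : R) : `|Num.max x 0 - Num.max y 0| <= `|x - y|.
Proof.
have h1 := ler_norm (x - y); have := ler_norm (y - x); rewrite distrC => h2.
by rewrite ler_norml; have [hx|hx] := leP x 0; have [hy|hy] := leP y 0; apply/andP; split; lra.
Qed.

Lemma minr0_lip (R : realType) (x y : R) : `|Num.min x 0 - Num.min y 0| <= `|x - y|.
Proof.
have h1 := ler_norm (x - y); have := ler_norm (y - x); rewrite distrC => h2.
by rewrite ler_norml; have [hx|hx] := leP x 0; have [hy|hy] := leP y 0; apply/andP; split; lra.
Qed.

(** * Minimization on the Nehari and nodal Nehari sets *)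

Section Nehari.
Variables (R : realType) (X : Type) (H : set (X -> R)).
Variables (D L : (X -> R) -> (X -> R) -> R) (P : (X -> R) -> R) (p lam : R).
Implicit Types (u v w : X -> R) (f : nat -> X -> R).

Definition hnorm u : R := D u u + L u u.
Definition qform u v : R := D u v + lam * L u v.
Definition action u : R := 1 / 2 * D u u + lam / 2 * L u u - 1 / p * P u.
Definition nehari_set : set (X -> R) := [set u | [/\ H u, u <> cst 0 & qform u u = P u]].
Definition nodal_set : set (X -> R) := [set u | [/\ H u,
  nehari_set (fun q => Num.max (u q) 0) & nehari_set (fun q => Num.min (u q) 0)]].

Hypothesis p2 : 2 < p.
Hypothesis H0 : H (fun=> 0).
Hypothesis H_lin : forall (a : R) u v, H u -> H v -> H (fun q => a * u q + v q).
Hypothesis D_sym : forall u v, D u v = D v u.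
Hypothesis L_sym : forall u v, L u v = L v u.
Hypothesis D_lin : forall (a : R) u v w, H u -> H v -> H w ->
  D (fun q => a * u q + v q) w = a * D u w + D v w.
Hypothesis L_lin : forall (a : R) u v w, H u -> H v -> H w ->
  L (fun q => a * u q + v q) w = a * L u w + L v w.
Hypothesis D_ge0 : forall u, 0 <= D u u.
Hypothesis L_ge0 : forall u, 0 <= L u u.
Hypothesis D_CS : forall u v, H u -> H v -> D u v ^+ 2 <= D u u * D v v.
Hypothesis L_CS : forall u v, H u -> H v -> L u v ^+ 2 <= L u u * L v v.
Hypothesis H_complete : forall f, (forall n, H (f n)) ->
  (forall eps : R, 0 < eps -> exists k, forall m n, (k <= m)%N -> (k <= n)%N ->
     hnorm (fun q => f m q - f n q) <= eps) ->
  exists u, [/\ H u, forall q, f ^~ q @ \oo --> u q &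
    forall eps : R, 0 < eps -> exists k, forall n, (k <= n)%N ->
      hnorm (fun q => f n q - u q) <= eps].
Hypothesis H_compact : forall f M, (forall n, H (f n)) -> (forall n, hnorm (f n) <= M) ->
  exists phi : nat -> nat, (forall n, (n <= phi n)%N) /\ forall q, cvgn (fun n => f (phi n) q).
Hypothesis H_split : forall u, H u -> [/\ H (fun q => Num.max (u q) 0), H (fun q => Num.min (u q) 0),
  D u u = D (fun q => Num.max (u q) 0) (fun q => Num.max (u q) 0) +
          D (fun q => Num.min (u q) 0) (fun q => Num.min (u q) 0),
  L u u = L (fun q => Num.max (u q) 0) (fun q => Num.max (u q) 0) +
          L (fun q => Num.min (u q) 0) (fun q => Num.min (u q) 0) &
  P u = P (fun q => Num.max (u q) 0) + P (fun q => Num.min (u q) 0)].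
Hypothesis P_scale : forall (t : R) u, H u -> P (fun q => t * u q) = `|t| `^ p * P u.
Hypothesis P_gt0 : forall u, H u -> u <> cst 0 -> 0 < P u.
Hypothesis P_mono : forall u v, H u -> H v -> (forall q, 0 <= u q <= v q) -> P u <= P v.
Hypothesis hnorm_gt0 : forall u, H u -> u <> cst 0 -> 0 < hnorm u.
Hypothesis P_cvg : forall f u M, (forall n, H (f n)) -> (forall n, hnorm (f n) <= M) -> H u ->
  (forall q, f ^~ q @ \oo --> u q) ->
  (fun n => P (f n) - P (fun q => f n q - u q)) @ \oo --> P u.
Hypothesis coercive : exists2 d : R, 0 < d & forall u, H u -> d * hnorm u <= qform u u.

(** On the Nehari set the action equals [kap] times the quadratic form, since P can be replaced by
    it. *)
Local Notation kap := (1 / 2 - 1 / p).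

Lemma kap_gt0 : 0 < kap.
Proof.
have p0 : 0 < p by apply: lt_trans p2; rewrite ltr0n.
by rewrite subr_gt0 !div1r ltf_pV2 ?posrE.
Qed.

Lemma hnorm_ge0 u : 0 <= hnorm u.
Proof. by rewrite addr_ge0. Qed.

Lemma qform_ge0 u : H u -> 0 <= qform u u.
Proof.
have [d d0 hd] := coercive; move=> Hu; apply: le_trans (hd u Hu).
exact: mulr_ge0 (ltW d0) (hnorm_ge0 u).
Qed.

Lemma form_lin2 (B : (X -> R) -> (X -> R) -> R) : (forall u v, B u v = B v u) ->
  (forall (a : R) u v w, H u -> H v -> H w ->
     B (fun q => a * u q + v q) w = a * B u w + B v w) ->
  forall (a : R) u v, H u -> H v ->
    B (fun q => a * u q + v q) (fun q => a * u q + v q) =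
    a ^+ 2 * B u u + 2 * a * B u v + B v v.
Proof.
move=> Bs Bl a u v Hu Hv; have Hw := H_lin a Hu Hv.
by rewrite Bl// (Bs u) (Bs v) !Bl// (Bs v u); ring.
Qed.

Lemma hnorm_lin2 (a : R) u v : H u -> H v -> hnorm (fun q => a * u q + v q) =
  a ^+ 2 * hnorm u + 2 * a * (D u v + L u v) + hnorm v.
Proof. by move=> Hu Hv; rewrite /hnorm (form_lin2 D_sym D_lin)// (form_lin2 L_sym L_lin)//; ring. Qed.

Lemma qform_lin2 (a : R) u v : H u -> H v ->
  qform (fun q => a * u q + v q) (fun q => a * u q + v q) =
  a ^+ 2 * qform u u + 2 * a * qform u v + qform v v.
Proof. by move=> Hu Hv; rewrite /qform (form_lin2 D_sym D_lin)// (form_lin2 L_sym L_lin)//; ring. Qed.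

Let HZ' := HZ H0 H_lin.
Let HB' := @HB R X H H_lin.

Lemma form0 (B : (X -> R) -> (X -> R) -> R) :
  (forall (a : R) u v w, H u -> H v -> H w ->
     B (fun q => a * u q + v q) w = a * B u w + B v w) ->
  forall w, H w -> B (fun=> 0) w = 0.
Proof.
move=> Bl w Hw; have := Bl (-1) _ _ w H0 H0 Hw.
by under eq_fun do rewrite mulr0 addr0; rewrite mulN1r addNr.
Qed.

Lemma formZ (B : (X -> R) -> (X -> R) -> R) : (forall u v, B u v = B v u) ->
  (forall (a : R) u v w, H u -> H v -> H w ->
     B (fun q => a * u q + v q) w = a * B u w + B v w) ->
  forall (a : R) u, H u -> B (fun q => a * u q) (fun q => a * u q) = a ^+ 2 * B u u.
Proof.
move=> Bs Bl a u Hu; have := form_lin2 Bs Bl a Hu H0.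
rewrite (Bs u) !(form0 Bl)// mulr0 !addr0 => <-.
by under [in RHS]eq_fun do rewrite addr0.
Qed.

Lemma hnormZ (a : R) u : H u -> hnorm (fun q => a * u q) = a ^+ 2 * hnorm u.
Proof. by move=> Hu; rewrite /hnorm (formZ D_sym D_lin)// (formZ L_sym L_lin)// mulrDr. Qed.

Lemma qformZ (a : R) u : H u -> qform (fun q => a * u q) (fun q => a * u q) = a ^+ 2 * qform u u.
Proof. by move=> Hu; rewrite /qform (formZ D_sym D_lin)// (formZ L_sym L_lin)//; ring. Qed.

Lemma hnorm_parallelogram u v : H u -> H v ->
  hnorm (fun q => u q + v q) + hnorm (fun q => u q - v q) = 2 * hnorm u + 2 * hnorm v.
Proof.
move=> Hu Hv.
rewrite (_ : (fun q => u q + v q) = (fun q => 1 * v q + u q)); last by apply/funext => q; ring.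
rewrite (_ : (fun q => u q - v q) = (fun q => -1 * v q + u q)); last by apply/funext => q; ring.
by rewrite !hnorm_lin2//; ring.
Qed.

Lemma qform_dual u : H u -> dual_functional H hnorm (qform u).
Proof.
move=> Hu; split.
  move=> a v w Hv Hw; rewrite /qform (D_sym u) (L_sym u) D_lin// L_lin//.
  rewrite (D_sym v) (D_sym w) (L_sym v) (L_sym w).
  ring.
exists (Num.sqrt (D u u) + `|lam| * Num.sqrt (L u u)) => v Hv.
have cs (a b c : R) : 0 <= b -> 0 <= c -> a ^+ 2 <= b * c -> `|a| <= Num.sqrt b * Num.sqrt c.
  move=> b0 c0 h; rewrite -sqrtrM// -sqrtr_sqr ler_wsqrtr//.
have hD : Num.sqrt (D v v) <= Num.sqrt (hnorm v) by rewrite ler_wsqrtr// /hnorm lerDl.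
have hL : Num.sqrt (L v v) <= Num.sqrt (hnorm v) by rewrite ler_wsqrtr// /hnorm lerDr.
apply: le_trans (ler_normD _ _) _; rewrite mulrDl normrM -mulrA; apply: lerD.
  apply: le_trans (cs _ _ _ _ _ (D_CS Hu Hv)) _ => //.
  by rewrite ler_wpM2l// sqrtr_ge0.
rewrite ler_wpM2l//; apply: le_trans (cs _ _ _ _ _ (L_CS Hu Hv)) _ => //.
by rewrite ler_wpM2l// sqrtr_ge0.
Qed.

Lemma ptwise_null_dual f M : (forall n, H (f n)) -> (forall n, hnorm (f n) <= M) ->
  (forall q, f ^~ q @ \oo --> (0 : R)) ->
  forall F, dual_functional H hnorm F -> (fun n => F (f n)) @ \oo --> (0 : R).
Proof.
move=> Hf fM f0 F; apply: (@ptwise_null_weakly_null _ _ _ hnorm H0 H_lin hnorm_ge0 hnormZ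
  hnorm_parallelogram H_complete f M) => //.
Qed.

Lemma ptwise_limit f l M : (forall n, H (f n)) -> (forall n, hnorm (f n) <= M) ->
  (forall q, f ^~ q @ \oo --> l q) -> H l.
Proof.
exact: (@ptwise_limit_H _ _ _ hnorm H0 H_lin hnorm_ge0 hnormZ hnorm_parallelogram H_complete f l M).
Qed.

Lemma nehari_action u : nehari_set u -> action u = kap * qform u u.
Proof. by move=> [_ _ h]; rewrite /action -h /qform; ring. Qed.

Lemma qform_gt0 u : H u -> u <> cst 0 -> 0 < qform u u.
Proof.
have [d d0 hd] := coercive; move=> Hu u0; apply: lt_le_trans (hd u Hu).
by rewrite mulr_gt0// hnorm_gt0.
Qed.

Lemma nehari_scale u : H u -> u <> cst 0 -> exists t, [/\ 0 < t,
  nehari_set (fun q => t * u q) & qform u u <= P u -> t <= 1].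
Proof.
move=> Hu u0; have Pu := P_gt0 Hu u0; have Qu := qform_gt0 Hu u0.
have p20 : 0 < p - 2 by rewrite subr_gt0.
have r0 : 0 < qform u u / P u by rewrite divr_gt0.
(* The positive root of t^2 Q(u) = t^p P(u). *)
exists ((qform u u / P u) `^ (p - 2)^-1); split; first exact: powR_gt0.
  set t := _ `^ _; have t0 : 0 < t by exact: powR_gt0.
  split; first exact: HZ'.
    move=> tu; apply: u0; apply/funext => q; have := congr1 (fun g => g q) tu.
    by move=> /= /eqP; rewrite mulf_eq0 gt_eqF//= => /eqP.
  rewrite qformZ// P_scale// gtr0_norm//.
  have -> : t `^ p = t ^+ 2 * (qform u u / P u).
    have {1}-> : p = 2%:R + (p - 2) by rewrite addrC subrK.
    rewrite powRD; last by rewrite (gt_eqF t0) implybT.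
    rewrite powR_mulrn ?(ltW t0)//; congr (_ * _).
    by rewrite /t -powRrM mulVf ?powRr1 ?(ltW r0)// gt_eqF.
  by rewrite -mulrA divfK// gt_eqF.
have e1 : 1 `^ (p - 2)^-1 = 1 :> R by rewrite powR1.
move=> QP; rewrite -[leRHS]e1; apply: ge0_ler_powR.
- by rewrite invr_ge0 ltW.
- by rewrite nnegrE ltW.
- by rewrite nnegrE.
- by rewrite ler_pdivrMr// mul1r.
Qed.

(** Here t <= 1, so the action kap t^2 Q(u) after scaling is at most kap Q(u), a quantity that makes
    sense before scaling and passes to limits. *)
Lemma nehari_scale_action u : H u -> u <> cst 0 -> qform u u <= P u ->
  exists t, [/\ 0 < t <= 1, nehari_set (fun q => t * u q) &
    action (fun q => t * u q) <= kap * qform u u].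
Proof.
move=> Hu u0 QP; have [t [t0 tN t1]] := nehari_scale Hu u0.
have {}t1 := t1 QP.
exists t; split => //; first by rewrite t0.
rewrite nehari_action// qformZ// ler_wpM2l ?(ltW kap_gt0)//.
by rewrite ler_piMl ?qform_ge0// expr_le1// ltW.
Qed.

Variable Jinf : \bar R.
Hypothesis Jinf_le : forall f, (forall n, nehari_set (f n)) ->
  (forall F, dual_functional H hnorm F -> (fun n => F (f n)) @ \oo --> (0 : R)) ->
  (Jinf <= limn_einf (fun n => (action (f n))%:E))%E.

Lemma Jinf_le_cvg f (b : nat -> R) (beta : R) : (forall n, nehari_set (f n)) ->
  (forall F, dual_functional H hnorm F -> (fun n => F (f n)) @ \oo --> (0 : R)) ->
  (forall n, action (f n) <= b n) -> b @ \oo --> beta -> (Jinf <= beta%:E)%E.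
Proof.
move=> fN fw fb bb; apply: le_trans (Jinf_le fN fw) _.
have bE : (fun n => (b n)%:E) @ \oo --> beta%:E by apply: cvg_EFin => //; exact: nearW.
rewrite -(cvg_limn_einf_sup bE).1 !limn_einf_lim.
apply: lee_lim; [exact: is_cvg_einfs|exact: is_cvg_einfs|].
apply: nearW => n; apply: le_ereal_inf_tmp => _ [m nm <-].
apply: (@le_trans _ _ (action (f m))%:E); last by rewrite lee_fin.
by apply: ereal_inf_lbound; exists m.
Qed.

(* The concentration-compactness alternative: either the limit can be rescaled into the
   Nehari set without raising the energy, or the part escaping to infinity carries at
   least the level at infinity. *)
Lemma nehari_alternative f u (alpha : R) : (forall n, nehari_set (f n)) ->
  (fun n => qform (f n) (f n)) @ \oo --> alpha -> (forall q, f ^~ q @ \oo --> u q) ->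
  [/\ H u, u <> cst 0, qform u u <= P u & qform u u <= alpha] \/ (Jinf <= (kap * alpha)%:E)%E.
Proof.
move=> fN Qa fu.
have fH n : H (f n) by have [] := fN n.
have [M fM] : exists M, forall n, hnorm (f n) <= M.
  have [d d0 hd] := coercive.
  have [M [_ hM]] := cvg_seq_bounded (cvgP _ Qa).
  exists ((`|M| + 1) / d) => n; rewrite ler_pdivlMr// mulrC; apply: le_trans (hd _ (fH n)) _.
  apply: le_trans (ler_norm _) (hM (`|M| + 1) _ n I).
  by apply: le_lt_trans (ler_norm M) _; rewrite ltrDl.
have Hu : H u by exact: ptwise_limit fH fM fu.
have faction n : action (f n) <= kap * qform (f n) (f n) by rewrite nehari_action.
have kQ : (fun n => kap * qform (f n) (f n)) @ \oo --> kap * alpha.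
  by apply: cvgM => //; exact: cvg_cst.
have [u0|u0] := pselect (u = cst 0).
  right; apply: (Jinf_le_cvg fN _ faction kQ) => F; apply: ptwise_null_dual fH fM _ F.
  by move=> q; have := fu q; rewrite u0.
pose w n q := f n q - u q.
have wH n : H (w n) by exact: HB'.
have wM n : hnorm (w n) <= 2 * M + 2 * hnorm u.
  have := hnorm_parallelogram (fH n) Hu; have := fM n.
  have := hnorm_ge0 (fun q => f n q + u q); rewrite -/(w n); lra.
have w0 q : w ^~ q @ \oo --> (0 : R).
  by rewrite -(subrr (u q)); apply: cvgB; [exact: fu|exact: cvg_cst].
have wdual := ptwise_null_dual wH wM w0.
have Qw : (fun n => qform (w n) (w n)) @ \oo --> alpha - qform u u.
  have c0 := wdual _ (qform_dual Hu).
  have -> : (fun n => qform (w n) (w n)) = (fun n => qform (f n) (f n) - qform u u - 2 * qform u (w n)).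
    apply/funext => n.
    have fE : f n = (fun q => 1 * w n q + u q) by apply/funext => q; rewrite /w; ring.
    rewrite {1 2}fE qform_lin2//.
    have -> : qform (w n) u = qform u (w n) by rewrite /qform D_sym L_sym.
    ring.
  rewrite -[X in _ --> X]subr0 -[X in _ - _ - X](mulr0 2).
  apply: cvgB; first by apply: cvgB => //; exact: cvg_cst.
  by apply: cvgM => //; exact: cvg_cst.
(* P (f n) equals Q (f n) on the Nehari set and so tends to alpha; Brezis-Lieb subtracts P u. The
   same alpha in the limits of Q (w n) and P (w n) makes them comparable. *)
have Pw : (fun n => P (w n)) @ \oo --> alpha - P u.
  have -> : (fun n => P (w n)) = (fun n => qform (f n) (f n) - (P (f n) - P (w n))).
    by apply/funext => n; have [_ _ ->] := fN n; ring.
  by apply: cvgB => //; exact: P_cvg fH fM Hu fu.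
have Qua : qform u u <= alpha.
  by rewrite -subr_ge0; apply: (cvgr_to_ge Qw); apply: nearW => n; exact: qform_ge0.
have [QP|PQ] := leP (qform u u) (P u); [by left|right].
have [n0 hn0] : exists n0, forall n, (n0 <= n)%N -> qform (w n) (w n) < P (w n).
  have cQP : (fun n => P (w n) - qform (w n) (w n)) @ \oo --> (alpha - P u) - (alpha - qform u u).
    exact: cvgB.
  have /cvgrPdist_lt /(_ (qform u u - P u)) := cQP.
  rewrite subr_gt0 PQ => /(_ isT)[n0 _ h]; exists n0 => n /= /h /= hn.
  have arith (a b c x y : R) : a - b - (a - c) - (x - y) < c - b -> y < x by move=> ?; lra.
  exact: arith (le_lt_trans (ler_norm _) hn).
have wne n : (n0 <= n)%N -> w n <> cst 0.
  move=> /hn0 + wn0; rewrite ltNge => /negP; apply.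
  have P0 : P (w n) = 0.
    have -> : w n = (fun q => 0 * w n q) by rewrite wn0; apply/funext => q; rewrite mul0r.
    by rewrite P_scale// normr0 powR0 ?mul0r// gt_eqF// (lt_trans _ p2).
  by rewrite P0 qform_ge0.
(* The shift by [n0] drops the finitely many indices at which Q (w n) may exceed P (w n), so that
   the whole scaled sequence lies in the Nehari set. *)
have /choice[t ht] n : exists t, [/\ 0 < t <= 1, nehari_set (fun q => t * w (n0 + n) q) &
    action (fun q => t * w (n0 + n) q) <= kap * qform (w (n0 + n)) (w (n0 + n))].
  by apply: nehari_scale_action => //; [exact/wne/leq_addr|exact/ltW/hn0/leq_addr].
pose g n q := t n * w (n0 + n) q.
have gN n : nehari_set (g n) by have [] := ht n.
have t1 n : 0 <= t n <= 1 by have [/andP[? ?] _ _] := ht n; apply/andP; split => //; exact: ltW.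
have gM n : hnorm (g n) <= 2 * M + 2 * hnorm u.
  rewrite hnormZ//; apply: le_trans (wM (n0 + n)).
  have /andP[? ?] := t1 n.
  by rewrite ler_piMl ?hnorm_ge0// expr_le1.
have sub (b : nat -> R) (l : R) : b @ \oo --> l -> (fun n => b (n0 + n)%N) @ \oo --> l.
  by apply: cvg_subseq => n; exact: leq_addl.
have g0 q : g ^~ q @ \oo --> (0 : R).
  have := sub _ _ (w0 q) => /cvgrPdist_le h; apply/cvgrPdist_le => e e0.
  have := h e e0; apply: filterS => n /=; rewrite !sub0r !normrN; apply: le_trans.
  have /andP[? ?] := t1 n.
  by rewrite /g normrM ler_piMl// ger0_norm.
have gH n : H (g n) by have [] := gN n.
have gdual := ptwise_null_dual gH gM g0.
have kQw : (fun n => kap * qform (w (n0 + n)) (w (n0 + n))) @ \oo --> kap * (alpha - qform u u).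
  apply: cvgM; first exact: cvg_cst.
  exact: (sub (fun n => qform (w n) (w n))).
have gact n : action (g n) <= kap * qform (w (n0 + n)) (w (n0 + n)) by have [] := ht n.
apply: le_trans (Jinf_le_cvg gN gdual gact kQw) _.
by rewrite lee_fin ler_wpM2l ?(ltW kap_gt0)// gerBl qform_ge0.
Qed.

Definition level (A : set (X -> R)) : \bar R := ereal_inf [set (action u)%:E | u in A].

Lemma level_le A u : A u -> (level A <= (action u)%:E)%E.
Proof. by move=> Au; apply: ereal_inf_lbound; exists u. Qed.

Lemma minimizing_sequence A : (forall u, A u -> 0 <= action u) -> (level A < +oo)%E ->
  exists (c : R) f, [/\ level A = c%:E, forall n, A (f n) & (fun n => action (f n)) @ \oo --> c].
Proof.
move=> A0 Aoo; have L0' : (0 <= level A)%E.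
  by apply: le_ereal_inf_tmp => _ [u Au <-]; rewrite lee_fin A0.
have [c lc] : exists c : R, level A = c%:E.
  by move: L0' Aoo; case: (level A) => [c _ _| |]//; exists c.
have /choice[f hf] n : exists u, A u /\ action u < c + n.+1%:R^-1.
  have : (level A < (c + n.+1%:R^-1)%:E)%E by rewrite lc lte_fin ltrDl invr_gt0.
  by move=> /ereal_inf_lt[_ [u Au <-]]; rewrite lte_fin => h; exists u.
exists c, f; split => // [n|]; first by have [] := hf n.
have h1 : (fun n => c + n.+1%:R^-1) @ \oo --> c.
  by rewrite -[X in _ --> X]addr0; apply: cvgD; [exact: cvg_cst|exact: cvg_harmonic].
apply: (squeeze_cvgr _ (cvg_cst c) h1); apply: nearW => n.
have [An /ltW ->] := hf n; rewrite andbT -lee_fin -lc; exact: level_le.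
Qed.

Lemma nehari_action_ge0 u : nehari_set u -> 0 <= action u.
Proof.
by move=> uN; rewrite nehari_action// mulr_ge0 ?(ltW kap_gt0)// qform_ge0//; case: uN.
Qed.

Lemma hnorm_bounded f (a : nat -> R) (l : R) : (forall n, H (f n)) ->
  (forall n, qform (f n) (f n) <= a n) -> a @ \oo --> l -> exists M, forall n, hnorm (f n) <= M.
Proof.
move=> fH fa al; have [d d0 hd] := coercive.
have [M [_ hM]] := cvg_seq_bounded (cvgP _ al).
exists ((`|M| + 1) / d) => n; rewrite ler_pdivlMr// mulrC; apply: le_trans (hd _ (fH n)) _.
apply: le_trans (fa n) _; apply: le_trans (ler_norm _) (hM (`|M| + 1) _ n I).
by apply: le_lt_trans (ler_norm M) _; rewrite ltrDl.
Qed.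

Lemma ground_state_exists : (level nehari_set < Jinf)%E ->
  exists u, nehari_set u /\ (action u)%:E = level nehari_set.
Proof.
move=> lJ; have [c [f [lc fN fc]]] := minimizing_sequence nehari_action_ge0 (lt_le_trans lJ (leey _)).
have fH n : H (f n) by have [] := fN n.
have k0 := kap_gt0.
have Qc : (fun n => qform (f n) (f n)) @ \oo --> kap^-1 * c.
  have -> : (fun n => qform (f n) (f n)) = (fun n => kap^-1 * action (f n)).
    by apply/funext => n; rewrite nehari_action// mulKf// gt_eqF.
  by apply: cvgM => //; exact: cvg_cst.
have [M fM] := hnorm_bounded fH (fun n => lexx _) Qc.
have [phi [phin cphi]] := H_compact fH fM.
pose u q := limn (fun n => f (phi n) q).
have [||[Hu u0 QP Qa]|] := @nehari_alternative (fun n => f (phi n)) u (kap^-1 * c) _ _ cphi.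
- by move=> n; exact: fN.
- exact: (cvg_subseq phin Qc).
- have [t [_ tN tJ]] := nehari_scale_action Hu u0 QP.
  exists (fun q => t * u q); split => //; apply/eqP; rewrite eq_le level_le// andbT lc lee_fin.
  apply: le_trans tJ _; apply: le_trans (ler_wpM2l (ltW k0) Qa) _.
  by rewrite mulVKf// gt_eqF.
- by rewrite mulVKf ?gt_eqF// => /(lt_le_trans lJ); rewrite lc ltxx.
Qed.

Local Notation posp u := (fun q => Num.max (u q) 0).
Local Notation negp u := (fun q => Num.min (u q) 0).

Lemma action_split u : H u -> action u = action (posp u) + action (negp u).
Proof. by move=> Hu; have [_ _ hD hL hP] := H_split Hu; rewrite /action hD hL hP; ring. Qed.

Lemma qform_split u : H u -> qform u u = qform (posp u) (posp u) + qform (negp u) (negp u).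
Proof. by move=> Hu; have [_ _ hD hL hP] := H_split Hu; rewrite /qform hD hL; ring. Qed.

Lemma nodal_action u : nodal_set u ->
  action u = kap * qform (posp u) (posp u) + kap * qform (negp u) (negp u).
Proof. by move=> [Hu up un]; rewrite action_split// !nehari_action. Qed.

(** Along a subsequence the energies of the two parts converge separately, to kap ap and kap an, of
    sum c and each at least the Nehari level. If one part had energy at least [Jinf], then c would
    reach the excluded threshold. So both parts of the limit scale into the Nehari set; the factors
    t and s may differ because the parts live where u > 0 and where u < 0. *)
Lemma nodal_state_exists : (level nodal_set < Jinf + level nehari_set)%E ->
  exists u, nodal_set u /\ (action u)%:E = level nodal_set.
Proof.
move=> lJ; have k0 := kap_gt0.
have nA0 u : nodal_set u -> 0 <= action u.
  by move=> uM; have [Hu up un] := uM; rewrite action_split// addr_ge0 ?nehari_action_ge0.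
have [c [f [lc fN fc]]] := minimizing_sequence nA0 (lt_le_trans lJ (leey _)).
have fH n : H (f n) by have [] := fN n.
have fp n : nehari_set (posp (f n)) by have [] := fN n.
have fn n : nehari_set (negp (f n)) by have [] := fN n.
have pH n : H (posp (f n)) by have [] := fp n.
have nH n : H (negp (f n)) by have [] := fn n.
have cc : (fun n => kap^-1 * action (f n)) @ \oo --> kap^-1 * c.
  by apply: cvgM => //; exact: cvg_cst.
have Qsum n : qform (posp (f n)) (posp (f n)) + qform (negp (f n)) (negp (f n)) = kap^-1 * action (f n).
  by rewrite nodal_action// -mulrDr mulKf// gt_eqF.
have [M fM] : exists M, forall n, hnorm (f n) <= M.
  by apply: (hnorm_bounded fH _ cc) => n; rewrite qform_split// Qsum.
have [M2 hM2] : exists M2, forall n, kap^-1 * action (f n) <= M2.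
  have [M2 [_ h]] := cvg_seq_bounded (cvgP _ cc); exists (`|M2| + 1) => n.
  apply: le_trans (ler_norm _) (h (`|M2| + 1) _ n I).
  by apply: le_lt_trans (ler_norm M2) _; rewrite ltrDl.
have [phi [phin cphi]] := H_compact fH fM.
(* Only two numerical sequences have to converge; they are encoded as i = 0 and i <> 0 to reuse the
   diagonal extraction. *)
pose a n (i : nat) := if i == 0%N then qform (posp (f (phi n))) (posp (f (phi n)))
  else qform (negp (f (phi n))) (negp (f (phi n))).
have [n i|psi [psin cpsi]] := @diagonal_cvg R a M2.
  have h := hM2 (phi n); rewrite -Qsum in h.
  have h1 := qform_ge0 (pH (phi n)); have h2 := qform_ge0 (nH (phi n)).
  by rewrite /a; case: (i == 0%N); rewrite ger0_norm//; lra.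
pose th n := phi (psi n).
have thn n : (n <= th n)%N by exact: leq_trans (psin n) (phin _).
pose u q := limn (fun n => f (phi n) q).
have fu q : (fun n => f (th n) q) @ \oo --> u q.
  exact: (@cvg_subseq _ (fun n => f (phi n) q) psi _ psin (cphi q)).
have /cvg_ex[ap cap] := cpsi 0%N; have /cvg_ex[an can] := cpsi 1%N.
rewrite /a /= in cap can.
have cE : c = kap * ap + kap * an.
  apply: (@cvg_unique _ _ ((fun n => action (f (th n))) @ \oo)) => //.
    exact: (cvg_subseq thn fc).
  rewrite (_ : (fun n => action (f (th n))) = (fun n =>
    kap * qform (posp (f (th n))) (posp (f (th n))) + kap * qform (negp (f (th n))) (negp (f (th n))))).
    by apply: cvgD; apply: cvgM => //; exact: cvg_cst.
  by apply/funext => n; rewrite nodal_action.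
have cN_le (g : nat -> X -> R) (al : R) : (forall n, nehari_set (g n)) ->
    (fun n => qform (g n) (g n)) @ \oo --> al -> (level nehari_set <= (kap * al)%:E)%E.
  move=> gN gal.
  have kal : (fun n => (kap * qform (g n) (g n))%:E) @ \oo --> (kap * al)%:E.
    by apply: cvg_EFin; [exact: nearW|apply: cvgM => //; exact: cvg_cst].
  rewrite -(cvg_lim _ kal)//; apply: lime_ge; first by apply/cvg_ex; exists (kap * al)%:E.
  by apply: nearW => n; rewrite -nehari_action//; exact: level_le.
have lp := cN_le (fun n => posp (f (th n))) ap (fun n => fp _) cap.
have ln := cN_le (fun n => negp (f (th n))) an (fun n => fn _) can.
have pu q : (fun n => Num.max (f (th n) q) 0) @ \oo --> Num.max (u q) 0.
  exact: (cvg_lip1 (@maxr0_lip R) (fu q)).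
have nu q : (fun n => Num.min (f (th n) q) 0) @ \oo --> Num.min (u q) 0.
  exact: (cvg_lip1 (@minr0_lip R) (fu q)).
have [[Hp p0 QPp Qap]|Jp] := nehari_alternative (fun n => fp (th n)) cap pu; last first.
  by move: lJ; rewrite ltNge lc cE EFinD leeD.
have [[Hn n0 QPn Qan]|Jn] := nehari_alternative (fun n => fn (th n)) can nu; last first.
  by move: lJ; rewrite ltNge lc cE EFinD addeC leeD.
have [t [/andP[t0 _] tN tJ]] := nehari_scale_action Hp p0 QPp.
have [s [/andP[s0 _] sN sJ]] := nehari_scale_action Hn n0 QPn.
pose v q := t * Num.max (u q) 0 + s * Num.min (u q) 0.
have vp : posp v = (fun q => t * Num.max (u q) 0).
  apply/funext => q; rewrite /v; have [h|h] := leP (u q) 0.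
    by rewrite mulr0 add0r max_r// mulr_ge0_le0// ltW.
  by rewrite mulr0 addr0 max_l// mulr_ge0 ?ltW.
have vn : negp v = (fun q => s * Num.min (u q) 0).
  apply/funext => q; rewrite /v; have [h|h] := leP (u q) 0.
    by rewrite mulr0 add0r min_l// mulr_ge0_le0// ltW.
  by rewrite mulr0 addr0 min_r// mulr_ge0 ?ltW.
have Hv : H v by apply: H_lin => //; exact: HZ'.
have vM : nodal_set v by split; rewrite ?vp ?vn.
exists v; split => //; apply/eqP; rewrite eq_le level_le// andbT lc cE lee_fin.
rewrite action_split// vp vn; apply: lerD.
  by apply: le_trans tJ _; rewrite ler_wpM2l// ltW.
by apply: le_trans sJ _; rewrite ler_wpM2l// ltW.
Qed.

Definition ground_state u := nehari_set u /\ (action u)%:E = level nehari_set.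

(** Minimality reaches beyond the Nehari set: anything with Q <= P scales down into it without
    gaining energy. *)
Lemma ground_state_le u v : ground_state u -> H v -> v <> cst 0 -> qform v v <= P v ->
  qform u u <= qform v v.
Proof.
move=> [uN uL] Hv v0 QP; have [t' [_ tN tJ]] := nehari_scale_action Hv v0 QP.
have := level_le tN; rewrite -uL lee_fin nehari_action// => h.
by rewrite -(ler_pM2l kap_gt0); exact: le_trans h tJ.
Qed.

(** Q and P are additive over the two parts and agree at u, so one part has Q <= P. Minimality
    bounds Q(u) by the Q of that part, although the other part contributes a positive amount. *)
Lemma ground_state_sign u : ground_state u -> posp u = cst 0 \/ negp u = cst 0.
Proof.
move=> gu; have [[Hu u0 QP] _] := gu; have [Hp Hn hD hL hP] := H_split Hu.
have Qs := qform_split Hu.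
apply: contrapT => /not_orP[p0 n0].
have Qp := qform_gt0 Hp p0; have Qn := qform_gt0 Hn n0.
have [h|h] := leP (qform (posp u) (posp u)) (P (posp u)).
  by have := ground_state_le gu Hp p0 h; rewrite Qs; lra.
have h' : qform (negp u) (negp u) <= P (negp u) by move: QP; rewrite Qs hP; lra.
by have := ground_state_le gu Hn n0 h'; rewrite Qs; lra.
Qed.

(** If Q(u, v) < 0, moving from u to u + t v lowers Q for small t > 0 and does not lower P, as both
    functions are nonnegative; this contradicts [ground_state_le]. *)
Lemma ground_state_supersolution u v : ground_state u -> (forall q, 0 <= u q) ->
  H v -> (forall q, 0 <= v q) -> 0 <= qform u v.
Proof.
move=> gu up Hv vp; have [[Hu u0 QP] _] := gu; rewrite leNgt; apply/negP => uv0.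
(* The value with t (Q(v) + 1) = - Q(u, v), small enough that t^2 Q(v) + 2 t Q(u, v) < 0; the 1
   guards against Q(v) = 0. *)
pose t := - qform u v / (qform v v + 1).
have Qv := qform_ge0 Hv.
have t0 : 0 < t by rewrite divr_gt0 ?oppr_gt0// ltr_wpDl.
have Hw : H (fun q => t * v q + u q) by exact: H_lin.
have Pw : P u <= P (fun q => t * v q + u q).
  by apply: P_mono => // q; rewrite up lerDr mulr_ge0 ?(ltW t0)/=.
have Qw : qform (fun q => t * v q + u q) (fun q => t * v q + u q) < qform u u.
  rewrite qform_lin2// [qform v u](_ : _ = qform u v); last by rewrite /qform D_sym L_sym.
  rewrite -ltrBrDr subrr.
  have tE : t * (qform v v + 1) = - qform u v by rewrite /t divfK// gt_eqF// ltr_wpDl.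
  nra.
have w0 : (fun q => t * v q + u q) <> cst 0.
  move=> w0; have := P_gt0 Hu u0; rewrite ltNge => /negP; apply.
  apply: le_trans Pw _; rewrite w0 (_ : cst 0 = (fun q => 0 * u q)).
    by rewrite P_scale// normr0 powR0 ?mul0r// gt_eqF// (lt_trans _ p2).
  by apply/funext => q; rewrite mul0r.
have QPw : qform (fun q => t * v q + u q) (fun q => t * v q + u q) <= P (fun q => t * v q + u q).
  by apply: le_trans (ltW Qw) _; rewrite QP.
by have := ground_state_le gu Hw w0 QPw; rewrite leNgt Qw.
Qed.

Lemma ground_state_opp u : ground_state u -> ground_state (fun q => -1 * u q).
Proof.
move=> [[Hu u0 QP] uL].
have PE : P (fun q => -1 * u q) = P u by rewrite P_scale// normrN normr1 powR1 mul1r.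
have QE : qform (fun q => -1 * u q) (fun q => -1 * u q) = qform u u.
  by rewrite qformZ// sqrrN expr1n mul1r.
have N1 : nehari_set (fun q => -1 * u q).
  split; [exact: HZ'| |by rewrite QE PE].
  move=> h; apply: u0; apply/funext => q; have := congr1 (fun g => g q) h.
  by move=> /= /eqP; rewrite mulN1r oppr_eq0 => /eqP.
by split => //; rewrite nehari_action// QE -nehari_action.
Qed.

End Nehari.

(** * Strict positivity of nonnegative ground states *)

Section TestFunctions.
Variables (R : realType) (G : metric_graph R).
Local Notation mu := (@lebesgue_measure R).
Local Notation bmu := (@bmu R).
Implicit Types (u v : graph_point G -> R) (e : edge G) (x y h : R) (F K : bundle R -> R).

Lemma ip_single_sqr e K : sqi bmu K ->
  (forall z, ~ (z.1 = pickle e /\ edge_interior e z.2) -> K z = 0) ->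
  ip bmu K K = ip mu (fun x => K (pickle e, x)) (fun x => K (pickle e, x)).
Proof.
move=> sK Ke; apply: EFin_inj.
have KS z : ~ bundle_supp G z -> K z = 0.
  by move=> zS; apply: Ke => -[z1 z2]; apply: zS; exists e.
rewrite (@ip_bundle _ G)//.
have <- : (\esum_(e' in [set e]) (ip mu (fun x => K (pickle e', x)) (fun x => K (pickle e', x)))%:E
   = (ip mu (fun x => K (pickle e, x)) (fun x => K (pickle e, x)))%:E)%E.
  by rewrite esum_set1// lee_fin ip_ge0.
rewrite [RHS]esum_mkcond; apply: eq_esum => e' _.
case: (boolP (e' \in _)) => // /negP; rewrite inE => e'e.
have K0 x : K (pickle e', x) = 0.
  by apply: Ke => -[/= /(pcan_inj pickleK_inv)].
by rewrite /ip; under eq_Rintegral do rewrite K0 mul0r; rewrite Rintegral_cst// mul0r.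
Qed.

(** [ip_bundle] decomposes only squares, so the product is recovered by polarization, with t = 1 and
    t = -1, after the cut-off [m] has confined F to the edge. *)
Lemma ip_single e F K : sqi bmu F -> sqi bmu K ->
  (forall z, ~ (z.1 = pickle e /\ edge_interior e z.2) -> K z = 0) ->
  ip bmu F K = ip mu (fun x => F (pickle e, x)) (fun x => K (pickle e, x)).
Proof.
move=> sF sK Ke.
pose m := spread (fun (e' : edge G) (_ : R) => (e' == e)%:R : R).
have mm : measurable_fun setT m.
  apply: bundle_measurable_fun => n; rewrite /m /spread /=.
  case: (pickle_inv n) => [e'|]; last exact: measurable_cst.
  by apply: measurable_funM => //; apply: measurable_indic; exact: edge_interior_measurable.
have m1 z : z.1 = pickle e -> edge_interior e z.2 -> m z = 1.
  by case: z => n x /= -> ex; rewrite /m spreadE eqxx indicE mem_set// mulr1.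
have m0 z : ~ (z.1 = pickle e /\ edge_interior e z.2) -> m z = 0.
  move=> ze; rewrite /m /spread; case E : (pickle_inv z.1) => [e'|//].
  have z1 : z.1 = pickle e' by have := @pickle_invK (edge G) z.1; rewrite E /=.
  have [ee'|] := eqVneq e' e; last by rewrite mul0r.
  rewrite indicE memNset ?mulr0// => e'z; apply: ze.
  by rewrite z1 ee'; split => //; rewrite -ee'.
have mb z : `|m z| <= 1.
  have [[h1 h2]|h] := pselect (z.1 = pickle e /\ edge_interior e z.2).
    by rewrite m1// normr1.
  by rewrite m0// normr0.
pose F' z := F z * m z.
have sF' : sqi bmu F'.
  have [mF iF] := sF.
  have mF' : measurable_fun setT F' by exact: measurable_funM.
  split => //; apply: integrableT_bounded iF _; first exact: measurable_funX.
  move=> z; rewrite ger0_norm ?sqr_ge0// /F' exprMn ler_piMr ?sqr_ge0//.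
  by rewrite -(real_normK (num_real (m z))) expr_le1.
have F'e z : ~ (z.1 = pickle e /\ edge_interior e z.2) -> F' z = 0.
  by move=> /m0; rewrite /F' => ->; rewrite mulr0.
have E1 : ip bmu F K = ip bmu F' K.
  apply: eq_Rintegral => z _; have [[h1 h2]|h] := pselect (z.1 = pickle e /\ edge_interior e z.2).
    by rewrite /F' m1// mulr1.
  by rewrite Ke// !mulr0.
have KS z : ~ bundle_supp G z -> K z = 0.
  by move=> zS; apply: Ke => -[z1 z2]; apply: zS; exists e.
have F'S z : ~ bundle_supp G z -> F' z = 0.
  by move=> zS; apply: F'e => -[z1 z2]; apply: zS; exists e.
have [sKe _] := sqi_slice (pickle e) sK KS; have [sFe _] := sqi_slice (pickle e) sF' F'S.
have E2 : ip mu (fun x => F (pickle e, x)) (fun x => K (pickle e, x)) =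
    ip mu (fun x => F' (pickle e, x)) (fun x => K (pickle e, x)).
  apply: eq_Rintegral => x _; have [ex|ex] := pselect (edge_interior e x).
    by rewrite /F' m1// mulr1.
  by rewrite Ke ?mulr0// => -[].
rewrite E1 E2.
have pol t := ip_single_sqr (sqi_lin t sF' sK) (fun z ze =>
  etrans (congr2 (fun a b => t * a + b) (F'e z ze) (Ke z ze)) (etrans (addr0 _) (mulr0 t))).
have := pol 1; have := pol (-1); rewrite !ipD2//; lra.
Qed.

Lemma ip_sum (I : eqType) (r : seq I) F (K : I -> bundle R -> R) : sqi bmu F ->
  (forall i, i \in r -> sqi bmu (K i)) ->
  sqi bmu (fun z => \sum_(i <- r) K i z) /\
  ip bmu F (fun z => \sum_(i <- r) K i z) = \sum_(i <- r) ip bmu F (K i).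
Proof.
move=> sF; elim: r => [|i r IH] sK.
  have z0 : sqi bmu (fun z => 0 * F z) by exact: sqiZ.
  have E : (fun z => \sum_(i <- [::]) K i z) = (fun z => 0 * F z).
    by apply/funext => z; rewrite big_nil mul0r.
  rewrite E big_nil; split => //.
  by rewrite /ip; under eq_Rintegral do rewrite mul0r mulr0; rewrite Rintegral_cst// mul0r.
have sK' j : j \in r -> sqi bmu (K j) by move=> jr; apply: sK; rewrite inE jr orbT.
have [s1 e1] := IH sK'.
have si : sqi bmu (K i) by apply: sK; rewrite inE eqxx.
have E : (fun z => \sum_(j <- i :: r) K j z) = (fun z => 1 * K i z + \sum_(j <- r) K j z).
  by apply/funext => z; rewrite big_cons mul1r.
rewrite E; split; first exact: sqi_lin.
by rewrite ipC ip_lin// mul1r big_cons ipC (ipC _ _ F) e1.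
Qed.

Lemma linteg_indic (A : set R) : measurable A -> linteg (\1_A : R -> R).
Proof.
move=> mA; apply: (@linteg_le _ _ (fun=> 1)) => [|| x].
- exact: measurable_indic.
- exact: linteg_cst.
- by rewrite indicE; case: (x \in A); rewrite ?normr1 ?normr0.
Qed.

Lemma itvint_oo (x y : R) g : linteg g -> itvint g x y = \int[mu]_(t in `]x, y[) g t.
Proof.
move=> [_ ig]; rewrite /itvint -Rintegral_itv_bndo_bndc; last first.
  by apply: (integrableS _ _ _ (ig x y)) => //; apply: subset_itvl; rewrite bnd_simp.
rewrite -Rintegral_itv_obnd_cbnd//.
by apply: (integrableS _ _ _ (ig x y)) => //; apply: subset_itvW.
Qed.

Lemma eq_itvint_oo (x y : R) (g h : R -> R) : linteg g -> linteg h ->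
  (forall t, x < t < y -> g t = h t) -> itvint g x y = itvint h x y.
Proof.
move=> lg lh gh; rewrite !itvint_oo//; apply: eq_Rintegral => t.
by rewrite inE/= in_itv/= => /gh.
Qed.

(** For a <= b, the projection onto [a, b]; it is a primitive of the indicator of ]a, b[, so
    piecewise affine functions are combinations of clamps. *)
Definition clamp (a b x : R) : R := Num.max a (Num.min b x).

Lemma clamp_id (a b x : R) : a <= x -> x <= b -> clamp a b x = x.
Proof. by move=> ax xb; rewrite /clamp min_r// max_r. Qed.

Lemma clamp_le (a b x : R) : x <= a -> a <= b -> clamp a b x = a.
Proof. by move=> xa ab; rewrite /clamp max_l// ge_min xa orbT. Qed.

Lemma clamp_ge (a b x : R) : a <= b -> b <= x -> clamp a b x = b.
Proof. by move=> ab bx; rewrite /clamp min_l// max_r. Qed.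

Lemma primitive_clamp (a b : R) : a <= b ->
  primitive (clamp a b) (\1_(`]a, b[%classic : set R)).
Proof.
move=> ab.
have li : linteg (\1_(`]a, b[%classic : set R) : R -> R) by apply: linteg_indic.
have Il x y : x <= y -> y <= a -> itvint (\1_(`]a, b[%classic : set R)) x y = 0.
  move=> xy ya; rewrite (@eq_itvint _ _ (fun=> 0)) ?itvint_cst ?mul0r// => t /andP[_ ty].
  by rewrite indicE memNset//= in_itv/= => /andP[]; rewrite ltNge (le_trans ty ya).
have Ir x y : x <= y -> b <= x -> itvint (\1_(`]a, b[%classic : set R)) x y = 0.
  move=> xy bx; rewrite (@eq_itvint _ _ (fun=> 0)) ?itvint_cst ?mul0r// => t /andP[xt _].
  by rewrite indicE memNset//= in_itv/= => /andP[_]; rewrite ltNge (le_trans bx xt).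
have Im x y : x <= y -> a <= x -> y <= b -> itvint (\1_(`]a, b[%classic : set R)) x y = y - x.
  move=> xy ax yb.
  rewrite (@eq_itvint_oo _ _ _ (fun=> 1 : R))//; first by rewrite itvint_cst// mul1r.
    exact: linteg_cst.
  move=> t /andP[xt ty]; rewrite indicE mem_set//= in_itv/=.
  by rewrite (le_lt_trans ax xt) (lt_le_trans ty yb).
move=> x y xy.
case: (leP y a) => ya.
  by rewrite !clamp_le// ?(le_trans xy)// subrr Il.
case: (leP b x) => bx.
  by rewrite !clamp_ge// ?(le_trans bx)// subrr Ir.
have ym : exists2 m, m <= y & a <= m /\ m <= b /\ clamp a b y = m /\ Num.min y b <= m /\
    itvint (\1_(`]a, b[%classic : set R)) m y = 0.
  case: (leP y b) => yb.
    exists y => //; split; [exact: ltW|split => //; split; first by rewrite clamp_id ?(ltW ya)].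
    by split; [exact: lexx|exact: itvintxx].
  exists b; first exact: ltW.
  split => //; split => //; split; first by rewrite clamp_ge ?(ltW yb).
  by split; [exact: lexx|rewrite Ir ?(ltW yb)].
have xm : exists2 m, x <= m & a <= m /\ m <= b /\ clamp a b x = m /\ m <= Num.min y b /\
    itvint (\1_(`]a, b[%classic : set R)) x m = 0.
  case: (leP a x) => ax.
    by exists x => //; rewrite (ltW bx) clamp_id ?(ltW bx)// itvintxx le_min xy (ltW bx).
  by exists a; rewrite ?(ltW ax)// clamp_le ?(ltW ax)// Il ?(ltW ax)// le_min (ltW ya) ab.
have [n ny [an [nb [-> [xn i1]]]]] := ym; have [m xm' [am [mb [-> [mn i2]]]]] := xm.
have mn' : m <= n by exact: le_trans mn xn.
rewrite (itvint_chasles li xm' (le_trans mn' ny)) i2 add0r.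
by rewrite (itvint_chasles li mn' ny) i1 addr0 Im.
Qed.

Definition piece e (A : set R) : bundle R -> R := fun z => (z.1 == pickle e)%:R * \1_A z.2.

Lemma piece_out e A z : A `<=` edge_interior e ->
  ~ (z.1 = pickle e /\ edge_interior e z.2) -> piece e A z = 0.
Proof.
move=> Ae ze; rewrite /piece; case: eqP => [z1|]; last by rewrite mul0r.
by rewrite mul1r indicE memNset// => /Ae h; apply: ze.
Qed.

Lemma piece_sqi e A (a b : R) : measurable A -> A `<=` edge_interior e -> A `<=` `[a, b] ->
  sqi bmu (piece e A).
Proof.
move=> mA Ae Aab.
have mp : measurable_fun setT (piece e A).
  apply: bundle_measurable_fun => n; apply: measurable_funM; first exact: measurable_cst.
  exact: measurable_indic.
have mp2 : measurable_fun setT (fun z => piece e A z ^+ 2) by exact: measurable_funX.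
split => //; apply/integrableP; split; first exact/measurable_EFinP.
under eq_integral do rewrite gee0_abs ?lee_fin ?sqr_ge0//.
rewrite (@bundle_integral _ G)//; last first.
- move=> z zS; rewrite (piece_out Ae) ?expr0n// => -[z1 z2]; apply: zS; by exists e.
- by move=> z; exact: sqr_ge0.
rewrite (_ : (\esum_(e' in _) _)%E = (mu A)).
  apply: (@le_lt_trans _ _ (mu `[a, b])); first by apply: le_measure; rewrite ?inE.
  by rewrite lebesgue_measure_itv/=; case: ifP => //; rewrite -EFinB ltry.
transitivity (\esum_(e' in [set e]) (\int[mu]_x (piece e A (pickle e', x) ^+ 2)%:E))%E.
  rewrite [RHS]esum_mkcond; apply: eq_esum => e' _.
  case: (boolP (e' \in _)) => // /negP; rewrite inE => e'e.
  under eq_integral => x _.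
    rewrite piece_out// ?expr0n//; last by move=> [/= /(pcan_inj pickleK_inv)].
    over.
  by rewrite integral0.
have i0 : (0 <= \int[mu]_x (piece e A (pickle e, x) ^+ 2)%:E)%E.
  by apply: integral_ge0 => x _; rewrite lee_fin sqr_ge0.
rewrite esum_set1//.
transitivity (\int[mu]_x (\1_A x)%:E)%E; last by rewrite integral_indic ?setIT.
apply: eq_integral => x _; rewrite /piece /= eqxx mul1r indicE.
by case: (x \in A); rewrite ?expr1n ?expr0n.
Qed.

Lemma ip_piece e A (a b : R) F : measurable A -> A `<=` edge_interior e -> A `<=` `[a, b] ->
  sqi bmu F -> ip bmu F (piece e A) = itvint (fun x => F (pickle e, x) * \1_A x) a b.
Proof.
move=> mA Ae Aab sF; rewrite (@ip_single e)//; last 2 first.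
- exact: piece_sqi Aab.
- by move=> z ze; exact: piece_out.
have -> : itvint (fun x => F (pickle e, x) * \1_A x) a b =
    \int[mu]_(x in `[a, b]) (1 * (F (pickle e, x) * \1_A x)).
  by apply: eq_Rintegral => x _; rewrite mul1r.
rewrite -ip_indic /ip.
apply: eq_Rintegral => x _; rewrite /piece/= eqxx !mul1r.
case: (boolP (x \in A)) => xA; last by rewrite !indicE (negbTE xA) !mulr0.
have xab : x \in (`[a, b]%classic : set R) by rewrite inE; apply: Aab; exact: set_mem.
by rewrite [X in _ = X * _]indicE xab mul1r.
Qed.

End TestFunctions.

(** * Piecewise affine test functions on a star of edge segments *)

Section StarTest.
Variables (R : realType) (G : metric_graph R).
Hypothesis hG : class_G G.
Local Notation mu := (@lebesgue_measure R).
Local Notation bmu := (@bmu R).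
Variables (I : eqType) (S : seq I) (ed : I -> edge G) (lo hi k : I -> R).
Variables (phi : graph_point G -> R) (C : edge G -> R).
Hypothesis lo0 : forall i, i \in S -> 0 <= lo i.
Hypothesis lohi : forall i, i \in S -> lo i <= hi i.
Hypothesis hil : forall i, i \in S -> ((hi i)%:E <= edge_length (ed i))%E.
(* On each edge, [phi] is piecewise affine, with slope [k i] on [[lo i, hi i]]. *)
Hypothesis phiE : forall e x,
  on_edge phi e x = C e + \sum_(i <- S | ed i == e) k i * clamp (lo i) (hi i) x.
Hypothesis phi0 : forall q, 0 <= phi q.
Hypothesis phi_le : forall e x, edge_interior e x ->
  on_edge phi e x <= \sum_(i <- S | ed i == e) \1_(`[lo i, hi i]%classic : set R) x.
Implicit Types (e : edge G) (i : I).

Let op i : set R := `]lo i, hi i[.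
Let cl i : set R := `[lo i, hi i] `&` edge_interior (ed i).
Let grad z := \sum_(i <- S) k i * piece (ed i) (op i) z.
(** An L^2 majorant of [phi]: it makes [phi] square-integrable and bounds [lform u phi]. The pieces
    [cl] are cut to the open edges so that it vanishes off [bundle_supp]. *)
Let bnd z := \sum_(i <- S) piece (ed i) (cl i) z.

Let op_int i : i \in S -> op i `<=` edge_interior (ed i).
Proof.
move=> iS x; rewrite /op /edge_interior/= in_itv/= => /andP[x1 x2].
rewrite (le_lt_trans (lo0 iS) x1)/=; apply: lt_le_trans (hil iS).
by rewrite lte_fin.
Qed.

Let op_cl i : op i `<=` `[lo i, hi i].
Proof. exact: subset_itvW. Qed.

Let m_op i : measurable (op i).
Proof. exact: measurable_itv. Qed.

Let m_cl i : measurable (cl i).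
Proof. by apply: measurableI; [exact: measurable_itv|exact: edge_interior_measurable]. Qed.

Let sqi_op i : i \in S -> sqi bmu (piece (ed i) (op i)).
Proof. by move=> iS; apply: (piece_sqi (m_op i) (op_int iS) (@op_cl i)). Qed.

Let sqi_cl i : i \in S -> sqi bmu (piece (ed i) (cl i)).
Proof. by move=> iS; apply: (@piece_sqi _ _ _ _ (lo i) (hi i)) => // x []. Qed.

Lemma ipZ d (T : measurableType d) (nu : {measure set T -> \bar R}) (c : R) f h :
  sqi nu f -> sqi nu h -> ip nu (fun z => c * f z) h = c * ip nu f h.
Proof.
move=> sf sh; have := ip_lin (c - 1) sf sf sh.
have -> : (fun z => (c - 1) * f z + f z) = (fun z => c * f z).
  by apply/funext => z; rewrite mulrBl mul1r subrK.
by rewrite mulrBl mul1r subrK.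
Qed.

Lemma itvint_sum (J : eqType) (s : seq J) (c : J -> R) (h : J -> R -> R) x y : x <= y ->
  (forall j, j \in s -> linteg (h j)) ->
  linteg (fun t => \sum_(j <- s) c j * h j t) /\
  itvint (fun t => \sum_(j <- s) c j * h j t) x y = \sum_(j <- s) c j * itvint (h j) x y.
Proof.
move=> xy; elim: s => [|j s IH] lh.
  have -> : (fun t : R => \sum_(j <- [::]) c j * h j t) = (fun=> 0).
    by apply/funext => t; rewrite big_nil.
  by rewrite big_nil; split; [exact: linteg_cst|rewrite itvint_cst// mul0r].
have [l1 e1] := IH (fun j' (si : j' \in s) => lh j' (@mem_behead _ (j :: s) j' si)).
have lj : linteg (h j) by apply: lh; rewrite inE eqxx.
have -> : (fun t => \sum_(i <- j :: s) c i * h i t) =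
    (fun t => c j * h j t + \sum_(j' <- s) c j' * h j' t).
  by apply/funext => t; rewrite big_cons.
by split; [exact: linteg_lin|rewrite itvint_lin// big_cons e1].
Qed.

Let sqi0 : sqi bmu (fun=> 0).
Proof.
split; first exact: measurable_cst.
by under eq_fun do rewrite expr0n; exact: integrable0.
Qed.

Let sqi_grad : sqi bmu grad.
Proof.
have sK i : i \in S -> sqi bmu (fun z => k i * piece (ed i) (op i) z).
  by move=> iS; exact: sqiZ (sqi_op iS).
by have [] := @ip_sum _ _ S _ (fun i z => k i * piece (ed i) (op i) z) sqi0 sK.
Qed.

Let sqi_bnd : sqi bmu bnd.
Proof.
by have [] := @ip_sum _ _ S _ (fun i z => piece (ed i) (cl i) z) sqi0 sqi_cl.
Qed.

Let test_weak_grad : weak_grad phi grad.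
Proof.
split; first exact: sqi_grad.
- move=> z zS; rewrite /grad big_seq big1// => i iS.
  by rewrite (piece_out (op_int iS)) ?mulr0// => -[z1 z2]; apply: zS; exists (ed i).
- move=> e x y xy; rewrite !phiE opprD addrACA subrr add0r -sumrB.
  have lp i : i \in S -> linteg (fun t => piece (ed i) (op i) (pickle e, t)).
    by move=> iS; apply: lintegZ; exact: linteg_indic.
  have [_ ->] := @itvint_sum _ S k (fun i t => piece (ed i) (op i) (pickle e, t)) x y xy lp.
  rewrite big_mkcond.
  apply: eq_big_seq => i iS /=; rewrite -mulrBr /piece /=.
  rewrite (inj_eq (pcan_inj pickleK)) eq_sym.
  rewrite itvintZ; last exact: linteg_indic.
  rewrite -(primitive_clamp (lohi iS))//.
  by case: eqP; rewrite ?mul1r// mul0r mulr0.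
Qed.

Let bval_ge0 z : 0 <= bval phi z.
Proof.
rewrite /bval /spread; case: (pickle_inv _) => [e|//].
by rewrite mulr_ge0 ?indicE//; have [q ->] := on_edgeP hG e z.2.
Qed.

Let bval_le z : bval phi z <= bnd z.
Proof.
have b0 : 0 <= bnd z.
  by apply: sumr_ge0 => i _; rewrite /piece mulr_ge0// indicE.
have [zS|zS] := pselect (bundle_supp G z); last by rewrite /bval spread_out.
case: z zS b0 => n x [e /= -> ex] _.
rewrite /bval spreadE [X in _ * X]indicE mem_set// mulr1.
apply: le_trans (phi_le ex) _; rewrite /bnd big_mkcond; apply: ler_sum => i _.
rewrite /piece /= (inj_eq (pcan_inj pickleK)) (eq_sym e).
case: eqP => [eie|_]; last by rewrite mul0r.
rewrite mul1r !indicE; case: (boolP (x \in _)) => //; rewrite inE => xi.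
by rewrite mem_set//; split => //; rewrite eie.
Qed.

Let sqi_test : sqi bmu (bval phi).
Proof.
have mb : measurable_fun setT (bval phi).
  apply: bundle_measurable_fun => n; rewrite /bval /spread /=.
  case: (pickle_inv n) => [e|]; last exact: measurable_cst.
  apply: measurable_funM; last by apply: measurable_indic; exact: edge_interior_measurable.
  have [sg pg] := weak_grad_primitive_sqi e test_weak_grad.
  by apply: continuous_measurable_fun; exact: primitive_continuous sg pg.
have [_ ib] := sqi_bnd; split => //.
apply: integrableT_bounded ib _; first exact: measurable_funX.
move=> z; rewrite ger0_norm ?sqr_ge0// ler_sqr// nnegrE ?bval_ge0//.
exact: le_trans (bval_ge0 z) (bval_le z).
Qed.

Lemma star_test_H1 : H1 phi.
Proof. exact: weak_grad_H1 sqi_test test_weak_grad. Qed.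

(** The gradient of [phi] is a constant slope on each segment, so pairing it with the gradient of u
    leaves only values of u at the ends of the segments. *)
Lemma star_test_dform u : H1 u -> dform u phi =
  \sum_(i <- S) k i * (on_edge u (ed i) (hi i) - on_edge u (ed i) (lo i)).
Proof.
move=> Hu; have [sg [_ gS gp]] : sqi bmu (gder u) /\ weak_grad u (gder u).
  by split; [exact: sqi_gder|have [] := H1_weak_grad hG Hu].
rewrite /dform ipC (dform_eq hG star_test_H1 test_weak_grad sg) ipC.
have sK i : i \in S -> sqi bmu (fun z => k i * piece (ed i) (op i) z).
  by move=> iS; exact: sqiZ (sqi_op iS).
have [_ ->] := @ip_sum _ _ S _ (fun i z => k i * piece (ed i) (op i) z) sg sK.
apply: eq_big_seq => i iS; rewrite ipC (ipZ _ (sqi_op iS) sg) ipC; congr (_ * _).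
rewrite (ip_piece (m_op i) (op_int iS) (@op_cl i) sg) (gp _ _ _ (lohi iS)).
have [sge _] := sqi_slice (pickle (ed i)) sg gS.
apply: eq_itvint_oo.
- apply: (@lintegM _ _ _ 1); first exact: sqi_linteg.
    exact: measurable_indic.
  by move=> x; rewrite indicE ger0_norm// lern1 leq_b1.
- exact: sqi_linteg.
- by move=> t ti; rewrite indicE mem_set ?mulr1//= in_itv.
Qed.

Lemma star_test_lform u (M : R) : H1 u -> (forall q, 0 <= u q) ->
  (forall i x, i \in S -> lo i <= x <= hi i -> on_edge u (ed i) x <= M) ->
  lform u phi <= \sum_(i <- S) (hi i - lo i) * M.
Proof.
move=> Hu u0 uM; have su := sqi_bval hG Hu.
have bu0 z : 0 <= bval u z.
  rewrite /bval /spread; case: (pickle_inv _) => [e|//].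
  by rewrite mulr_ge0 ?indicE//; have [q ->] := on_edgeP hG e z.2.
apply: (@le_trans _ _ (ip bmu (bval u) bnd)).
  apply: le_Rintegral => //; [exact: sqi_mul|exact: sqi_mul|].
  by move=> z _; rewrite ler_wpM2l.
have [_ ->] := @ip_sum _ _ S _ (fun i z => piece (ed i) (cl i) z) su sqi_cl.
rewrite big_seq [leRHS]big_seq; apply: ler_sum => i iS.
have cle : cl i `<=` edge_interior (ed i) by move=> x [].
have clc : cl i `<=` `[lo i, hi i] by move=> x [].
rewrite (ip_piece (m_cl i) cle clc su) mulrC -itvint_cst ?lohi//.
have [sue _] := sqi_slice (pickle (ed i)) su (@spread_out _ _ _).
apply: le_itvint => [||t ti].
- apply: (@lintegM _ _ _ 1); first exact: sqi_linteg.
    exact: measurable_indic.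
  by move=> x; rewrite indicE ger0_norm// lern1 leq_b1.
- exact: linteg_cst.
- have M0 : 0 <= M by apply: le_trans (uM i t iS ti); have [q ->] := on_edgeP hG (ed i) t.
  rewrite indicE; case: (boolP (t \in _)) => [|_]; last by rewrite mulr0.
  rewrite inE => -[_ te]; rewrite mulr1 /bval spreadE indicE mem_set// mulr1.
  exact: uM.
Qed.

End StarTest.

(** * Vanishing of a nonnegative supersolution near a zero *)

Section StrongMaximum.
Variables (R : realType) (G : metric_graph R).
Hypothesis hG : class_G G.
Variables (Z : set (vertex G)) (lam : R) (u : graph_point G -> R).
Hypothesis Hu : H1 u.
Hypothesis u0 : forall q, 0 <= u q.
Hypothesis super : forall v, H1Z Z v -> (forall q, 0 <= v q) -> 0 <= dform u v + lam * lform u v.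
Implicit Types (e : edge G) (x h : R).

Let on_edge_ge0 e x : 0 <= on_edge u e x.
Proof. by have [q ->] := on_edgeP hG e x. Qed.

Let on_edge_cont e : continuous (on_edge u e).
Proof. by apply: on_edge_continuous => //; case: Hu. Qed.

(* At its maximum over [[0, h1]] the sum of the [w i] is at most [L * h1 ^ 2 * size S < 1]
   times itself. *)
Lemma star_vanish (J : eqType) (S : seq J) (w : J -> R -> R) (L h1 : R) :
  (forall i, i \in S -> continuous (w i)) -> (forall i t, i \in S -> 0 <= w i t) ->
  (forall i, i \in S -> w i 0 = 0) -> 0 < h1 -> 0 <= L -> L * h1 ^+ 2 * (size S)%:R < 1 ->
  (forall h M, 0 < h -> h <= h1 -> 
    (forall i t, i \in S -> 0 <= t <= h -> w i t <= M) ->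
    \sum_(i <- S) w i h <= L * h * (h * (size S)%:R * M)) ->
  forall i t, i \in S -> 0 <= t <= h1 -> w i t = 0.
Proof.
move=> cw w0 wc h10 L0 small main.
pose m t := \sum_(i <- S) w i t.
have wm i t : i \in S -> w i t <= m t.
  move=> iS; rewrite /m big_seq (big_rem i)//= iS lerDl big_seq_cond.
  by apply: sumr_ge0 => j /andP[/mem_rem jS _]; exact: w0.
have cm : continuous m.
  have cs s : {subset s <= S} -> continuous (fun t => \sum_(i <- s) w i t).
    elim: s => [_|i s IH sS].
      by under eq_fun do rewrite big_nil; exact: cst_continuous.
    under eq_fun do rewrite big_cons.
    move=> x; apply: continuousD; first by apply: cw; apply: sS; rewrite inE eqxx.
    by apply: IH => j js; apply: sS; rewrite inE js orbT.
  exact: cs.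
have [c] := @EVT_max R m 0 h1 (ltW h10) (continuous_subspaceT cm).
rewrite in_itv/= => /andP[c0 c1] mc.
have mle t : 0 <= t <= h1 -> m t <= m c by move=> t1; apply: mc; rewrite in_itv.
have mc0 : m c <= 0.
  have [c0'|c0'] := eqVneq c 0.
    by rewrite c0' /m big_seq big1// => i iS; exact: wc.
  have cp : 0 < c by rewrite lt_neqAle eq_sym c0'.
  have := main c (m c) cp c1; rewrite -/(m c).
  have wmc i t : i \in S -> 0 <= t <= c -> w i t <= m c.
    move=> iS /andP[t0 tc]; apply: le_trans (wm i t iS) _.
    by apply: mle; rewrite t0 (le_trans tc c1).
  move=> /(_ wmc); case: (leP (m c) 0) => // mp H.
  have : L * c * (c * (size S)%:R * m c) <= L * h1 ^+ 2 * (size S)%:R * m c.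
    have -> : L * c * (c * (size S)%:R * m c) = L * c ^+ 2 * (size S)%:R * m c by ring.
    apply: ler_wpM2r; first exact: ltW.
    apply: ler_wpM2r; first exact: ler0n.
    by apply: ler_wpM2l => //; rewrite ler_sqr// nnegrE ltW.
  move=> /(le_trans H); rewrite -ler_pdivrMr// divff ?gt_eqF// leNgt small//.
move=> i t iS t1; apply/eqP; rewrite eq_le w0// andbT.
exact: le_trans (wm i t iS) (le_trans (mle t t1) mc0).
Qed.

Section Ends.
Variables (J : eqType) (S : seq J) (ed : J -> edge G) (c : J -> R) (b : J -> bool) (h1 : R).
(** End [i] is the segment of length h on the edge [ed i] issuing from the coordinate [c i] of the
    zero, backwards if [b i] holds and forwards otherwise. *)
Let lo h i := if b i then c i - h else c i.
Let hi h i := if b i then c i else c i + h.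
Let k h i := if b i then h^-1 else - h^-1.
Hypothesis h10 : 0 < h1.
Hypothesis in_lo : forall i, i \in S -> 0 <= lo h1 i.
Hypothesis in_hi : forall i, i \in S -> ((hi h1 i)%:E <= edge_length (ed i))%E.
Hypothesis test : forall h, 0 < h -> h <= h1 -> exists (phi : graph_point G -> R) C,
  [/\ forall e x, on_edge phi e x =
        C e + \sum_(i <- S | ed i == e) k h i * clamp (lo h i) (hi h i) x,
      forall q, 0 <= phi q,
      forall e x, edge_interior e x ->
        on_edge phi e x <= \sum_(i <- S | ed i == e) \1_(`[lo h i, hi h i]%classic : set R) x
    & forall q, vertex_points Z q -> phi q = 0].
Hypothesis center : forall i, i \in S -> on_edge u (ed i) (c i) = 0.

Lemma ends_vanish : exists2 h, 0 < h &
  forall i t, i \in S -> 0 <= t <= h -> on_edge u (ed i) (if b i then c i - t else c i + t) = 0.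
Proof.
(* With r <= 1 and r <= 1 / (|lam| n + 1), one gets |lam| r^2 n <= |lam| n r < 1, the smallness that
   [star_vanish] asks for. *)
pose n : R := (size S)%:R; pose r := Num.min h1 (Num.min 1 (`|lam| * n + 1)^-1).
have n0 : 0 <= n by exact: ler0n.
have ln0 : 0 <= `|lam| * n by rewrite mulr_ge0.
have p0 : 0 < `|lam| * n + 1 by rewrite ltr_wpDl.
have r0 : 0 < r by rewrite !lt_min h10 ltr01/= invr_gt0.
have rh : r <= h1 by rewrite ge_min lexx.
have r1 : r <= 1 by rewrite !ge_min lexx orbT.
have rl : r <= (`|lam| * n + 1)^-1 by rewrite !ge_min lexx !orbT.
exists r => //.
apply: (@star_vanish _ _ (fun i t => on_edge u (ed i) (if b i then c i - t else c i + t)) `|lam|) => //.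
- move=> i iS x; case: (b i).
    apply: (@continuous_comp _ _ _ (fun t => c i - t) (on_edge u (ed i))); last exact: on_edge_cont.
    by apply: cvgB; [exact: cvg_cst|exact: cvg_id].
  apply: (@continuous_comp _ _ _ (fun t => c i + t) (on_edge u (ed i))); last exact: on_edge_cont.
  by apply: cvgD; [exact: cvg_cst|exact: cvg_id].
- by move=> i iS; rewrite subr0 addr0; case: (b i); exact: center.
- have E : `|lam| * r ^+ 2 * n <= `|lam| * n * r.
    have -> : `|lam| * r ^+ 2 * n = `|lam| * n * (r * r) by ring.
    by apply: ler_wpM2l => //; apply: ler_piMr => //; exact: ltW.
  apply: le_lt_trans E _; apply: le_lt_trans (ler_wpM2l ln0 rl) _.
  by rewrite ltr_pdivrMr// mul1r ltrDl.
move=> h M h0 hr Mb; have hh1 := le_trans hr rh.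
have [phi [C [phiE phi0 phile phiZ]]] := test h0 hh1.
have lo0 i : i \in S -> 0 <= lo h i.
  move=> iS; apply: le_trans (in_lo iS) _; rewrite /lo; case: (b i) => //.
  by rewrite lerD2l lerN2.
have lohi i : i \in S -> lo h i <= hi h i.
  by move=> iS; rewrite /lo /hi; case: (b i); rewrite ?gerBl ?lerDl ltW.
have hil i : i \in S -> ((hi h i)%:E <= edge_length (ed i))%E.
  move=> iS; apply: le_trans (in_hi iS); rewrite lee_fin /hi; case: (b i) => //.
  by rewrite lerD2l.
have Hphi := star_test_H1 hG lo0 lohi hil phiE phi0 phile.
have dE := star_test_dform hG lo0 lohi hil phiE phi0 phile Hu.
have Mb' i x : i \in S -> lo h i <= x <= hi h i -> on_edge u (ed i) x <= M.
  move=> iS; have := Mb i; rewrite /lo /hi; case: (b i) => Mbi /andP[x1 x2].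
    have -> : x = c i - (c i - x) by ring.
    by apply: Mbi => //; rewrite subr_ge0 x2 lerBlDr addrC -lerBlDr.
  have -> : x = c i + (x - c i) by ring.
  by apply: Mbi => //; rewrite subr_ge0 x1 lerBlDr addrC.
have lE := star_test_lform hG lo0 lohi hil phiE phi0 phile Hu u0 Mb'.
have := super (conj Hphi phiZ) phi0; rewrite dE.
have lsum : \sum_(i <- S) (hi h i - lo h i) * M = h * n * M.
  rewrite -mulr_suml; congr (_ * M).
  rewrite (eq_bigr (fun=> h)); first by rewrite big_const_seq count_predT iter_addr_0 mulr_natr.
  by move=> i _; rewrite /lo /hi; case: (b i); ring.
(* Since u vanishes at the centre, each end contributes only its outer value, with slope -1 / h away
   from the centre in both orientations. *)
have dsum : \sum_(i <- S) k h i * (on_edge u (ed i) (hi h i) - on_edge u (ed i) (lo h i)) =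
    - h^-1 * \sum_(i <- S) on_edge u (ed i) (if b i then c i - h else c i + h).
  rewrite mulr_sumr; apply: eq_big_seq => i iS; rewrite /k /lo /hi; have := center iS.
  by case: (b i) => ->; ring.
rewrite dsum => sup.
have l0 : 0 <= lform u phi.
  apply: Rintegral_ge0 => z _; apply: mulr_ge0.
    rewrite /bval /spread; case: (pickle_inv _) => [e|//].
    by rewrite mulr_ge0 ?indicE.
  rewrite /bval /spread; case: (pickle_inv _) => [e|//].
  by rewrite mulr_ge0 ?indicE//; have [q ->] := on_edgeP hG e z.2.
have l1 : lam * lform u phi <= `|lam| * (h * n * M).
  apply: le_trans (ler_wpM2r l0 (ler_norm lam)) _.
  by apply: ler_wpM2l => //; rewrite -lsum.
have : h^-1 * \sum_(i <- S) on_edge u (ed i) (if b i then c i - h else c i + h) <= `|lam| * (h * n * M).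
  by apply: le_trans l1; rewrite -subr_ge0 addrC -mulNr.
by rewrite ler_pdivrMl// mulrCA mulrA.
Qed.

End Ends.

End StrongMaximum.

From mathcomp Require Import finmap all_classical.

(** * Half tents *)

Section Hats.
Variables (R : realType).
Implicit Types (b : bool) (c h x : R).

(* One half of a tent of half-width [h] centered at [c], extended by 1 on the other side. *)
Definition hat b c h x : R := if b then (1 - c / h) + h^-1 * clamp (c - h) c x
  else (1 + c / h) + - h^-1 * clamp c (c + h) x.

Lemma hat1 b c h x : 0 < h -> (if b then c <= x else x <= c) -> hat b c h x = 1.
Proof.
move=> h0; rewrite /hat; case: b => xc.
  by rewrite clamp_ge// ?gerBl ?(ltW h0)// (mulrC _ c) subrK.
by rewrite clamp_le// ?lerDl ?(ltW h0)// mulNr (mulrC _ c) addrK.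
Qed.

Lemma hat0 b c h x : 0 < h -> (if b then x <= c - h else c + h <= x) -> hat b c h x = 0.
Proof.
move=> h0; have hn : h != 0 by rewrite gt_eqF.
rewrite /hat; case: b => xc.
  by rewrite clamp_le// ?gerBl ?(ltW h0)//; field.
by rewrite clamp_ge// ?lerDl ?(ltW h0)//; field.
Qed.

Lemma hat_mid b c h x : 0 < h -> (if b then c - h <= x <= c else c <= x <= c + h) ->
  hat b c h x = 1 - (if b then c - x else x - c) / h.
Proof.
move=> h0; have hn : h != 0 by rewrite gt_eqF.
by rewrite /hat; case: b => /andP[x1 x2]; rewrite clamp_id//; field.
Qed.

Lemma hat_bounds b c h x : 0 < h -> 0 <= hat b c h x <= 1.
Proof.
move=> h0; have hn : h != 0 by rewrite gt_eqF.
have main (t : R) : 0 <= t -> t <= h -> 0 <= 1 - t / h <= 1.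
  move=> t0 th; rewrite subr_ge0 ler_pdivrMr// mul1r th/= gerBl.
  by rewrite divr_ge0// ltW.
case: b.
  have [x1|x1] := leP x (c - h); first by rewrite hat0// lexx ler01.
  have [x2|x2] := leP c x; first by rewrite hat1// lexx ler01.
  rewrite hat_mid ?(ltW x1) ?(ltW x2)//; apply: main.
    by rewrite subr_ge0 ltW.
  by rewrite lerBlDr -lerBlDl ltW.
have [x1|x1] := leP x c; first by rewrite hat1// lexx ler01.
have [x2|x2] := leP (c + h) x; first by rewrite hat0// lexx ler01.
rewrite hat_mid ?(ltW x1) ?(ltW x2)//; apply: main.
  by rewrite subr_ge0 ltW.
by rewrite lerBlDr addrC ltW.
Qed.

Lemma hat_out b c h x : 0 < h ->
  (if b then x <= c else c <= x) ->
  hat b c h x <= \1_(`[if b then c - h else c, if b then c else c + h]%classic : set R) x.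
Proof.
move=> h0 xc; rewrite indicE; case: (boolP (x \in _)) => [_|].
  by have /andP[] := hat_bounds b c x h0.
rewrite notin_setE/= in_itv/= => /negP; rewrite negb_and -!ltNge => xo.
rewrite hat0//; case: b xc xo => xc /orP[] xo.
- exact: ltW.
- by move: xc; rewrite leNgt xo.
- by move: xc; rewrite leNgt xo.
- exact: ltW.
Qed.

End Hats.

Arguments hat : simpl never.

(** * Graph functions assembled from vertex values and edge profiles *)

Section PointFunctions.
Variables (R : realType) (G : metric_graph R).
Hypothesis hG : class_G G.

Lemma on_edge_val (psi : vertex G + edge G * R -> R) e x :
  on_edge (fun q => psi (val q)) e x = psi (edge_coord e x).
Proof. by rewrite /on_edge (insubT _ (edge_coordP e x hG)) SubK. Qed.

Lemma on_edge_coord (u : graph_point G -> R) (q : graph_point G) e x :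
  val q = edge_coord e x -> on_edge u e x = u q.
Proof. by rewrite /on_edge => <-; rewrite valK. Qed.

Definition glue (delta : vertex G -> R) (A : edge G -> R -> R) (q : graph_point G) : R :=
  match val q with inl w => delta w | inr (e, x) => A e x end.

Lemma on_edge_glue delta A : (forall e x, x <= 0 -> A e x = delta (origin e)) ->
  (forall e x, (edge_length e <= x%:E)%E -> A e x = delta (terminus e)) ->
  forall e x, on_edge (glue delta A) e x = A e x.
Proof.
move=> A0 Al e x.
rewrite (on_edge_val (fun q => match q with inl w => delta w | inr (e, x) => A e x end)).
rewrite /edge_coord; case: ifPn => [/A0 -> //|_]; case: ifPn => [/Al -> //|_ //].
Qed.

End PointFunctions.

(** * The zero set of a nonnegative supersolution, on an edge and around a vertex *)

Section ZeroSet.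
Variables (R : realType) (G : metric_graph R).
Hypothesis hG : class_G G.
Variables (Z : set (vertex G)) (lam : R) (u : graph_point G -> R).
Hypothesis Hu : H1 u.
Hypothesis u0 : forall q, 0 <= u q.
Hypothesis super : forall v, H1Z Z v -> (forall q, 0 <= v q) -> 0 <= dform u v + lam * lform u v.
Implicit Types (e : edge G) (x h : R).

(** An interior point is the centre of a star with two ends on the same edge, one in each direction;
    its tent is the sum of the two half tents minus 1. *)
Lemma interior_zero_nbhs e x0 : edge_interior e x0 -> on_edge u e x0 = 0 ->
  exists2 h, 0 < h & forall t, `|t| <= h -> on_edge u e (x0 + t) = 0.
Proof.
move=> /andP[x0p x0l] ux0.
have [h1 h10 [h1x h1l]] : exists2 h1, 0 < h1 & 0 <= x0 - h1 /\ ((x0 + h1)%:E <= edge_length e)%E.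
  case: (edge_length e) x0l => [r| |]//.
    rewrite lte_fin => xr; exists (Num.min x0 (r - x0)).
      by rewrite lt_min x0p subr_gt0.
    by rewrite lee_fin -lerBrDl subr_ge0 !ge_min !lexx orbT.
  by move=> _; exists x0 => //; rewrite subrr lexx leey.
have [||||h h0 hz] := @ends_vanish _ _ hG Z lam u Hu u0 super bool [:: false; true]
    (fun=> e) (fun=> x0) id h1 h10.
- by case=> _ //=; exact: ltW.
- by case=> _ //=; rewrite (le_trans _ h1l)// lee_fin lerDl ltW.
- move=> h h0 hh1.
  have hx : 0 <= x0 - h by apply: le_trans h1x _; rewrite lerD2l lerN2.
  have hl : ((x0 + h)%:E <= edge_length e)%E by apply: le_trans h1l; rewrite lee_fin lerD2l.
  pose A (e' : edge G) x := if e == e' then hat false x0 h x + hat true x0 h x - 1 else 0.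
  have Age e' x : 0 <= A e' x.
    rewrite /A; case: ifP => // _; have [x1|x1] := leP x x0.
      by rewrite hat1// addrAC subrr add0r; have /andP[] := hat_bounds true x0 x h0.
    rewrite (@hat1 _ true) ?(ltW x1)// addrK.
    by have /andP[] := hat_bounds false x0 x h0.
  have Ale e' x : x <= 0 -> A e' x = 0.
    move=> xle; rewrite /A; case: ifP => // _.
    rewrite (@hat0 _ true)//; last exact: le_trans xle hx.
    by rewrite hat1 ?addr0 ?subrr// (le_trans xle)// ltW.
  have Agl e' x : (edge_length e' <= x%:E)%E -> A e' x = 0.
    rewrite /A; case: eqP => // <- xl.
    have xh : x0 + h <= x by rewrite -lee_fin (le_trans hl).
    rewrite (@hat0 _ false)// hat1 ?add0r ?subrr//.
    by apply: le_trans xh; rewrite lerDl ltW.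
  have phiE := @on_edge_glue _ _ hG (fun=> 0) A Ale Agl.
  (* The constants 1 + x0 / h and 1 - x0 / h of the half tents, less 1, leave 1 on the edge [e]. *)
  exists (glue (fun=> 0) A), (fun e' => if e == e' then 1 else 0); split.
  + move=> e' x; rewrite phiE /A /hat !big_cons big_nil /=.
    case: ifP => _; last by rewrite addr0.
    ring.
  + by move=> q; rewrite /glue; case: (val q) => [//|[e' x]].
  + move=> e' x ex; rewrite phiE /A !big_cons big_nil /=.
    case: ifP => // _; rewrite addr0.
    have [x1|x1] := leP x x0.
      rewrite (@hat1 _ false)// addrAC subrr add0r.
      apply: le_trans (@hat_out _ true x0 h x h0 x1) _.
      by rewrite lerDr indicE.
    rewrite (@hat1 _ true) ?(ltW x1)// addrK.
    apply: le_trans (@hat_out _ false x0 h x h0 (ltW x1)) _.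
    by rewrite lerDl indicE.
  + by move=> q [w _ qw]; rewrite /glue qw.
- by [].
exists h => // t; rewrite ler_norml => /andP[t1 t2].
have [t0|t0] := leP 0 t.
  by apply: (hz false) => //; rewrite t0.
by have := hz true (- t); rewrite opprK; apply => //; rewrite oppr_ge0 (ltW t0) lerNl.
Qed.

(** In the connected open edge the zero set is closed by continuity and open by
    [interior_zero_nbhs]; the end values follow by continuity, and [on_edge] is constant beyond the
    ends. *)
Lemma edge_vanish e x0 : edge_interior e x0 -> on_edge u e x0 = 0 -> forall y, on_edge u e y = 0.
Proof.
move=> ex0 ux0.
have cu : continuous (on_edge u e) by apply: on_edge_continuous => //; case: Hu.
have E : [set x | edge_interior e x /\ on_edge u e x = 0] = edge_interior e.
  have /connected_intervalP ci : is_interval (edge_interior e).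
    move=> x y /andP[xp xl] /andP[yp yl] z /andP[xz zy].
    by rewrite /edge_interior/= (lt_le_trans xp xz)/= (le_lt_trans _ yl)// lee_fin.
  apply: ci.
  - by exists x0.
  - exists ((on_edge u e @^-1` [set 0])^°); first exact: open_interior.
    apply/seteqP; split => x [ex ux]; split => //; last exact: interior_subset ux.
    have [h h0 hz] := interior_zero_nbhs ex ux.
    exists h => //= y /= xy; rewrite -(subrKC x y); apply: hz.
    by rewrite distrC ltW.
  - exists (on_edge u e @^-1` [set 0]); last by apply/seteqP; split.
    by apply: closed_comp; [move=> x _; exact: cu|exact: closed_eq].
have int y : edge_interior e y -> on_edge u e y = 0 by rewrite -E => -[].
have lim y : (forall eps, 0 < eps -> exists2 x, edge_interior e x & `|y - x| < eps) -> on_edge u e y = 0.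
  move=> dy; apply: contrapT => /eqP uy.
  have := cu y; move=> /cvgrPdist_lt /(_ `|on_edge u e y|); rewrite normr_gt0 => /(_ uy).
  move=> [eps /= eps0 be]; have [x ex xy] := dy eps eps0.
  by have := be x xy; rewrite /= (int x ex) subr0 ltxx.
have [l l0 le] := edge_length_inf hG.
have half (a : R) : 0 < a -> a / 2 < a by move=> a0; rewrite ltr_pdivrMr// mulr_natr mulr2n ltrDl.
move=> y; have [y0|y0] := leP y 0.
  rewrite on_edge_le0//; apply: lim => eps eps0; exists (Num.min (eps / 2) (l / 2)).
    rewrite /edge_interior/= lt_min !divr_gt0//=; apply: lt_le_trans (le e).
    by rewrite lte_fin gt_min (half l l0) orbT.
  rewrite sub0r normrN gtr0_norm ?lt_min ?divr_gt0//.
  by rewrite gt_min (half eps eps0).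
have [yl|yl] := ltP y%:E (edge_length e); first by apply: int; rewrite /edge_interior/= y0.
case E' : (edge_length e) yl => [r| |]; last 2 first.
- by rewrite leye_eq.
- by have := edge_length_gt0 hG e; rewrite E'.
rewrite lee_fin => ry; rewrite (on_edge_ge hG u E' ry).
have r0 : 0 < r by have := edge_length_gt0 hG e; rewrite E' lte_fin.
apply: lim => eps eps0; have m0 : 0 < Num.min (eps / 2) (r / 2) by rewrite lt_min !divr_gt0.
have mr : Num.min (eps / 2) (r / 2) < r.
  by rewrite gt_min (half r r0) orbT.
exists (r - Num.min (eps / 2) (r / 2)).
  by rewrite /edge_interior/= subr_gt0 mr E' lte_fin gtrBl.
rewrite opprB addrC subrK gtr0_norm//.
by rewrite gt_min (half eps eps0).
Qed.

(** The star consists of all edge ends at v, finitely many. As v is not in Z, the tent of height 1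
    at v is admissible. Once u vanishes on a short segment from v, [edge_vanish] covers the rest of
    the edge. *)
Lemma vertex_zero_edge v (q : graph_point G) e : val q = inl v -> ~ Z v -> finite_set (incident_ends v) ->
  u q = 0 -> origin e = v \/ terminus e = v -> forall y, on_edge u e y = 0.
Proof.
move=> qv nZ finv uq inc.
have vfin : ~ infinity_vertices v.
  by move=> vi; have := valP q; rewrite qv /= notin_setE.
have [l l0 le] := edge_length_inf hG.
pose len e' : R := fine (edge_length e').
have lenE e' : terminus e' = v -> (len e')%:E = edge_length e'.
  move=> tv; apply: fineK; have := edge_length_gt0 hG e'.
  case E : (edge_length e') => //= _; exfalso; apply: vfin; exists e' => //.
have llen e' : terminus e' = v -> l <= len e' by move=> tv; rewrite -lee_fin lenE.
pose S : seq (edge G * bool) := finmap.enum_fset (fset_set (incident_ends v)).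
have SE d : (d \in S) = ((if d.2 then terminus d.1 else origin d.1) == v).
  by rewrite -[_ \in S]/(d \in fset_set (incident_ends v)) in_fset_set//; apply/idP/eqP; rewrite inE.
pose c (d : edge G * bool) : R := if d.2 then len d.1 else 0.
have hl : l / 2 < l by rewrite ltr_pdivrMr// mulr_natr mulr2n ltrDl.
have h10 : 0 < l / 2 by rewrite divr_gt0.
(* At most two ends of an edge lie at v, and both do exactly when the edge is a loop at v. *)
have sumS e' (X : edge G * bool -> R) : \sum_(d <- S | d.1 == e') X d =
    (if origin e' == v then X (e', false) else 0) + (if terminus e' == v then X (e', true) else 0).
  rewrite -big_filter (perm_big [seq d <- [:: (e', false); (e', true)] | d \in S]).
    rewrite big_filter !big_cons big_nil !SE /=.
    by case: ifP => _; case: ifP => _; rewrite ?addr0 ?add0r.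
  apply: uniq_perm.
  - by rewrite filter_uniq// /S finmap.fset_uniq.
  - by rewrite filter_uniq//= inE andbT; apply/eqP => -[].
  - move=> [e2 b2]; rewrite !mem_filter !inE /= !xpair_eqE.
    by rewrite andbC; case: (_ \in S) => //=; case: (e2 == e'); case: b2.
have [||||h h0 hz] := @ends_vanish _ _ hG Z lam u Hu u0 super _ S
    (fun d => d.1) c (fun d => d.2) (l / 2) h10.
- case=> e' [] dS; rewrite /c//=.
  by move: dS; rewrite SE /= => /eqP tv; rewrite subr_ge0 (le_trans (ltW hl))// llen.
- case=> e' [] dS; rewrite /c//=; first by move: dS; rewrite SE /= => /eqP tv; rewrite lenE.
  by rewrite add0r (le_trans _ (le e'))// lee_fin ltW.
- move=> h h0 hh1.
  have hl' : h < l by exact: le_lt_trans hh1 hl.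
  (* On a loop both half tents are present. As h < l, each is 0 at the opposite end of the edge, so
     the value at v is 1 and not 2, and the profile matches the vertex values. *)
  pose A (e' : edge G) x := (if origin e' == v then hat false 0 h x else 0) +
    (if terminus e' == v then hat true (len e') h x else 0).
  have Age e' x : 0 <= A e' x.
    by rewrite /A addr_ge0//; case: ifP => // _;
      [have /andP[] := hat_bounds false 0 x h0|have /andP[] := hat_bounds true (len e') x h0].
  have Ale e' x : x <= 0 -> A e' x = (origin e' == v)%:R.
    move=> xle; rewrite /A hat1//; case: eqP => _; case: eqP => tv; rewrite ?addr0 ?hat0 ?addr0//.
      by rewrite (le_trans xle)// subr_ge0 (le_trans (ltW hl'))// llen.
    by rewrite (le_trans xle)// subr_ge0 (le_trans (ltW hl'))// llen.
  have Agl e' x : (edge_length e' <= x%:E)%E -> A e' x = (terminus e' == v)%:R.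
    move=> xl; have hx : h <= x.
      by rewrite -lee_fin (le_trans _ xl)// (le_trans _ (le e'))// lee_fin ltW.
    rewrite /A (@hat0 _ false)// ?add0r//; case: eqP => _; rewrite add0r; case: eqP => tv//.
      by rewrite hat1// -lee_fin lenE.
    by rewrite hat1// -lee_fin lenE.
  have phiE := @on_edge_glue _ _ hG (fun w => (w == v)%:R) A Ale Agl.
  exists (glue (fun w => (w == v)%:R) A), (fun e' => (if origin e' == v then 1 else 0) +
     (if terminus e' == v then 1 - len e' / h else 0)); split.
  + move=> e' x; rewrite phiE /A sumS /c /hat /=.
    by case: ifP => _; case: ifP => _; rewrite ?mul0r ?addr0; ring.
  + by move=> p; rewrite /glue; case: (val p) => [w|[e' x]].
  + move=> e' x /andP[x0 xl]; rewrite phiE /A sumS /c /=.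
    apply: lerD; case: ifP => // /eqP tv.
      exact: (@hat_out _ false 0 h x h0 (ltW x0)).
    by apply: (@hat_out _ true (len e') h x h0); rewrite -lee_fin lenE// ltW.
  + move=> p [w Zw pw]; rewrite /glue pw; case: eqP => // wv.
    by move: Zw; rewrite wv.
- case=> e' [] dS; move: (dS); rewrite SE /c /= => /eqP tv.
    rewrite (@on_edge_coord _ _ u q)// qv /edge_coord lenE// lexx leNgt.
    by rewrite (lt_le_trans l0)// ?llen//= tv.
  by rewrite (@on_edge_coord _ _ u q)// qv /edge_coord lexx tv.
pose t := Num.min h (l / 2).
have t0 : 0 < t by rewrite lt_min h0.
have th : t <= h by rewrite ge_min lexx.
have tl : t < l by rewrite (le_lt_trans _ hl)// ge_min lexx orbT.
case: inc => ev.
  apply: (@edge_vanish e t).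
    by rewrite /edge_interior/= t0 (lt_le_trans _ (le e))// lte_fin.
  by have := hz (e, false) t; rewrite SE /= ev eqxx /c /= add0r => -> //; rewrite ltW.
apply: (@edge_vanish e (len e - t)).
  by rewrite /edge_interior/= subr_gt0 (lt_le_trans tl) ?llen//= -lenE// lte_fin gtrBl.
by have := hz (e, true) t; rewrite SE /= ev eqxx /c /= => -> //; rewrite ltW.
Qed.

End ZeroSet.

(** * Propagation of zeros along the graph *)

Section StrictPositivity.
Variables (R : realType) (G : metric_graph R).
Hypothesis hG : class_G G.
Variable e0 : edge G.
Variables (Z : set (vertex G)) (lam : R) (u : graph_point G -> R).
Hypothesis hZ : forall v, Z v -> vertex_degree v = 1%N.
Hypothesis Hu : H1 u.
Hypothesis u0 : forall q, 0 <= u q.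
Hypothesis super : forall v, H1Z Z v -> (forall q, 0 <= v q) -> 0 <= dform u v + lam * lform u v.
Implicit Types (e : edge G) (v w : vertex G).

Let incident e v := origin e = v \/ terminus e = v.
Let null_at v := forall e, incident e v -> forall y, on_edge u e y = 0.

Lemma degree1_edge v e e' : vertex_degree v = 1%N ->
  incident e v -> incident e' v -> e = e'.
Proof.
have [_ fin _ _] := hG.
rewrite /vertex_degree => /eqP /finmap.cardfs1P [d0 E].
have mem d : incident_ends v d -> d = d0.
  by move=> vd; apply/eqP; rewrite -finmap.in_fset1 -E in_fset_set ?inE.
have inc e1 : incident e1 v -> e1 = d0.1.
  case=> ev; first by rewrite -(mem (e1, false)).
  by rewrite -(mem (e1, true)).
by move=> /inc -> /inc ->.
Qed.

(** No tent is available at vertices of Z or at infinity, but these have degree 1, so the given edge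
    is the only one there. At any other vertex u is 0 by the values on that edge, and
    [vertex_zero_edge] applies. *)
Lemma null_edge_spread e v : incident e v -> (forall y, on_edge u e y = 0) -> null_at v.
Proof.
have [_ fin _ deg1] := hG.
move=> ev ez e' e'v.
have [v1|v1] := eqVneq (vertex_degree v) 1%N.
  by rewrite (degree1_edge v1 e'v ev).
have nZ : ~ Z v by move=> /hZ /eqP; apply/negP.
have nI : ~ infinity_vertices v.
  by move=> [e1 l1 tv]; move: v1; rewrite -tv deg1// eqxx.
have ip : is_point (inl v : vertex G + edge G * R) by rewrite /= notin_setE.
pose q : graph_point G := exist _ (inl v) ip.
have uq : u q = 0.
  case: ev => ev.
    rewrite -(ez 0); apply/esym/on_edge_coord.
    by rewrite /= /edge_coord lexx ev.
  have := edge_length_gt0 hG e; case E : (edge_length e) => [r| |]// r0; last first.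
    by exfalso; apply: nI; exists e.
  rewrite -(ez r); apply/esym/on_edge_coord; rewrite /= /edge_coord E lexx leNgt.
  by move: r0; rewrite lte_fin => ->; rewrite ev.
exact: (@vertex_zero_edge _ _ hG Z lam u Hu u0 super v q e' erefl nZ (fin v) uq e'v).
Qed.

Lemma supersolution_positive q : u <> cst 0 -> ~ vertex_points Z q -> 0 < u q.
Proof.
have [conn fin _ _] := hG.
move=> un0 qZ; rewrite lt_neqAle u0 andbT eq_sym; apply/eqP => uq; apply: un0.
have [v0 null0] : exists v, null_at v.
  case vq : (val q) => [v|[e x]].
    exists v => e ev; apply: (@vertex_zero_edge _ _ hG Z lam u Hu u0 super v q) => //.
    by move=> Zv; apply: qZ; exists v.
  have ex : edge_interior e x by have := valP q; rewrite vq.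
  exists (origin e); apply: (@null_edge_spread e); first by left.
  apply: (edge_vanish hG Hu u0 super ex); rewrite -uq; apply: on_edge_coord.
  by rewrite vq /edge_coord; case/andP: ex => x0 xl; rewrite leNgt x0 leNgt xl.
have spread v w : Relation_Operators.clos_refl_sym_trans (vertex G) (@Defs.adjacent R G) v w ->
    null_at v <-> null_at w.
  elim=> {v w} [v w [e [ov tw]]|v|v w _ IH|v w z _ IH1 _ IH2] //.
  - split=> nv; apply: (@null_edge_spread e); try by [left|right].
      by apply: nv; left.
    by apply: nv; right.
  - by rewrite IH.
  - by rewrite IH1.
have nall v : null_at v by apply/(spread v0 v (conn v0 v)).
apply/funext => p; have [e [x E]] := graph_point_on_edge hG e0 p.
by rewrite -E; apply: (nall (origin e)); left.
Qed.

End StrictPositivity.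

(** * The action functional on a metric graph *)

Section GraphAction.
Variables (R : realType) (G : metric_graph R) (p lam : R) (Z : set (vertex G)).
Hypothesis p2 : 2 < p.
Hypothesis hG : class_G G.
Variable e0 : edge G.
Hypothesis hlambda : (- omega_Z Z < lam%:E)%E.
Local Notation bmu := (@bmu R).
Local Notation H := (H1Z Z).
Local Notation P := (@normLp_pow R G p).
Local Notation posp u := (fun q => Num.max (u q) 0).
Local Notation negp u := (fun q => Num.min (u q) 0).
Implicit Types (u v w : graph_point G -> R).

(** The added 1 avoids a square root: x^2 <= t implies |x| <= t + 1. *)
Lemma h1_bound : exists2 C : R, 0 < C & forall u q M, H1 u -> h1sq u <= M -> `|u q| <= C * M + 1.
Proof.
have [C C0 hC] := sup_norm_bound hG e0; exists C => // u q M Hu uM.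
have h0 : 0 <= h1sq u by rewrite addr_ge0 ?ip_ge0.
have M0 : 0 <= M := le_trans h0 uM.
have CM : 0 <= C * M by rewrite mulr_ge0// ltW.
have : u q ^+ 2 <= C * M by apply: le_trans (hC u q Hu) _; rewrite ler_pM2l.
move=> uq; rewrite -(@ler_sqr _ `|u q|) ?nnegrE ?addr_ge0// real_normK ?num_real//.
by apply: le_trans uq _; rewrite expr2; nra.
Qed.

Lemma normLp_eq u : H1 u -> exists2 B : R, 0 < B & P u = powint bmu p (bval u) /\
  (forall z, `|bval u z| <= B).
Proof.
move=> Hu; have [C C0 hC] := h1_bound.
have h0 : 0 <= h1sq u by rewrite addr_ge0 ?ip_ge0.
have B0 : 0 < C * h1sq u + 1 by rewrite ltr_wpDl// mulr_ge0// ltW.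
have uB q : `|u q| <= C * h1sq u + 1 by exact: hC.
exists (C * h1sq u + 1) => //; split; first exact: (normLp_powE hG p2 Hu uB).
by apply: bval_bounded => //; exact: ltW.
Qed.

Lemma H1_0 : H1 (fun _ : graph_point G => 0 : R).
Proof.
have b0 : bval (fun _ : graph_point G => 0 : R) = fun=> 0.
  by apply/funext => z; have [->//|[q ->]//] := bvalP hG z.
have s0 : sqi bmu (fun=> 0 : R).
  split; first exact: measurable_cst.
  by under eq_fun do rewrite expr0n; exact: integrable0.
apply: (@weak_grad_H1 _ _ hG _ (fun=> 0)); first by rewrite b0.
split => // e x y xy; rewrite itvint_cst// mul0r.
have [q ->] := on_edgeP hG e x; have [q' ->] := on_edgeP hG e y; exact: subrr.
Qed.

Lemma H1Z_0 : H (fun=> 0).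
Proof. by split; first exact: H1_0. Qed.

Lemma H1Z_lin (a : R) u v : H u -> H v -> H (fun q => a * u q + v q).
Proof.
move=> [Hu uZ] [Hv vZ]; split; first exact: H1_lin.
by move=> q qZ; rewrite uZ// vZ// mulr0 addr0.
Qed.

Lemma H1Z_complete (f : nat -> graph_point G -> R) : (forall n, H (f n)) ->
  (forall eps : R, 0 < eps -> exists k, forall m n, (k <= m)%N -> (k <= n)%N ->
     h1sq (fun q => f m q - f n q) <= eps) ->
  exists u, [/\ H u, forall q, f ^~ q @ \oo --> u q &
    forall eps : R, 0 < eps -> exists k, forall n, (k <= n)%N ->
      h1sq (fun q => f n q - u q) <= eps].
Proof.
move=> Hf cf; have [u [Hu fu fc]] := H1_complete hG e0 (fun n => (Hf n).1) cf.
exists u; split => //; split => // q qZ; apply: (cvg_unique (@Rhausdorff R) (fu q)); rewrite /=.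
have -> : f ^~ q = fun=> 0 by apply/funext => n; exact: (Hf n).2.
exact: cvg_cst.
Qed.

Lemma H1Z_split u : H u -> [/\ H (posp u), H (negp u),
  dform u u = dform (posp u) (posp u) + dform (negp u) (negp u),
  lform u u = lform (posp u) (posp u) + lform (negp u) (negp u) &
  P u = P (posp u) + P (negp u)].
Proof.
move=> [Hu uZ]; have [Hp Hn dE lE] := pos_neg_split hG Hu.
have [B B0 [-> uB]] := normLp_eq Hu.
have [Bp _ [-> pB]] := normLp_eq Hp; have [Bn _ [-> nB]] := normLp_eq Hn.
split => //.
- by split => // q qZ; rewrite uZ// maxxx.
- by split => // q qZ; rewrite uZ// minxx.
have pn0 : p != 0 by apply: lt0r_neq0; apply: lt_trans p2; rewrite ltr0n.
rewrite /powint -RintegralD//.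
- apply: eq_Rintegral => z _.
  rewrite (@bval_map _ _ hG (fun x => Num.max x 0))// ?maxxx//.
  rewrite (@bval_map _ _ hG (fun x => Num.min x 0))// ?minxx//.
  by case: (leP (bval u z) 0) => _; rewrite normr0 powR0// ?addr0 ?add0r.
- by apply: integrable_powR p2 _ pB; exact: sqi_bval.
- by apply: integrable_powR p2 _ nB; exact: sqi_bval.
Qed.

Lemma normLp_scale (t : R) u : H u -> P (fun q => t * u q) = `|t| `^ p * P u.
Proof.
move=> [Hu _]; have Htu : H1 (fun q => t * u q).
  by have := H1_lin hG t Hu H1_0; under eq_fun do rewrite addr0.
have [B _ [-> uB]] := normLp_eq Hu; have [B' _ [-> _]] := normLp_eq Htu.
rewrite /powint -RintegralZl//; last by apply: integrable_powR p2 _ uB; exact: sqi_bval.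
apply: eq_Rintegral => z _.
by rewrite (@bval_map _ _ hG (fun x => t * x)) ?mulr0// normrM powRM.
Qed.

Lemma normLp_gt0 u : H u -> u <> cst 0 -> 0 < P u.
Proof.
move=> [Hu _] u0; have [B _ [-> uB]] := normLp_eq Hu.
rewrite lt_neqAle powint_ge0 andbT eq_sym; apply/eqP => P0; apply: u0.
by apply: (lform_eq0 hG e0 Hu); apply: (powint_eq0 p2 _ uB P0); exact: sqi_bval.
Qed.

Lemma normLp_mono u v : H u -> H v -> (forall q, 0 <= u q <= v q) -> P u <= P v.
Proof.
move=> [Hu _] [Hv _] uv; have [B _ [-> uB]] := normLp_eq Hu; have [B' _ [-> vB]] := normLp_eq Hv.
apply: (powint_mono p2 _ _ vB); [exact: sqi_bval|exact: sqi_bval|move=> z].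
have [h|[q h]] := bvalP hG z; rewrite !h// ger0_norm ?ger0_norm//.
all: by have /andP[u0 uvq] := uv q; rewrite ?(le_trans u0).
Qed.

Lemma h1sq_gt0 u : H u -> u <> cst 0 -> 0 < h1sq u.
Proof.
move=> [Hu _] u0; rewrite lt_neqAle addr_ge0 ?ip_ge0// andbT eq_sym; apply/eqP => h0; apply: u0.
apply: (lform_eq0 hG e0 Hu); have := h0; rewrite /h1sq.
have := ip_ge0 bmu (gder u); have := ip_ge0 bmu (bval u); rewrite -/(dform u u) -/(lform u u).
by move: (dform u u) (lform u u) => a b; lra.
Qed.

Lemma normLp_cvg (f : nat -> graph_point G -> R) u M : (forall n, H (f n)) ->
  (forall n, h1sq (f n) <= M) -> H u -> (forall q, f ^~ q @ \oo --> u q) ->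
  (fun n => P (f n) - P (fun q => f n q - u q)) @ \oo --> P u.
Proof.
move=> Hf fM [Hu _] fu; have [C C0 hC] := h1_bound.
have M0 : 0 <= M by apply: le_trans (fM 0%N); rewrite addr_ge0 ?ip_ge0.
have h0 : 0 <= h1sq u by rewrite addr_ge0 ?ip_ge0.
pose B := C * (M + h1sq u) + 1.
have B0 : 0 < B by apply: ltr_wpDl => //; apply: mulr_ge0; [exact: ltW|exact: addr_ge0].
have fB n z : `|bval (f n) z| <= B.
  apply: (bval_bounded hG (ltW B0)) => q; apply: hC; first by have [] := Hf n.
  by apply: le_trans (fM n) _; rewrite lerDl.
have uB z : `|bval u z| <= B.
  apply: (bval_bounded hG (ltW B0)) => q; apply: hC => //.
  by rewrite lerDr.
have Pf n : P (f n) = powint bmu p (bval (f n)) by have [b _ [-> _]] := normLp_eq (Hf n).1.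
have Pu : P u = powint bmu p (bval u) by have [b _ [-> _]] := normLp_eq Hu.
have Pd n : P (fun q => f n q - u q) = powint bmu p (fun z => bval (f n) z - bval u z).
  have [b _ [-> _]] := normLp_eq (H1B hG (Hf n).1 Hu); congr powint.
  by apply/funext => z; exact: bvalB.
under eq_fun do rewrite Pf Pd; rewrite Pu.
apply: (@brezis_lieb _ _ _ bmu p B (2 * M + 2 * h1sq u)) => //.
- by move=> n; exact: (sqi_bval hG (Hf n).1).
- exact: (sqi_bval hG Hu).
- move=> n; have sf : sqi bmu (bval (f n)) by exact: (sqi_bval hG (Hf n).1).
  have su := sqi_bval hG Hu.
  have := ipD2 1 sf su; have := ipD2 (-1) su sf.
  have := ip_ge0 bmu (fun z => 1 * bval (f n) z + bval u z).
  have -> : (fun z => bval (f n) z - bval u z) = (fun z => -1 * bval u z + bval (f n) z).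
    by apply/funext => z; rewrite mulN1r addrC.
  have := fM n; have := ip_ge0 bmu (gder (f n)); have := ip_ge0 bmu (gder u).
  rewrite /h1sq /dform /lform (ipC bmu (bval u) (bval (f n))).
  move: (ip _ (fun _ => -1 * _ + _) _) (ip _ (fun _ => 1 * _ + _) _).
  move: (ip _ (bval (f n)) (bval (f n))) (ip _ (bval u) (bval u)) (ip _ (bval (f n)) (bval u)).
  move: (ip _ (gder (f n)) (gder (f n))) (ip _ (gder u) (gder u)).
  by move=> a b c d e x y; lra.
- exact: bval_cvg.
Qed.

Lemma omega_coercive : exists2 d : R, 0 < d & forall u, H u -> d * h1sq u <= dform u u + lam * lform u u.
Proof.
have [c c0 [cl hc]] : exists2 c : R, 0 <= c & 0 < c + lam /\
    forall u, H u -> c * lform u u <= dform u u.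
  have quot u : H u -> u <> cst 0 -> (omega_Z Z <= (dform u u / lform u u)%:E)%E.
    move=> Hu u0; apply: ereal_inf_lbound; exists u => //.
    by rewrite (normL2sq_derivE hG) ?(normL2sqE hG)//; case: Hu.
  have lpos u : H u -> u <> cst 0 -> 0 < lform u u.
    move=> [Hu _] u0; rewrite lt_neqAle ip_ge0 andbT eq_sym; apply/eqP => l0.
    by apply: u0; exact: (lform_eq0 hG e0 Hu).
  have bound c : (c%:E <= omega_Z Z)%E -> forall u, H u -> c * lform u u <= dform u u.
    move=> co u Hu; have [->|u0] := pselect (u = cst 0).
      have b0 : bval (cst 0 : graph_point G -> R) = fun=> 0.
        by apply/funext => z; have [->//|[q ->]//] := bvalP hG z.
      rewrite [lform _ _](_ : _ = 0) ?mulr0 ?ip_ge0//.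
      by rewrite /lform /ip b0; under eq_Rintegral do rewrite mulr0; rewrite Rintegral_cst// mul0r.
    rewrite -ler_pdivlMr ?lpos// -lee_fin; exact: le_trans co (quot u Hu u0).
  have om0 : (0 <= omega_Z Z)%E.
    apply: le_ereal_inf_tmp => _ [u [Hu u0] <-]; rewrite lee_fin.
    by rewrite (normL2sq_derivE hG) ?(normL2sqE hG) ?divr_ge0 ?ip_ge0//; case: Hu.
  case E : (omega_Z Z) om0 hlambda => [w| |]// om0.
    rewrite -EFinN lte_fin => wl; exists w; first by rewrite lee_fin in om0.
    by split; [lra|apply: bound; rewrite E].
  (* Here [omega_Z] is +oo, the infimum of an empty set of quotients; any c with c + lam > 0 will
     do. *)
  move=> _; exists (`|lam| + 1); first by rewrite addr_ge0.
  split; first by have := ler_norm (- lam); rewrite normrN; lra.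
  by apply: bound; rewrite E leey.
(* Both bounds on d serve the identity below: they make 1 - d and c + lam - d (c + 1), the
   coefficients of D - c L and of L, nonnegative. *)
pose d := Num.min 1 ((c + lam) / (c + 1)).
have c1 : 0 < c + 1 by lra.
have d0 : 0 < d by rewrite lt_min ltr01 divr_gt0.
have d1 : d <= 1 by rewrite ge_min lexx.
have dc : d * (c + 1) <= c + lam by rewrite -ler_pdivlMr// ge_min lexx orbT.
exists d => // u Hu; have := hc u Hu; have := ip_ge0 bmu (bval u).
rewrite /h1sq -/(lform u u); move: (lform u u) (dform u u) => l D l0 lD.
rewrite -subr_ge0.
have -> : D + lam * l - d * (D + l) = (1 - d) * (D - c * l) + (c + lam - d * (c + 1)) * l by ring.
by rewrite addr_ge0// mulr_ge0// ?subr_ge0.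
Qed.

Local Notation dform := (@dform R G).
Local Notation lform := (@lform R G).

Let dlin (a : R) u v w : H u -> H v -> H w ->
  dform (fun q => a * u q + v q) w = a * dform u w + dform v w.
Proof. by move=> [Hu _] [Hv _] [Hw _]; exact: dform_lin. Qed.

Let llin (a : R) u v w : H u -> H v -> H w ->
  lform (fun q => a * u q + v q) w = a * lform u w + lform v w.
Proof. by move=> [Hu _] [Hv _] [Hw _]; exact: lform_lin. Qed.

Let dCS u v : H u -> H v -> dform u v ^+ 2 <= dform u u * dform v v.
Proof. by move=> [Hu _] [Hv _]; apply: ip_sqr_le; exact: (sqi_gder hG). Qed.

Let lCS u v : H u -> H v -> lform u v ^+ 2 <= lform u u * lform v v.
Proof. by move=> [Hu _] [Hv _]; apply: ip_sqr_le; exact: (sqi_bval hG). Qed.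

Let dsym u v : dform u v = dform v u. Proof. exact: ipC. Qed.
Let lsym u v : lform u v = lform v u. Proof. exact: ipC. Qed.
Let dge0 u : 0 <= dform u u. Proof. exact: ip_ge0. Qed.
Let lge0 u : 0 <= lform u u. Proof. exact: ip_ge0. Qed.

Let Hcomp (f : nat -> graph_point G -> R) M : (forall n, H (f n)) ->
  (forall n, h1sq (f n) <= M) ->
  exists phi : nat -> nat, (forall n, (n <= phi n)%N) /\ forall q, cvgn (fun n => f (phi n) q).
Proof. by move=> Hf fM; exact: (H1_compact hG e0 (fun n => (Hf n).1) fM). Qed.

Lemma actionE u : H1 u -> action_functional p lam u = action dform lform P p lam u.
Proof. by move=> Hu; rewrite /action_functional /action (normL2sq_derivE hG Hu) (normL2sqE hG Hu). Qed.

Lemma NehariE : Nehari p lam Z = nehari_set H dform lform P lam.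
Proof.
apply/seteqP; split => u [Hu u0 QP]; split => //; move: QP; have [Hu1 _] := Hu.
  by rewrite (normL2sq_derivE hG Hu1) (normL2sqE hG Hu1).
by rewrite (normL2sq_derivE hG Hu1) (normL2sqE hG Hu1).
Qed.

Lemma nodal_NehariE : nodal_Nehari p lam Z = nodal_set H dform lform P lam.
Proof. by rewrite /nodal_Nehari NehariE. Qed.

Lemma action_levelE (A : set (graph_point G -> R)) : A `<=` H ->
  action_level p lam A = level dform lform P p lam A.
Proof.
move=> AH; rewrite /action_level /level; congr ereal_inf.
by apply/seteqP; split => _ [u Au <-]; exists u => //; rewrite actionE//; have [] := AH u Au.
Qed.

Lemma level_at_infinity_le (f : nat -> graph_point G -> R) :
  (forall n, nehari_set H dform lform P lam (f n)) ->
  (forall F, dual_functional H (hnorm dform lform) F -> (fun n => F (f n)) @ \oo --> (0 : R)) ->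
  (level_at_infinity p lam Z <= limn_einf (fun n => (action dform lform P p lam (f n))%:E))%E.
Proof.
move=> fN fw; have fH n : H (f n) by have [] := fN n.
apply: ereal_inf_lbound; exists f; last first.
  by congr limn_einf; apply/funext => n; rewrite actionE//; have [] := fH n.
split; first by move=> n; rewrite NehariE.
split => // F [Fl [C FC]]; apply: fw; split => //; exists C => u Hu.
have [Hu1 _] := Hu; apply: le_trans (FC u Hu) _.
by rewrite /H1_norm (normL2sq_derivE hG Hu1) (normL2sqE hG Hu1).
Qed.

Lemma graph_ground_state_exists :
  (action_level p lam (Nehari p lam Z) < level_at_infinity p lam Z)%E ->
  exists u, is_ground_state p lam Z u.
Proof.
rewrite /is_ground_state NehariE action_levelE; last by move=> u [].
move=> h.
have [u [uN uL]] := ground_state_exists p2 H1Z_0 H1Z_lin dsym lsym dlin llin dge0 lge0 dCS lCS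
  H1Z_complete Hcomp normLp_scale normLp_gt0 h1sq_gt0 normLp_cvg omega_coercive level_at_infinity_le h.
by exists u; split => //; rewrite actionE//; have [[]] := uN.
Qed.

Lemma graph_nodal_state_exists :
  (action_level p lam (nodal_Nehari p lam Z) <
     level_at_infinity p lam Z + action_level p lam (Nehari p lam Z))%E ->
  exists u, is_nodal_ground_state p lam Z u.
Proof.
rewrite /is_nodal_ground_state nodal_NehariE NehariE !action_levelE; first last.
- by move=> u [].
- by move=> u [].
move=> h.
have [u [uN uL]] := nodal_state_exists p2 H1Z_0 H1Z_lin dsym lsym dlin llin dge0 lge0 dCS lCS
  H1Z_complete Hcomp H1Z_split normLp_scale normLp_gt0 h1sq_gt0 normLp_cvg omega_coercive
  level_at_infinity_le h.
by exists u; split => //; rewrite actionE//; have [[]] := uN.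
Qed.

Hypothesis hZ : forall x : vertex G, Z x -> vertex_degree x = 1%N.

Lemma nonneg_ground_state_gt0 u : ground_state H dform lform P p lam u ->
  (forall q, 0 <= u q) -> forall q, ~ vertex_points Z q -> 0 < u q.
Proof.
move=> gu u0 q qZ; have [[[Hu _] un0 _] _] := gu.
apply: (supersolution_positive hG e0 hZ Hu u0 _ un0 qZ) => v Hv v0.
exact: (ground_state_supersolution p2 H1Z_0 H1Z_lin dsym lsym dlin llin dge0 lge0
  normLp_scale normLp_gt0 normLp_mono h1sq_gt0 omega_coercive gu u0 Hv v0).
Qed.

Lemma graph_ground_state_sign u : is_ground_state p lam Z u ->
  (forall q, ~ vertex_points Z q -> 0 < u q) \/ (forall q, ~ vertex_points Z q -> u q < 0).
Proof.
move=> uG; have gu : ground_state H dform lform P p lam u.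
  move: uG; rewrite /is_ground_state NehariE action_levelE; last by move=> v [].
  by move=> [uN]; rewrite actionE//; have [[]] := uN.
have [pz|nz] := ground_state_sign p2 H1Z_0 H1Z_lin dsym lsym dlin llin dge0 lge0 H1Z_split
  normLp_scale normLp_gt0 h1sq_gt0 omega_coercive gu.
- right=> q qZ; rewrite -oppr_gt0 -mulN1r.
  apply: (nonneg_ground_state_gt0
    (ground_state_opp H1Z_0 H1Z_lin dsym lsym dlin llin normLp_scale gu) _ qZ) => r.
  rewrite mulN1r oppr_ge0; have := congr1 (@^~ r) pz => /= <-.
  by rewrite le_max lexx.
- left; apply: (nonneg_ground_state_gt0 gu) => r.
  by have := congr1 (@^~ r) nz => /= <-; rewrite ge_min lexx.
Qed.

End GraphAction.

Theorem theorem1p3 (R : realType) (p lambda : R) (G : metric_graph R)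
    (Z : set (vertex G))
    (hp : 2 < p)
    (hG : class_G G)
    (hnc : noncompact_graph G)
    (hZ : forall v : vertex G, Z v -> ~ infinity_vertices v /\ vertex_degree v = 1%N)
    (hlambda : (- omega_Z Z < lambda%:E)%E) :
  (((action_level p lambda (Nehari p lambda Z) < level_at_infinity p lambda Z)%E ->
      exists u : graph_point G -> R, is_ground_state p lambda Z u) /\
   (forall u : graph_point G -> R, is_ground_state p lambda Z u ->
      (forall q : graph_point G, ~ vertex_points Z q -> 0 < u q) \/
      (forall q : graph_point G, ~ vertex_points Z q -> u q < 0)))
  /\
  ((action_level p lambda (nodal_Nehari p lambda Z) <
      level_at_infinity p lambda Z + action_level p lambda (Nehari p lambda Z))%E ->
   exists u : graph_point G -> R, is_nodal_ground_state p lambda Z u).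
Proof.
(* Noncompactness provides an edge; by connectedness every graph point then lies on some edge, as
   [graph_point_on_edge] states. *)
have [e0 _] : exists e0 : edge G, True.
  case: hnc => [[e _]|inf]; first by exists e.
  by have [e _] := infinite_setN0 inf; exists e.
split; first split.
- exact: (graph_ground_state_exists hp hG e0 hlambda).
- move=> u; apply: (graph_ground_state_sign hp hG e0 hlambda).
  by move=> v /hZ[].
- exact: (graph_nodal_state_exists hp hG e0 hlambda).
Qed.
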